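(* Suppose that $M>0$. Let $\{t_n\}_{n=0}^{+\infty}$ be the sequence constructed by bisection from $M$ and an arbitrary $t_0>0$ as described in the context. Let $u_*$ be the optimal control to $(TP)^M$. Let $u_n=(u_n^1,\dots,u_n^d)$, $n\in\mathbb{N}$, be defined by $$u_n^i(t)=\left(\int_0^{t_n}\sum_{j=1}^d k_j|\langle b_j,\hat{\varphi}_n(t)\rangle|\,dt\right)\frac{k_i\langle b_i,\hat{\varphi}_n(t)\rangle}{|\langle b_i,\hat{\varphi}_n(t)\rangle|}\quad\text{for a.e. }t\in(0,+\infty),\ i=1,\dots,d,$$ where $\hat{\varphi}_n(\cdot)$ is the solution to the dual equation $\varphi'(t)-A^*(t)\varphi(t)=0$ with $\varphi(t_n)=\hat{\varphi}_{t_n}$, and $\hat{\varphi}_{t_n}$ is a minimizer of the functional $J^{t_n}$. Then $$t_n\to t^*(M)\quad\text{as } n\to+\infty,$$ and for each $i$ with $1\le i\le d$, $$u_n^i\to u_*^i\quad\text{in } L^2(0,t^*(M);\mathbb{R})\text{ as } n\to+\infty.$$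
   Context: Let $m,d\ge 1$ be integers, $A(\cdot)\in C([0,+\infty);\mathbb{R}^{m\times m})$, $b_1,\dots,b_d\in\mathbb{R}^m$, and $y_0\in\mathbb{R}^m$ with $y_0\neq 0$. $\langle\cdot,\cdot\rangle$ and $\|\cdot\|$ are the Euclidean inner product and norm on $\mathbb{R}^m$, and $A^*$ is the transpose of $A$. The controlled equation is $$y'(t)+A(t)y(t)=\sum_{i=1}^d b_iu^i(t),\quad t\ge 0,\qquad y(0)=y_0,$$ and $y(\cdot;u)$ denotes its solution for the control $u=(u^1,\dots,u^d)$ (also when the time horizon $(0,+\infty)$ is replaced by $(0,T)$). The dual equation is $\varphi'(t)-A^*(t)\varphi(t)=0$, $t\in[0,+\infty)$. Standing assumptions: (1) $A(\cdot)$ is real analytic on $(0,+\infty)$. (2) (Conti's condition) For each $i=1,\dots,d$ and each nonzero solution $\varphi$ of the dual equation, $\int_0^{+\infty}|\langle b_i,\varphi(t)\rangle|\,dt=+\infty$. Fix numbers $1=k_1\ge k_2\ge\cdots\ge k_d>0$. For $M>0$, $$\mathcal{U}^M=\{u=(u^1,\dots,u^d):(0,+\infty)\to\mathbb{R}^d \text{ measurable};\ |u^i(t)|\le k_iM\text{ for a.e. }t\in(0,+\infty)\text{ and all }i=1,\dots,d\}.$$ The time optimal control problem $(TP)^M$ is $\inf\{T>0;\ y(T;u)=0,\ u\in\mathcal{U}^M\}$. Its optimal time is $t^*(M)=\inf\{T>0;\ y(T;u)=0,\ u\in\mathcal{U}^M\}$, and an optimal control is a $u_*\in\mathcal{U}^M$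 with $y(t^*(M);u_* )=0$ (it exists and is unique up to null sets on $(0,t^*(M))$). For $T>0$, $$\mathcal{V}^T=\{v=(v^1,\dots,v^d)\in L^\infty(0,T;\mathbb{R}^d);\ |v^i(t)|\le k_i\|v^1\|_{L^\infty(0,T;\mathbb{R})}\text{ for a.e. }t\in(0,T)\text{ and all }i=1,\dots,d\},$$ $$\widetilde{M}(T)=\inf\{\|v^1\|_{L^\infty(0,T;\mathbb{R})};\ y(T;v)=0,\ v\in\mathcal{V}^T\}.$$ For $T>0$, the functional $J^T:\mathbb{R}^m\to\mathbb{R}$ is $$J^T(\varphi_T)=\frac12\left(\int_0^T\sum_{i=1}^d k_i|\langle b_i,\varphi(t)\rangle|\,dt\right)^2+\langle\varphi(0),y_0\rangle,$$ where $\varphi(\cdot)$ is the solution of the dual equation with $\varphi(T)=\varphi_T$. Under the standing assumptions $J^T$ has a minimizer in $\mathbb{R}^m$. Construction of $\{t_n\}_{n=0}^{+\infty}$: let $t_0>0$ be arbitrary and let $K=\min\{k\in\mathbb{N},\,k\ge1;\ \widetilde{M}(kt_0)<M\}$ (such a $K$ exists). Set $a_0=0$, $b_0=Kt_0$ and $t_1=(a_0+b_0)/2$. In general, for $n\ge1$, given $a_{n-1},b_{n-1}$ and $t_n=(a_{n-1}+b_{n-1})/2$, set $[a_n,b_n]=[t_n,b_{n-1}]$ if $\widetilde{M}(t_n)>M$, $[a_n,b_n]=[a_{n-1},t_n]$ if $\widetilde{M}(t_n)\le M$, and $t_{n+1}=(a_n+b_n)/2$. *)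

(* Defs.v *)
From HB Require Import structures.
From mathcomp Require Import all_boot all_order all_algebra.
From mathcomp Require Import all_classical all_reals all_analysis.
Import Order.TTheory GRing.Theory Num.Theory.
Import numFieldNormedType.Exports.

Set Implicit Arguments.
Unset Strict Implicit.
Unset Printing Implicit Defensive.

Local Open Scope classical_set_scope.
Local Open Scope ring_scope.

(** Dimensions [m, d >= 1] are written [m.+1] and [d.+1]: the state space R^m is
    ['cV[R]_m.+1], and the paper's index [1] in [1, ..., d] is [ord0 : 'I_d.+1].
    Functions on [0, +oo) or (0, T) are total functions on [R] of which only the
    values on that interval are ever constrained or used.  Measurability is with
    respect to the Borel sets, on which [lebesgue_measure] is defined. *)

Definition inner (R : realType) (m : nat) (x y : 'cV[R]_m.+1) : R :=
  \sum_(i < m.+1) x i ord0 * y i ord0.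

Definition real_analytic_on (R : realType) (m : nat) (D : set R)
    (A : R -> 'M[R]_m.+1) : Prop :=
  forall s, D s ->
    exists2 r : R, 0 < r &
    exists c : nat -> 'M[R]_m.+1, forall t, `|t - s| < r ->
      (\sum_(k < n) (t - s) ^+ k *: c k) @[n --> \oo] --> A t.

(** Classical solutions of [phi' - A^* phi = 0] on [0, +oo), the derivative at
    the endpoint [0] being one-sided. *)
Definition dual_solution (R : realType) (m : nat) (A : R -> 'M[R]_m.+1)
    (phi : R -> 'cV[R]_m.+1) : Prop :=
  (forall t : R, 0 < t -> is_derive t 1 phi ((A t)^T *m phi t)) /\
  h^-1 *: (phi h - phi 0) @[h --> 0^'+] --> (A 0)^T *m phi 0.

Definition conti (R : realType) (m d : nat) (A : R -> 'M[R]_m.+1)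
    (b : 'I_d.+1 -> 'cV[R]_m.+1) : Prop :=
  forall (i : 'I_d.+1) (phi : R -> 'cV[R]_m.+1),
    dual_solution A phi -> (exists2 t : R, 0 <= t & phi t != 0) ->
    (\int[lebesgue_measure]_(t in `]0%R, +oo[) `|inner (b i) (phi t)|%:E = +oo)%E.

(** Controls being merely measurable, [y' + A y = \sum_i u_i b_i], [y 0 = y0] is
    understood in the sense of Caratheodory, i.e. as an integral equation
    (written componentwise), for all [t] in [D] = [[0, T]] or [[0, +oo)]. *)
Definition state_solution (R : realType) (m d : nat) (A : R -> 'M[R]_m.+1)
    (b : 'I_d.+1 -> 'cV[R]_m.+1) (y0 : 'cV[R]_m.+1) (u : 'I_d.+1 -> R -> R)
    (D : set R) (y : R -> 'cV[R]_m.+1) : Prop :=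
  let rhs j s := (\sum_(i < d.+1) u i s *: b i - A s *m y s) j ord0 in
  {within D, continuous y} /\
  forall t, D t -> forall j : 'I_m.+1,
    lebesgue_measure.-integrable `[0, t] (EFin \o rhs j) /\
    y t j ord0 = y0 j ord0 + \int[lebesgue_measure]_(s in `[0, t]) rhs j s.

(** [y(T; u) = 0], where the solution [y(.; u)] lives on [D]. *)
Definition steers_to_zero (R : realType) (m d : nat) (A : R -> 'M[R]_m.+1)
    (b : 'I_d.+1 -> 'cV[R]_m.+1) (y0 : 'cV[R]_m.+1) (D : set R) (T : R)
    (u : 'I_d.+1 -> R -> R) : Prop :=
  exists2 y : R -> 'cV[R]_m.+1, state_solution A b y0 u D y & y T = 0.

Definition admissible_U (R : realType) (d : nat) (k : 'I_d.+1 -> R) (M : R) :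
    set ('I_d.+1 -> R -> R) :=
  [set u : 'I_d.+1 -> R -> R | forall i : 'I_d.+1,
     measurable_fun (`]0, +oo[ : set R) (u i) /\
     {ae lebesgue_measure, forall t, 0 < t -> `|u i t| <= k i * M}].

(** An infimum in [\bar R], so that it is [+oo] for an infeasible problem. *)
Definition opt_time (R : realType) (m d : nat) (A : R -> 'M[R]_m.+1)
    (b : 'I_d.+1 -> 'cV[R]_m.+1) (y0 : 'cV[R]_m.+1) (k : 'I_d.+1 -> R) (M : R) :
    \bar R :=
  ereal_inf [set T%:E | T in [set T : R | 0 < T /\
    exists2 u, admissible_U k M u & steers_to_zero A b y0 `[0, +oo[ T u]].

Definition optimal_control (R : realType) (m d : nat) (A : R -> 'M[R]_m.+1)
    (b : 'I_d.+1 -> 'cV[R]_m.+1) (y0 : 'cV[R]_m.+1) (k : 'I_d.+1 -> R) (M : R)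
    (u : 'I_d.+1 -> R -> R) : Prop :=
  admissible_U k M u /\
  exists2 T : R, opt_time A b y0 k M = T%:E &
    steers_to_zero A b y0 `[0, +oo[ T u.

(** The norm of [L^p(0, T)], the function being extended by [0]. *)
Definition Lp_norm (R : realType) (p : \bar R) (T : R) (f : R -> R) : \bar R :=
  'N[lebesgue_measure]_p[EFin \o (f \_ `]0, T[)].

Definition admissible_V (R : realType) (d : nat) (k : 'I_d.+1 -> R) (T : R) :
    set ('I_d.+1 -> R -> R) :=
  [set v : 'I_d.+1 -> R -> R | forall i : 'I_d.+1,
     [/\ measurable_fun (`]0, T[ : set R) (v i),
         (Lp_norm +oo T (v i) < +oo)%E &
         {ae lebesgue_measure, forall t, 0 < t < T ->
            (`|v i t|%:E <= (k i)%:E * Lp_norm +oo T (v ord0))%E}]].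

Definition min_norm (R : realType) (m d : nat) (A : R -> 'M[R]_m.+1)
    (b : 'I_d.+1 -> 'cV[R]_m.+1) (y0 : 'cV[R]_m.+1) (k : 'I_d.+1 -> R) (T : R) :
    \bar R :=
  ereal_inf [set Lp_norm +oo T (v ord0) |
    v in admissible_V k T `&` steers_to_zero A b y0 `[0, T] T].

(** The solution of the dual equation with [phi T = z]; it exists and is unique on
    [0, +oo), so the default value of [xget] plays no role. *)
Definition dual_flow (R : realType) (m : nat) (A : R -> 'M[R]_m.+1) (T : R)
    (z : 'cV[R]_m.+1) : R -> 'cV[R]_m.+1 :=
  xget (cst 0) [set phi | dual_solution A phi /\ phi T = z].

Definition weighted_integral (R : realType) (m d : nat)
    (b : 'I_d.+1 -> 'cV[R]_m.+1) (k : 'I_d.+1 -> R) (T : R)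
    (phi : R -> 'cV[R]_m.+1) : R :=
  \int[lebesgue_measure]_(t in `]0, T[)
    \sum_(i < d.+1) k i * `|inner (b i) (phi t)|.

Definition J (R : realType) (m d : nat) (A : R -> 'M[R]_m.+1)
    (b : 'I_d.+1 -> 'cV[R]_m.+1) (y0 : 'cV[R]_m.+1) (k : 'I_d.+1 -> R) (T : R)
    (z : 'cV[R]_m.+1) : R :=
  2^-1 * weighted_integral b k T (dual_flow A T z) ^+ 2
  + inner (dual_flow A T z 0) y0.

Section Bisection.
Variables (R : realType) (Mt : R -> \bar R) (M t0 : R) (K : nat).

Definition first_multiple : Prop :=
  [/\ (1 <= K)%N, (Mt (K%:R * t0) < M%:E)%E &
      forall l : nat, (1 <= l)%N -> (Mt (l%:R * t0) < M%:E)%E -> (K <= l)%N].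

Fixpoint bracket (n : nat) : R * R :=
  if n is n'.+1 then
    let: (a, b) := bracket n' in
    let t := (a + b) / 2 in
    if (M%:E < Mt t)%E then (t, b) else (a, t)
  else (0, K%:R * t0).

Definition bisection (n : nat) : R :=
  if n is n'.+1 then ((bracket n').1 + (bracket n').2) / 2 else t0.

End Bisection.

(* Main.v *)
Require Import Defs.
From mathcomp Require Import all_boot all_order all_algebra.
From mathcomp Require Import all_classical all_reals all_analysis.
From mathcomp Require Import measurable_realfun ess_sup_inf.
From mathcomp Require Import ring lra.
Import Order.TTheory GRing.Theory Num.Theory.
Import numFieldNormedType.Exports.
Local Open Scope classical_set_scope.
Local Open Scope ring_scope.
Set Implicit Arguments.
Unset Strict Implicit.

(** Parametrise the solutions of the dual equation by their initial value: such a
    solution is [F t *m z], where [F] is the flow.  Put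
    [p_i z t = <b_i, F t *m z>] and [N T z = \int_0^T \sum_i k_i |p_i z|].

    Integrating the product of a dual solution and of the state by parts shows that
    a control [u] steers [y0] to [0] at time [T] exactly when its moments vanish:
    [<z, y0> + \int_0^T \sum_i u_i p_i z = 0] for all [z] ([dual_flow_exists]).
    Where [A] is analytic a dual solution is the sum of its Taylor series, so each
    [p_i z] either vanishes identically on [(0, +oo)] or has isolated zeros; Conti's
    condition excludes the former when [z] is nonzero, hence [p_i z] is nonzero
    almost everywhere and [N T] is a norm.

    The rest is a duality argument.  A control with [|u_i| <= k_i L] and vanishing
    moments forces [L * N T z + <z, y0> >= 0] for all [z] ([moment_bound]).
    Conversely, under these inequalities some sign control [l k_i sgn (p_i z)] with
    [l <= L] has vanishing moments: take for [l] the least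
    size for which the inequalities hold and for [z] a direction in which one of them
    is an equality; there the convex function [h |-> l * N T h + <h, y0>] is minimal
    and differentiable ([sign_control_moment], [moment_feasible]).  So for [T > 0]
    both [min_norm T <= M] and [t^* <= T] are equivalent to these inequalities with
    [L = M] ([min_norm_leP], [optimal_controlP]), and bisection on the sign of
    [min_norm t - M] converges to [t^*] ([bisection_cvg]).

    A minimizer of [J^T] is described by [z] with [N T z ^ 2 = - <z, y0>] for which
    [L = N T z] satisfies the inequalities ([J_minimizer]).  Hence [u_n] is the
    sign control of size [L_n = N t_n z_n], and it steers [y0] to [0] at time
    [t_n].  At the optimal time the inequalities with [L = M] become an equality
    for some nonzero [z] ([exhausting_direction]), since otherwise a shorter time
    would do; in that direction the moment of the optimal control is as large as
    its bound permits, so that [u_*] is bang-bang ([bang_bang]).  The control [u_n]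
    has the same moment up to an error [O(|t_n - t^*|)], and
    [L_n <= M + O(|t_n - t^*|)]; therefore
    [\int_0^t^* \sum_i |u_n^i - u_*^i| |p_i z|] is [O(|t_n - t^*|)]
    ([control_gap], [gap_estimate]).  As the controls are uniformly bounded and the
    weight [|p_i z|] is nonzero almost everywhere, this weighted convergence implies
    convergence in [L^2] ([weighted_cvg_L2]). *)

(** * Real-valued integrals *)

Section GenericIntegrals.
Context d (T : measurableType d) (R : realType) (mu : {measure set T -> \bar R}).
Notation "f \Rint D" := (mu.-integrable D (EFin \o f)) (at level 50).
Implicit Types (f g : T -> R) (D : set T).

Lemma ae_imply (P Q : T -> Prop) : (forall t, P t -> Q t) ->
  {ae mu, forall t, P t} -> {ae mu, forall t, Q t}.
Proof. by move=> PQ; apply: filterS. Qed.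

Lemma ae_imply2 (P Q S : T -> Prop) : (forall t, P t -> Q t -> S t) ->
  {ae mu, forall t, P t} -> {ae mu, forall t, Q t} -> {ae mu, forall t, S t}.
Proof. by move=> PQ; apply: filterS2. Qed.

Lemma ae_forall (I : finType) (P : I -> T -> Prop) :
  (forall i, {ae mu, forall t, P i t}) -> {ae mu, forall t, forall i, P i t}.
Proof. by move=> h; apply: filter_forall. Qed.

Lemma RintegrableD D f g : measurable D -> f \Rint D -> g \Rint D ->
  (fun x => f x + g x) \Rint D.
Proof. by move=> mD; apply: integrableD. Qed.

Lemma RintegrableB D f g : measurable D -> f \Rint D -> g \Rint D ->
  (fun x => f x - g x) \Rint D.
Proof. by move=> mD; apply: integrableB. Qed.

Lemma RintegrableZ D c f : measurable D -> f \Rint D ->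
  (fun x => c * f x) \Rint D.
Proof. by move=> mD; apply: integrableZl. Qed.

Lemma Rintegrable_sum D (I : finType) (F : I -> T -> R) : measurable D ->
  (forall i, F i \Rint D) -> (fun x => \sum_i F i x) \Rint D.
Proof.
move=> mD iF.
have -> : EFin \o (fun x => \sum_i F i x) = fun x => (\sum_i (F i x)%:E)%E.
  by apply/funext => x /=; rewrite sumEFin.
by apply: integrable_sum => // i _; exact: iF.
Qed.

Lemma Rintegral_sum D (I : finType) (F : I -> T -> R) :
  measurable D -> (forall i, F i \Rint D) ->
  \int[mu]_(x in D) (\sum_i F i x) = \sum_i \int[mu]_(x in D) F i x.
Proof.
move=> mD iF; rewrite /Rintegral.
under eq_integral do rewrite -sumEFin.
rewrite (integral_sum mD iF) sum_fine// => i _.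
exact: (integrable_fin_num mD (iF i)).
Qed.

Lemma Rintegrable_mul_bounded f g D : measurable D -> f \Rint D ->
  measurable_fun D g -> (exists C : R, forall x, D x -> `|g x| <= C) ->
  (fun x => g x * f x) \Rint D.
Proof.
move=> mD fi mg [C gC]; apply: (@integrableMr _ _ _ _ _ mD g (EFin \o f)) => //.
exists C; split; first exact: num_real.
by move=> x Cx t Dt; exact: le_trans (gC t Dt) (ltW Cx).
Qed.

Lemma RintegrableS f (D E : set T) : measurable E -> measurable D -> D `<=` E ->
  f \Rint E -> f \Rint D.
Proof. by move=> mE mD DE; apply: integrableS. Qed.

Lemma Rintegrable_measurable f D : f \Rint D -> measurable_fun D f.
Proof. by move=> /integrableP[mf _]; exact/measurable_EFinP. Qed.

Lemma Rintegrable_le f g D : measurable D -> measurable_fun D f -> g \Rint D ->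
  {ae mu, forall t, D t -> `|f t| <= g t} -> f \Rint D.
Proof.
move=> mD mf gi fg; apply/integrableP; split; first exact/measurable_EFinP.
have /integrableP[mg]:= gi; apply: le_lt_trans.
apply: ae_ge0_le_integral => //.
- by apply/measurable_EFinP; apply: measurableT_comp.
- by apply: measurableT_comp.
- apply: ae_imply fg => t h /= Dt; rewrite lee_fin; exact: le_trans (h Dt) (ler_norm _).
Qed.

Lemma le_Rintegral_ae D f g : measurable D -> f \Rint D -> g \Rint D ->
  {ae mu, forall t, D t -> f t <= g t} ->
  \int[mu]_(x in D) f x <= \int[mu]_(x in D) g x.
Proof.
move=> mD fi gi fg; rewrite -subr_ge0 -RintegralB//.
have mfg : measurable_fun D (fun x => g x - f x).
  by apply: measurable_funB; exact: Rintegrable_measurable.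
rewrite /Rintegral.
rewrite (@ae_eq_integral _ _ _ _ D (fun x => `|g x - f x|%:E))//; first last.
- by apply: ae_imply fg => t h Dt; rewrite ger0_norm// subr_ge0 h.
- by apply/measurable_EFinP; apply: measurableT_comp.
- exact/measurable_EFinP.
by apply: fine_ge0; apply: integral_ge0 => x _; rewrite lee_fin.
Qed.

Lemma eq_Rintegral_ae D f g : measurable D -> f \Rint D -> g \Rint D ->
  {ae mu, forall t, D t -> f t = g t} ->
  \int[mu]_(x in D) f x = \int[mu]_(x in D) g x.
Proof.
move=> mD fi gi fg; apply/eqP; rewrite eq_le !le_Rintegral_ae//.
- by apply: ae_imply fg => t h Dt; rewrite h.
- by apply: ae_imply fg => t h Dt; rewrite h.
Qed.

Lemma Rintegral_eq0_ae D f : measurable D -> f \Rint D ->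
  {ae mu, forall t, D t -> 0 <= f t} -> \int[mu]_(x in D) f x <= 0 ->
  {ae mu, forall t, D t -> f t = 0}.
Proof.
move=> mD fi f0 intf; have mf := Rintegrable_measurable fi.
have mEf : measurable_fun D (EFin \o f) by exact/measurable_EFinP.
have absE : (\int[mu]_(x in D) `|(f x)%:E| = \int[mu]_(x in D) (f x)%:E)%E.
  apply: ae_eq_integral => //; first by apply: measurableT_comp.
  by apply: ae_imply f0 => t h Dt; rewrite gee0_abs// lee_fin h.
have : (\int[mu]_(x in D) `|(EFin \o f) x| = 0)%E.
  apply/eqP; rewrite eq_le integral_ge0// andbT absE.
  by rewrite -(fineK (integrable_fin_num mD fi)) lee_fin.
move=> /(ae_eq_integral_abs mu mD mEf); apply: ae_imply => t h Dt.
by have [] := h Dt.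
Qed.

Lemma eq_Rintegrable f g D : f =1 g -> f \Rint D -> g \Rint D.
Proof. by move=> /funext ->. Qed.

Lemma Rintegrable_patch f D : measurable D -> f \Rint D -> (f \_ D) \Rint setT.
Proof. by move=> mD; rewrite -restrict_EFin => h; exact/(integrable_mkcond _ mD). Qed.

Lemma Rdominated_cvg D (F : nat -> T -> R) f (C : R) : measurable D ->
  (mu D < +oo)%E -> (forall n, measurable_fun D (F n)) -> measurable_fun D f ->
  {ae mu, forall t, D t -> F n t @[n --> \oo] --> f t} ->
  {ae mu, forall t, D t -> forall n, `|F n t| <= C} ->
  f \Rint D /\ \int[mu]_(x in D) F n x @[n --> \oo] --> \int[mu]_(x in D) f x.
Proof.
move=> mD Dfin mF mf Ff FC.
have [] := @dominated_convergence _ _ _ mu D mD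
  (fun n x => (F n x)%:E) (EFin \o f) (cst C%:E).
- by move=> n; apply/measurable_EFinP.
- exact/measurable_EFinP.
- apply: ae_imply Ff => t h /h ht.
  by apply/fine_cvgP; split => //; exact: nearW.
- apply/integrableP; split; first exact: measurable_cst.
  by rewrite integral_cst// lte_mul_pinfty.
- by apply: ae_imply FC => t h n /h ht; rewrite lee_fin.
move=> fi _ cv; split => //.
rewrite /Rintegral; apply: fine_cvg => /=; rewrite fineK//.
exact: (integrable_fin_num mD fi).
Qed.

End GenericIntegrals.

Section Integrals.
Variable R : realType.
Notation mu := (@lebesgue_measure R).
Notation "f \Rint D" := (mu.-integrable D (EFin \o f)) (at level 50).
Implicit Types (f g : R -> R) (a b c : R).

Lemma continuous_within f (D : set R) : continuous f -> {within D, continuous f}.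
Proof. by move=> cf; apply: continuous_subspaceT. Qed.

Lemma Rintegrable_continuous f a b : continuous f -> f \Rint `[a, b].
Proof.
move=> cf; apply: continuous_compact_integrable; first exact: segment_compact.
exact: continuous_within.
Qed.

Lemma measure_itvcc a b : (mu `[a, b] < +oo)%E.
Proof. by rewrite lebesgue_measure_itv/=; case: ifP => // _; rewrite ltry. Qed.

Lemma Rintegrable_cst a b c : (fun=> c) \Rint `[a, b].
Proof. apply: Rintegrable_continuous; exact: cst_continuous. Qed.

Lemma Rintegrable_bounded f a b (C : R) : measurable_fun `[a, b] f ->
  {ae mu, forall t, a <= t <= b -> `|f t| <= C} -> f \Rint `[a, b].
Proof.
move=> mf bf; apply: (@Rintegrable_le _ _ _ mu f (cst C)) => //; exact: (Rintegrable_cst a b C).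
Qed.

Lemma continuous_bounded f a b : continuous f ->
  exists2 C, 0 <= C & forall x, a <= x <= b -> `|f x| <= C.
Proof.
move=> cf; have [ab|ba] := leP a b; last first.
  by exists 0 => // x /andP[ax xb]; move: (le_lt_trans (le_trans ax xb) ba); rewrite ltxx.
have [|c _ h] := @EVT_max R (fun x => `|f x|) a b ab.
  apply: continuous_within => x; apply: continuous_comp; [exact: cf|exact: norm_continuous].
by exists `|f c| => // x xab; apply: h; rewrite in_itv.
Qed.

Lemma Rintegrable_mul_continuous f g a b : f \Rint `[a, b] -> continuous g ->
  (fun x => g x * f x) \Rint `[a, b].
Proof.
move=> fi cg; apply: Rintegrable_mul_bounded => //.
- by apply: measurable_funS (continuous_measurable_fun cg).
- by have [C _ h] := continuous_bounded a b cg; exists C.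
Qed.

Lemma Rintegral_cst_itv a b c : a <= b -> \int[mu]_(x in `[a, b]) c = c * (b - a).
Proof.
move=> ab; rewrite Rintegral_cst//= lebesgue_measure_itv/= lte_fin.
by case: ltgtP ab => //= -> _; rewrite subrr mulr0.
Qed.

Lemma Rintegral_bound f a b C : a <= b -> f \Rint `[a, b] ->
  {ae mu, forall t, a <= t <= b -> `|f t| <= C} ->
  `|\int[mu]_(x in `[a, b]) f x| <= C * (b - a).
Proof.
move=> ab fi fC; rewrite (le_trans (le_normr_Rintegral _ fi))//.
rewrite -Rintegral_cst_itv//; apply: le_Rintegral_ae => //.
- exact: integrable_norm.
- exact: Rintegrable_cst.
Qed.

Lemma Rintegral_split f a b c : a <= b -> b <= c -> f \Rint `[a, c] ->
  \int[mu]_(x in `[a, c]) f x =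
  \int[mu]_(x in `[a, b]) f x + \int[mu]_(x in `[b, c]) f x.
Proof.
move=> ab bc fi.
have := @Rintegral_itvB R f (BLeft a) (BRight c) b fi.
rewrite !bnd_simp => /(_ ab bc) e.
rewrite -[X in _ = _ + X]Rintegral_itv_obnd_cbnd; last first.
  by apply: RintegrableS fi => //; apply: subset_itvr; rewrite bnd_simp.
by rewrite -e addrC subrK.
Qed.

Lemma Rintegral_oo_cc f a b : f \Rint `[a, b] ->
  \int[mu]_(x in `]a, b[) f x = \int[mu]_(x in `[a, b]) f x.
Proof.
move=> fi; rewrite Rintegral_itv_bndo_bndc; last first.
  by apply: RintegrableS fi => //; exact: subset_itv_oo_cc.
rewrite Rintegral_itv_obnd_cbnd//.
by apply: RintegrableS fi => //; exact: subset_itv_oc_cc.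
Qed.

Lemma ae_neq c : {ae mu, forall t : R, t != c}.
Proof.
exists [set c]; split; [exact: measurable_set1|exact: lebesgue_measure_set1|].
by move=> t /= /negP; rewrite negbK => /eqP.
Qed.

Lemma ae_itv_oo_cc a b (P : R -> Prop) : {ae mu, forall t : R, a < t < b -> P t} ->
  {ae mu, forall t : R, a <= t <= b -> P t}.
Proof.
move=> hP; have tab : {ae mu, forall t : R, t != a /\ t != b}.
  by apply: ae_imply2 (ae_neq a) (ae_neq b) => t.
apply: ae_imply2 hP tab => t Pt [ta tb] /andP[ale leb]; apply: Pt.
by rewrite !lt_neqAle eq_sym ta tb ale leb.
Qed.

Lemma ae_itv_exists (T : R) (P : R -> Prop) : 0 < T ->
  {ae mu, forall t : R, 0 < t < T -> P t} -> exists t : R, 0 < t < T /\ P t.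
Proof.
move=> T0 [E [mE E0 sub]]; apply: contrapT => nex.
have : (mu (`]0%R, T[ : set R) <= mu E)%E.
  apply: le_measure; rewrite ?inE// => t; rewrite /= in_itv/= => tT.
  by apply: sub => /= h; apply: nex; exists t; split => //; exact: h.
by rewrite E0 lebesgue_measure_itv/= lte_fin T0 -EFinB subr0 lee_fin leNgt T0.
Qed.

Lemma Rintegrable_bounded_oo f T C : measurable_fun (`]0, T[ : set R) f ->
  {ae mu, forall t : R, 0 < t < T -> `|f t| <= C} -> f \Rint `[0, T].
Proof.
move=> mf fC; apply: (@Rintegrable_bounded _ _ _ C); last exact: ae_itv_oo_cc.
by apply/measurable_fun_itv_obnd_cbndP/measurable_fun_itv_bndo_bndcP.
Qed.

Lemma sg_measurable : measurable_fun setT (@Num.sg R).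
Proof.
apply: nondecreasing_measurable => // x y xy.
by case: (sgrP x); case: (sgrP y) => //; lra.
Qed.

Lemma Rintegral_itv1 f a : \int[mu]_(x in `[a, a]) f x = 0.
Proof. by rewrite set_itv1 Rintegral_set1. Qed.

Lemma Rintegral_itv_empty f a b : b < a -> \int[mu]_(x in `[a, b]) f x = 0.
Proof. by move=> ba; rewrite set_itv_ge ?Rintegral_set0// bnd_simp -ltNge. Qed.

End Integrals.

(** * Integration by parts for integral functions *)

Section ProductIntegrable.
Context d1 d2 (T1 : measurableType d1) (T2 : measurableType d2) (R : realType).
Variables (m1 : {sigma_finite_measure set T1 -> \bar R}).
Variables (m2 : {sigma_finite_measure set T2 -> \bar R}).

Lemma integrable_prod (f : T1 -> R) (g : T2 -> R) :
  m1.-integrable setT (EFin \o f) -> m2.-integrable setT (EFin \o g) ->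
  (m1 \x m2)%E.-integrable setT (fun z => (f z.1 * g z.2)%:E).
Proof.
move=> fi gi; have mf := Rintegrable_measurable fi; have mg := Rintegrable_measurable gi.
have mfg : measurable_fun setT (fun z : T1 * T2 => (f z.1 * g z.2)%:E).
  apply/measurable_EFinP; apply: measurable_funM.
    exact: (measurableT_comp mf).
  exact: (measurableT_comp mg).
apply/integrable12ltyP => //=.
have ag : (0 <= \int[m2]_y `|(g y)%:E|)%E by apply: integral_ge0.
have gfin : (\int[m2]_y `|(g y)%:E| < +oo)%E by case/integrableP : gi.
have ffin : (\int[m1]_y `|(f y)%:E| < +oo)%E by case/integrableP : fi.
rewrite (eq_integral (fun x => ((fine (\int[m2]_y `|(g y)%:E|))%:E * `|(f x)%:E|)%E)).
  rewrite ge0_integralZl//.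
  - by rewrite lte_mul_pinfty ?lee_fin ?fine_ge0.
  - by apply/measurable_EFinP; apply: measurableT_comp.
  - by rewrite lee_fin fine_ge0.
move=> x _; rewrite fineK ?ge0_fin_numE// muleC -ge0_integralZl//.
- by apply: eq_integral => y _; rewrite -EFinM normrM.
- by apply/measurable_EFinP; apply: measurableT_comp.
Qed.

End ProductIntegrable.

Section IntegrationByParts.
Variable R : realType.
Notation mu := (@lebesgue_measure R).
Notation "f \Rint D" := (mu.-integrable D (EFin \o f)) (at level 50).
Implicit Types (f g : R -> R) (T : R).

Lemma Rintegrable_mul_primitive f g T : 0 <= T -> f \Rint `[0, T] -> g \Rint `[0, T] ->
  (fun s => f s * \int[mu]_(r in `[0, s]) g r) \Rint `[0, T].
Proof.
move=> T0 fi gi.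
have cG := parameterized_integral_continuous T0 gi.
under [X in EFin \o X]eq_fun do rewrite mulrC.
apply: Rintegrable_mul_bounded => //.
  exact: subspace_continuous_measurable_fun.
have [|c _ h] := @EVT_max R (fun x => `|parameterized_integral mu 0 x g|) 0 T T0.
  by move=> x; apply: cvg_norm; exact: cG.
by exists `|parameterized_integral mu 0 c g| => x xI; apply: h.
Qed.

(** Fubini for [f x * g y] on the triangle [x <= y]: one order of integration yields
    [F T * G T - \int f G], the other yields [\int g F]. *)
Lemma Rintegration_by_parts_integrable f g T : 0 <= T ->
  f \Rint `[0, T] -> g \Rint `[0, T] ->
  let F t := \int[mu]_(s in `[0, t]) f s in
  let G t := \int[mu]_(s in `[0, t]) g s in
  [/\ (fun s => f s * G s) \Rint `[0, T], (fun s => g s * F s) \Rint `[0, T] &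
  F T * G T = \int[mu]_(s in `[0, T]) (f s * G s) +
              \int[mu]_(s in `[0, T]) (g s * F s)].
Proof.
move=> T0 fi gi F G.
pose I := `[0, T]%classic : set R.
have fI : (f \_ I) \Rint setT.
  by apply: Rintegrable_patch => //; exact: measurable_itv.
have gI : (g \_ I) \Rint setT.
  by apply: Rintegrable_patch => //; exact: measurable_itv.
have mfI := Rintegrable_measurable fI; have mgI := Rintegrable_measurable gI.
have pE (u : R -> R) x : (u \_ I) x = if 0 <= x <= T then u x else 0.
  by rewrite patchE mem_setE /= in_itv.
pose h (z : measurableTypeR R * measurableTypeR R) : R :=
  if z.1 <= z.2 then (f \_ I) z.1 * (g \_ I) z.2 else 0.
have ifg := integrable_prod fI gI.
have mh : measurable_fun setT h.
  apply: measurable_fun_ifT => //=.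
    exact: measurable_fun_ler.
  exact: Rintegrable_measurable ifg.
have ih : (mu \x mu)%E.-integrable setT (EFin \o h).
  apply: le_integrable ifg => //; first exact/measurable_EFinP.
  by move=> z _ /=; rewrite /h; case: ifP => // _; rewrite normr0 lee_fin.
have := Fubini ih.
have giS x : I x -> g \Rint `[x, T].
  rewrite /I/= in_itv/= => /andP[x0 _].
  by apply: RintegrableS gi => //; apply: subset_itvr; rewrite bnd_simp.
have fiS x : I x -> f \Rint `[0, x].
  rewrite /I/= in_itv/= => /andP[_ x0].
  by apply: RintegrableS fi => //; apply: subset_itvl; rewrite bnd_simp.
have E1 : (fun x => \int[mu]_y (EFin \o h) (x, y))%E =
          (EFin \o (fun x => f x * (G T - G x))) \_ I.
  apply/funext => x; rewrite patchE; case: ifPn => [/set_mem Ix|/negP xI].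
  - have := Ix; rewrite /I/= in_itv/= => /andP[x0 xT].
    rewrite (_ : G T - G x = \int[mu]_(s in `[x, T]) g s); last first.
      by rewrite /G (Rintegral_split x0 xT gi) addrAC subrr add0r.
    rewrite /= EFinM /Rintegral fineK; last exact: integrable_fin_num (giS _ Ix).
    rewrite -integralZl//; last exact: giS.
    rewrite [RHS]integral_mkcond; apply: eq_integral => y _.
    rewrite /h/= !pE x0 xT/= patchE mem_setE in_itv/=.
    case: ifPn => xy //=.
    by rewrite (le_trans x0 xy)/=; case: ifP => //; rewrite mulr0.
  - rewrite -[RHS](@integral0 _ _ _ mu setT); apply: eq_integral => y _.
    rewrite /h/= pE; case: ifP => //; rewrite [X in if X then _ else _](negbTE _) ?mul0r//.
    by apply/negP => Ix; apply: xI; rewrite mem_setE/= in_itv.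
have E2 : (fun y => \int[mu]_x (EFin \o h) (x, y))%E =
          (EFin \o (fun x => g x * F x)) \_ I.
  apply/funext => y; rewrite patchE; case: ifPn => [/set_mem Iy|/negP yI].
  - have := Iy; rewrite /I/= in_itv/= => /andP[y0 yT].
    rewrite /= EFinM /F /Rintegral fineK; last exact: integrable_fin_num (fiS _ Iy).
    rewrite -integralZl//; last exact: fiS.
    rewrite [RHS]integral_mkcond; apply: eq_integral => x _.
    rewrite /h/= !pE y0 yT/= patchE mem_setE in_itv/=.
    case: ifPn => xy; last by rewrite andbF.
    rewrite (le_trans xy yT) andbT /=.
    by case: ifP => //; rewrite ?mul0r// mulrC.
  - rewrite -[RHS](@integral0 _ _ _ mu setT); apply: eq_integral => x _.
    rewrite /h/= [X in _ * X]pE; case: ifP => //; rewrite [X in if X then _ else _](negbTE _) ?mulr0//.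
    by apply/negP => Iy; apply: yI; rewrite mem_setE/= in_itv.
have I3 := Rintegrable_mul_primitive T0 fi gi; have I2 := Rintegrable_mul_primitive T0 gi fi.
have I1 : (fun x => f x * (G T - G x)) \Rint I.
  apply: eq_Rintegrable (RintegrableB _ (RintegrableZ (G T) _ fi) I3) => // x /=; rewrite -/(G x); ring.
rewrite E1 E2 -!integral_mkcond => /(congr1 fine).
rewrite -/(Rintegral mu I _) -/(Rintegral mu I _) => e.
split => //; rewrite -e.
rewrite -[LHS]RintegralZr// -RintegralD//.
by apply: eq_Rintegral => x _; ring.
Qed.

Corollary Rintegration_by_parts_cst f g (c c' : R) T : 0 <= T ->
  f \Rint `[0, T] -> g \Rint `[0, T] ->
  let F t := c + \int[mu]_(s in `[0, t]) f s in
  let G t := c' + \int[mu]_(s in `[0, t]) g s in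
  [/\ (fun s => f s * G s) \Rint `[0, T], (fun s => g s * F s) \Rint `[0, T] &
  F T * G T = c * c' + \int[mu]_(s in `[0, T]) (f s * G s + g s * F s)].
Proof.
move=> T0 fi gi F G.
have [fG gF e] := Rintegration_by_parts_integrable T0 fi gi.
have ifG : (fun s => f s * G s) \Rint `[0, T].
  by apply: eq_Rintegrable (RintegrableD _ (RintegrableZ c' _ fi) fG) => // s; rewrite /G; ring.
have igF : (fun s => g s * F s) \Rint `[0, T].
  by apply: eq_Rintegrable (RintegrableD _ (RintegrableZ c _ gi) gF) => // s; rewrite /F; ring.
split => //.
transitivity (c * c' + (c' * \int[mu]_(s in `[0, T]) f s + c * \int[mu]_(s in `[0, T]) g s +
  (\int[mu]_(s in `[0, T]) (f s * \int[mu]_(r in `[0, s]) g r) +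
   \int[mu]_(s in `[0, T]) (g s * \int[mu]_(r in `[0, s]) f r)))).
  by rewrite -e /F /G; ring.
congr (_ + _); rewrite -RintegralZl// -RintegralZl// -!RintegralD//.
- by apply: eq_Rintegral => s _; rewrite /F /G; ring.
- by apply: RintegrableD => //; apply: RintegrableZ.
- by apply: RintegrableD.
- by apply: RintegrableZ.
- by apply: RintegrableZ.
Qed.

End IntegrationByParts.

(** * Linear differential equations with continuous coefficients *)

Section LinearODE.
Variable R : realType.
Notation mu := (@lebesgue_measure R).
Notation "f \Rint D" := (mu.-integrable D (EFin \o f)) (at level 50).
Implicit Types (f g : R -> R).

Lemma cvgn_unique (u : nat -> R) (a b : R) :
  u n @[n --> \oo] --> a -> u n @[n --> \oo] --> b -> a = b.
Proof.
move=> ua ub; rewrite -(cvg_lim (@Rhausdorff R) ua).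
by apply: cvg_lim ub; exact: Rhausdorff.
Qed.

Lemma cvg_sumr T (F : set_system T) (FF : Filter F) (I : finType)
    (f : I -> T -> R) (a : I -> R) :
  (forall i, f i x @[x --> F] --> a i) ->
  \sum_i f i x @[x --> F] --> \sum_i a i.
Proof. by move=> fa; apply: cvg_big => //; exact: add_continuous. Qed.

Lemma primitive_lipschitz f (b C s t : R) : f \Rint `[0, b] -> 0 <= C ->
  {ae mu, forall x : R, 0 <= x <= b -> `|f x| <= C} -> s <= t -> t <= b ->
  `|\int[mu]_(r in `[0, t]) f r - \int[mu]_(r in `[0, s]) f r| <= C * (t - s).
Proof.
move=> fi C0 fC st tb.
have iS (u v : R) : 0 <= u -> v <= b -> f \Rint `[u, v].
  move=> u0 vb; apply: RintegrableS fi => //; apply: subset_itvScc; rewrite bnd_simp//.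
have [s0|s0] := ltP s 0.
  rewrite [X in _ - X]Rintegral_itv_empty// subr0.
  have [t0|t0] := ltP t 0.
    by rewrite Rintegral_itv_empty// normr0 mulr_ge0// subr_ge0.
  apply: le_trans (Rintegral_bound t0 (iS _ _ _ tb) _) _ => //.
    by apply: ae_imply fC => x fx /andP[x0 xt]; apply: fx; rewrite x0 (le_trans xt).
  by rewrite ler_wpM2l// lerD2l lerN2 ltW.
rewrite (Rintegral_split s0 st (iS _ _ _ tb))// addrAC subrr add0r.
apply: Rintegral_bound => //; first exact: iS.
by apply: ae_imply fC => x fx /andP[x0 xt]; apply: fx; rewrite (le_trans s0 x0) (le_trans xt).
Qed.

Lemma primitive_continuous f : (forall b : R, f \Rint `[0, b]) ->
  (forall b : R, exists2 C : R, 0 <= C &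
     {ae mu, forall x : R, 0 <= x <= b -> `|f x| <= C}) ->
  continuous (fun t : R => \int[mu]_(r in `[0, t]) f r).
Proof.
move=> fi fb x.
have [C C0 fC] := fb (x + 1).
apply/cvgrPdist_le => /= e e0.
have d0 : 0 < Num.min 1 (e / (C + 1)).
  by rewrite lt_min ltr01 divr_gt0// ltr_wpDl.
near=> y.
have xy : `|x - y| < Num.min 1 (e / (C + 1)).
  by near: y; exact: cvgr_dist_lt.
have yb : y <= x + 1.
  move: xy; rewrite lt_min distrC => /andP[/ltr_distlDr/ltW yx _]; lra.
have xye : C * `|x - y| <= e.
  move: xy; rewrite lt_min => /andP[_]; rewrite ltr_pdivlMr; last by rewrite ltr_wpDl.
  move=> h; have := normr_ge0 (x - y); nra.
apply: le_trans _ xye.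
have [h|h] := leP x y.
  rewrite distrC [X in _ * X]distrC [X in _ * X]ger0_norm ?subr_ge0//.
  exact: (primitive_lipschitz (fi (x + 1))).
rewrite [X in _ * X]ger0_norm; last by rewrite subr_ge0 ltW.
by apply: (primitive_lipschitz (fi (x + 1))) => //; [exact: ltW|rewrite lerDl].
Unshelve. all: by end_near. Qed.

Lemma continuous_primitive f : continuous f ->
  continuous (fun t : R => \int[mu]_(r in `[0, t]) f r).
Proof.
move=> cf; apply: primitive_continuous => b; first exact: Rintegrable_continuous.
by have [C C0 fC] := continuous_bounded 0 b cf; exists C => //; exact: aeW.
Qed.

Lemma Rintegral_expR_scale (c t : R) : 0 < c -> 0 <= t ->
  \int[mu]_(s in `[0, t]) (c * expR (c * s)) = expR (c * t) - 1.
Proof.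
move=> c0; rewrite le_eqVlt => /predU1P[<-|t0].
  by rewrite Rintegral_itv1 mulr0 expR0 subrr.
have dE (s : R) : is_derive s 1 (fun s : R => expR (c * s)) (c * expR (c * s)).
  apply: is_derive_eq; rewrite /GRing.scale/=; ring.
have cE : continuous (fun s : R => expR (c * s)).
  by move=> s; apply/differentiable_continuous/derivable1_diffP; case: (dE s).
rewrite /Rintegral (@continuous_FTC2 _ _ (fun s => expR (c * s)))//=.
- by rewrite mulr0 expR0.
- by apply: continuous_within => s; apply: cvgM; [exact: cvg_cst|exact: cE].
- split; first by move=> s _; case: (dE s).
  + apply: cvg_at_right_filter; exact: cE.
  + apply: cvg_at_left_filter; exact: cE.
- by move=> s _; rewrite derive1E; apply: derive_val.
Qed.

Variables (I : finType) (B : I -> I -> R -> R) (z : I -> R).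
Hypothesis cB : forall i l, continuous (B i l).

Fixpoint picard (k : nat) : I -> R -> R :=
  if k is k'.+1 then
    fun i t => \int[mu]_(s in `[0, t]) \sum_l B i l s * picard k' l s
  else fun i _ => z i.

Lemma continuous_sum (F : I -> R -> R) : (forall l, continuous (F l)) ->
  continuous (fun s : R => \sum_l F l s).
Proof. by move=> cF s; apply: cvg_sumr => l; exact: cF. Qed.

Lemma continuous_lin i (F : I -> R -> R) : (forall l, continuous (F l)) ->
  continuous (fun s : R => \sum_l B i l s * F l s).
Proof.
by move=> cF; apply: continuous_sum => l s; apply: cvgM; [exact: cB|exact: cF].
Qed.

Lemma picard_continuous k i : continuous (picard k i).
Proof.
elim: k i => [|k ih] i /=; first exact: cst_continuous.
apply: continuous_primitive; exact: continuous_lin.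
Qed.

Lemma lin_bounded (b : R) : exists2 c : R, 0 < c &
  forall i (t : R), 0 <= t <= b -> \sum_l `|B i l t| <= c.
Proof.
have h i : exists2 C : R, 0 <= C & forall t : R, 0 <= t <= b -> \sum_l `|B i l t| <= C.
  have [|C C0 h] := @continuous_bounded R (fun t : R => \sum_l `|B i l t|) 0 b.
    by apply: continuous_sum => l s; apply: cvg_norm; exact: cB.
  exists C => // t /h; apply: le_trans; exact: ler_norm.
exists (1 + \sum_i s2val (cid2 (h i))).
  rewrite ltr_wpDr// sumr_ge0// => i _; exact: (s2valP (cid2 (h i))).
move=> i t /(s2valP' (cid2 (h i)))/le_trans; apply.
rewrite (bigD1 i)//= addrCA lerDl addr_ge0// sumr_ge0// => j _.
exact: (s2valP (cid2 (h j))).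
Qed.

(** Measured against the weight [expR (2 * c * t)], where [c] bounds the
    coefficients, each Picard step gains a factor [2]. *)
Lemma picard_bound (b c : R) : 0 < c ->
  (forall i (t : R), 0 <= t <= b -> \sum_l `|B i l t| <= c) ->
  forall k i (t : R), 0 <= t <= b ->
  `|picard k i t| <= (\sum_l `|z l|) * 2^-1 ^+ k * expR (2 * c * t).
Proof.
move=> c0 Bc; set Z := \sum_l _.
have Z0 : 0 <= Z by apply: sumr_ge0.
elim=> [|k ih] i t /andP[t0 tb] /=.
  rewrite expr0 mulr1; apply: (@le_trans _ _ Z).
    by rewrite /Z (bigD1 i)//= lerDl sumr_ge0.
  by rewrite ler_peMr// -expR0 ler_expR mulr_ge0// mulr_ge0// ltW.
have cint := @continuous_lin i (picard k) (@picard_continuous k).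
apply: (le_trans (le_normr_Rintegral _ (Rintegrable_continuous 0 t cint))) => //.
pose K := Z * 2^-1 ^+ k.+1.
have K0 : 0 <= K by rewrite /K mulr_ge0// exprn_ge0// invr_ge0.
have cE : continuous (fun s : R => 2 * c * expR (2 * c * s)).
  move=> s; apply: cvgM; first exact: cvg_cst.
  apply: (@continuous_comp _ _ _ (fun s => 2 * c * s) expR).
    exact: mulrl_continuous.
  exact: continuous_expR.
apply: (@le_trans _ _ (\int[mu]_(s in `[0, t]) (K * (2 * c * expR (2 * c * s))))).
  apply: le_Rintegral => //.
  - by apply: integrable_norm; exact: Rintegrable_continuous.
  - by apply: (RintegrableZ K) => //; exact: (Rintegrable_continuous 0 t cE).
  move=> s; rewrite /= in_itv/= => /andP[s0 st].
  have sb : 0 <= s <= b by rewrite s0 (le_trans st).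
  apply: (le_trans (ler_norm_sum _ _ _)).
  apply: (@le_trans _ _ (\sum_l `|B i l s| * (Z * 2^-1 ^+ k * expR (2 * c * s)))).
    by apply: ler_sum => l _; rewrite normrM ler_wpM2l// ih.
  rewrite -mulr_suml (_ : K * _ = c * (Z * 2^-1 ^+ k * expR (2 * c * s))); last first.
    by rewrite /K exprS; field.
  by rewrite ler_wpM2r ?Bc// mulr_ge0 ?expR_ge0// mulr_ge0// exprn_ge0// invr_ge0.
rewrite RintegralZl//; last exact: (Rintegrable_continuous 0 t cE).
rewrite Rintegral_expR_scale//; last by rewrite mulr_gt0.
by rewrite -/K ler_wpM2l// gerBl.
Qed.

Lemma geometric_half_sum N : \sum_(k < N) (2^-1 : R) ^+ k <= 2.
Proof.
suff -> : \sum_(k < N) (2^-1 : R) ^+ k = 2 - 2 * 2^-1 ^+ N.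
  by rewrite gerBl mulr_ge0// exprn_ge0// invr_ge0.
elim: N => [|N ih]; first by rewrite big_ord0 expr0 mulr1 subrr.
by rewrite big_ord_recr/= ih exprS; field.
Qed.

Let S N i (t : R) := \sum_(k < N) picard k i t.

Lemma S_rec N i t :
  S N.+1 i t = z i + \int[mu]_(s in `[0, t]) \sum_l B i l s * S N l s.
Proof.
elim: N => [|N ih].
  rewrite /S big_ord_recl big_ord0 addr0/= -[LHS]addr0; congr (_ + _); symmetry.
  under eq_Rintegral.
    move=> s _; under eq_bigr do rewrite big_ord0 mulr0.
    rewrite big1//; over.
  by rewrite Rintegral_cst// mul0r.
have cS l : continuous (S N l).
  by move=> s; apply: cvg_sumr => k; exact: picard_continuous.
rewrite /S big_ord_recr -/(S N.+1 i t) ih /= -addrA; congr (_ + _).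
rewrite -RintegralD//.
- apply: eq_Rintegral => s _; rewrite -big_split/=; apply: eq_bigr => l _.
  by rewrite big_ord_recr/= mulrDr.
- by apply: Rintegrable_continuous; exact: continuous_lin.
- by apply: Rintegrable_continuous; apply: continuous_lin => l; exact: picard_continuous.
Qed.

(** The partial sums of the Picard increments converge by [picard_bound], uniformly
    bounded on bounded intervals, so the limit may be taken under the integral. *)
Theorem linear_ode_exists : exists x : I -> R -> R,
  (forall i, continuous (x i)) /\
  (forall i t, x i t = z i + \int[mu]_(s in `[0, t]) \sum_l B i l s * x l s).
Proof.
pose y i t := limn (fun N => S N i t).
have Sb (b : R) : exists C : R, forall N i (t : R), 0 <= t <= b -> `|S N i t| <= C.
  have [c c0 Bc] := lin_bounded b.
  set Z := \sum_l `|z l|.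
  have Z0 : 0 <= Z by apply: sumr_ge0.
  exists (Z * 2 * expR (2 * c * b)) => N i t tb.
  apply: (le_trans (ler_norm_sum _ _ _)).
  apply: (@le_trans _ _ (\sum_(k < N) (Z * expR (2 * c * t)) * 2^-1 ^+ k)).
    by apply: ler_sum => k _; rewrite mulrAC; exact: (picard_bound c0 Bc).
  rewrite -mulr_sumr; apply: (@le_trans _ _ (Z * expR (2 * c * t) * 2)).
    by rewrite ler_wpM2l ?mulr_ge0 ?expR_ge0// geometric_half_sum.
  rewrite mulrAC ler_wpM2l// ?mulr_ge0// ler_expR.
  by case/andP: tb => _ tb; rewrite ler_wpM2l// mulr_ge0// ltW.
have Sy i (t : R) : 0 <= t -> S N i t @[N --> \oo] --> y i t.
  move=> t0.
  have [c c0 Bc] := lin_bounded t.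
  set Z := \sum_l `|z l|.
  have Z0 : 0 <= Z by apply: sumr_ge0.
  suff : cvgn (fun N => S N i t) by [].
  have -> : (fun N => S N i t) = series (fun k => picard k i t).
    by apply/funext => N; rewrite /S /series/= big_mkord.
  apply: normed_cvg.
  apply: (@series_le_cvg _ _ (geometric (Z * expR (2 * c * t)) 2^-1)) => //.
  - by move=> n /=; exact: normr_ge0.
  - by move=> n; rewrite geometric_ge0// ?mulr_ge0 ?expR_ge0 ?invr_ge0.
  - move=> n /=; rewrite mulrAC; apply: (picard_bound c0 Bc).
    by rewrite t0 lexx.
  - by apply: is_cvg_geometric_series; rewrite ger0_norm ?invr_ge0// invf_lt1// ltr1n.
have mS N l (t : R) : measurable_fun `[0, t] (S N l).
  apply: measurable_funS (continuous_measurable_fun _) => //.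
  by move=> s; apply: cvg_sumr => k; exact: picard_continuous.
have my l (t : R) : measurable_fun `[0, t] (y l).
  apply: (@measurable_fun_cvg _ _ R _ (fun N => S N l)) => // s.
  by rewrite /= in_itv/= => /andP[s0 _]; exact: Sy.
have mB i l (t : R) : measurable_fun `[0, t] (B i l).
  by apply: measurable_funS (continuous_measurable_fun _).
have yb (b : R) : exists C : R, forall i (t : R), 0 <= t <= b -> `|y i t| <= C.
  have [C h] := Sb b; exists C => i t tb.
  have := Sy i t; case/andP: (tb) => -> _ /(_ isT)/cvg_norm cv.
  by apply: (cvgr_to_le cv); apply: nearW => N; exact: h.
have key i (t : R) : 0 <= t -> (fun s => \sum_l B i l s * y l s) \Rint `[0, t] /\
    y i t = z i + \int[mu]_(s in `[0, t]) \sum_l B i l s * y l s.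
  move=> t0; have [C SC] := Sb t.
  have [c c0 Bc] := lin_bounded t.
  have [] := @Rdominated_cvg _ _ _ mu `[0, t]%classic
    (fun N s => \sum_l B i l s * S N l s) (fun s => \sum_l B i l s * y l s) (c * C).
  - by [].
  - exact: measure_itvcc.
  - move=> N; apply: measurable_sum => l.
    by apply: measurable_funM; [exact: mB|exact: mS].
  - apply: measurable_sum => l.
    by apply: measurable_funM; [exact: mB|exact: my].
  - apply: aeW => s; rewrite /= in_itv/= => /andP[s0 st].
    by apply: cvg_sumr => l; apply: cvgM; [exact: cvg_cst|exact: Sy].
  - apply: aeW => s; rewrite /= in_itv/= => st N.
    apply: (le_trans (ler_norm_sum _ _ _)).
    apply: (@le_trans _ _ (\sum_l `|B i l s| * C)).
      by apply: ler_sum => l _; rewrite normrM ler_wpM2l// SC.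
    rewrite -mulr_suml ler_wpM2r ?Bc//.
    exact: le_trans (normr_ge0 _) (SC 0%N i s st).
  move=> iy cv; split => //.
  have Scv : S N.+1 i t @[N --> \oo] --> y i t.
    by have := Sy i t t0; rewrite -(cvg_shiftS (fun N => S N i t)).
  have Scv2 : S N.+1 i t @[N --> \oo] -->
      z i + \int[mu]_(s in `[0, t]) \sum_l B i l s * y l s.
    by under eq_cvg do rewrite S_rec; apply: cvgD => //; exact: cvg_cst.
  exact: cvgn_unique Scv Scv2.
pose x i t := z i + \int[mu]_(s in `[0, t]) \sum_l B i l s * y l s.
have xy i (t : R) : 0 <= t -> x i t = y i t by move=> /(key i)[_ ->].
exists x; split => [i|i t].
  move=> s; apply: cvgD; first exact: cvg_cst.
  apply: primitive_continuous => b.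
    have [b0|b0] := ltP b 0; last by case: (key i b b0).
    by rewrite set_itv_ge ?bnd_simp -?ltNge//; exact: integrable_set0.
  have [C yC] := yb b; have [c c0 Bc] := lin_bounded b.
  exists (c * `|C|); first by rewrite mulr_ge0// ltW.
  apply: aeW => r rb; apply: (le_trans (ler_norm_sum _ _ _)).
  apply: (@le_trans _ _ (\sum_l `|B i l r| * `|C|)).
    by apply: ler_sum => l _; rewrite normrM ler_wpM2l// (le_trans (yC _ _ rb))// ler_norm.
  by rewrite -mulr_suml ler_wpM2r ?Bc.
congr (_ + _); apply: eq_Rintegral => s; rewrite mem_setE/= in_itv/= => /andP[s0 _].
by apply: eq_bigr => l _; rewrite xy.
Qed.

End LinearODE.

(** * Zeros of solutions of analytic linear equations *)

Section Analytic.
Variable R : realType.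
Notation mu := (@lebesgue_measure R).
Implicit Types (f : R -> R).

Lemma primitive_is_derive f (t : R) : continuous f -> 0 < t ->
  is_derive t 1 (fun t : R => \int[mu]_(s in `[0, t]) f s) (f t).
Proof.
move=> cf t0.
have [] := @continuous_FTC1_closed R f 0 t (t + 1) _ _ t0 (cf t).
- by rewrite ltrDl.
- exact: Rintegrable_continuous.
move=> df dfE; apply: DeriveDef; first exact: df.
by rewrite -derive1E; exact: dfE.
Qed.

Lemma geometric_tail (x : R) N M : 0 <= x -> x <= 2^-1 ->
  \sum_(N <= k < M) x ^+ k <= 2 * x ^+ N.
Proof.
move=> x0 x2; have [MN|NM] := leqP M N.
  by rewrite big_geq// mulr_ge0// exprn_ge0.
suff h : \sum_(N <= k < M) x ^+ k <= 2 * x ^+ N - 2 * x ^+ M.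
  by apply: (le_trans h); rewrite gerBl mulr_ge0// exprn_ge0.
elim: M NM => // M ih; rewrite ltnS leq_eqVlt => /predU1P[->|NM].
  rewrite big_nat1 exprS; have := exprn_ge0 M x0; nra.
rewrite big_nat_recr/=; last exact: ltnW.
have := ih NM; have := exprn_ge0 M x0; rewrite exprS; nra.
Qed.

Lemma mean_value_bound (e de : R -> R) (s d K t : R) : 0 <= d ->
  (forall x, `|x - s| <= d -> is_derive x 1 e (de x)) ->
  (forall x, `|x - s| <= d -> `|de x| <= K) -> e s = 0 ->
  `|t - s| <= d -> `|e t| <= d * K.
Proof.
move=> d0 dE dK es0 td.
have K0 : 0 <= K.
  by apply: le_trans (normr_ge0 _) (dK s _); rewrite subrr normr0.
have ce x : `|x - s| <= d -> {for x, continuous e}.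
  by move=> xd; apply/differentiable_continuous/derivable1_diffP; case: (dE x xd).
have [c cd ->] : exists2 c, `|c - s| <= d & e t = de c * (t - s).
  have [st|ts] := leP s t.
    have seg x : x \in `[s, t] -> `|x - s| <= d.
      rewrite in_itv/= => /andP[sx xt]; apply: le_trans td.
      by rewrite !ger0_norm ?subr_ge0// lerD2r.
    have [x xst|x|c cst] := @MVT_segment R e de s t st.
    - by apply: dE; apply: seg; apply: subset_itv_oo_cc xst.
    - apply: continuous_in_subspaceT x => x /set_mem xst; apply: ce; exact: seg.
    - by rewrite es0 subr0 => ->; exists c => //; exact: seg.
  have seg x : x \in `[t, s] -> `|x - s| <= d.
    rewrite in_itv/= => /andP[sx xt]; apply: le_trans td.
    by rewrite !ler0_norm ?subr_le0// ?(ltW ts)// lerN2 lerD2r.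
  have [x xst|x|c cst] := @MVT_segment R e de t s (ltW ts).
  - by apply: dE; apply: seg; apply: subset_itv_oo_cc xst.
  - apply: continuous_in_subspaceT x => x /set_mem xst; apply: ce; exact: seg.
  - rewrite es0 sub0r => h; exists c; first exact: seg.
    by rewrite -opprB mulrN -h opprK.
rewrite normrM mulrC; apply: ler_pM => //; exact: dK.
Qed.

(** Close to the centre, the term with the first nonzero coefficient dominates the
    tail. *)
Lemma power_series_zeros (g : nat -> R) (F : R -> R) (sg d G : R) :
  0 < d -> 0 < sg -> sg * d <= 4^-1 -> 0 <= G ->
  (forall k, `|g k| <= G * sg ^+ k) ->
  (forall x : R, `|x| <= d -> \sum_(k < N.+1) g k * x ^+ k @[N --> \oo] --> F x) ->
  (forall x : R, `|x| <= d -> F x = 0) \/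
  (exists2 e : R, 0 < e & forall x : R, 0 < `|x| -> `|x| < e -> F x != 0).
Proof.
move=> d0 s0 sd G0 gG cvF.
have [g0|] := pselect (forall k, g k = 0).
  left => x xd; apply: (cvgn_unique (cvF x xd)).
  under eq_fun do under eq_bigr do rewrite g0 mul0r.
  under eq_fun do rewrite big1//.
  exact: cvg_cst.
move=> /existsNP[k0 /eqP gk0]; right.
have [n gn nmin] := ex_minnP (ex_intro (fun k => g k != 0) k0 gk0).
have zk k : (k < n)%N -> g k = 0.
  by move=> kn; apply/eqP; apply: contraLR kn => /nmin; rewrite -leqNgt.
pose K := 2 * G * sg ^+ n.+1.
have K0 : 0 <= K by rewrite /K !mulr_ge0// exprn_ge0// ltW.
pose e := Num.min d (`|g n| / (K + 1)).
exists e; first by rewrite lt_min d0 divr_gt0 ?normr_gt0// ltr_wpDl.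
move=> x x0; rewrite lt_min => /andP[/ltW xd].
rewrite ltr_pdivlMr; last by rewrite ltr_wpDl.
move=> xg.
suff : `|x| ^+ n * (`|g n| - K * `|x|) <= `|F x|.
  move=> h; rewrite -normr_gt0; apply: lt_le_trans h.
  by rewrite mulr_gt0 ?exprn_gt0// subr_gt0; nra.
have cv : `|\sum_(k < N.+1) g k * x ^+ k| @[N --> \oo] --> `|F x|.
  by apply: cvg_norm; exact: cvF.
apply: (cvgr_to_ge cv); exists n => // N /= nN.
rewrite -(big_mkord xpredT (fun k => g k * x ^+ k)).
rewrite (@big_cat_nat _ _ _ n)//=; last exact: leqW.
rewrite [X in `|X + _|]big1_seq ?add0r; last first.
  by move=> k; rewrite mem_index_iota => /andP[_ /andP[_ kn]]; rewrite zk// mul0r.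
rewrite big_ltn//.
apply: le_trans (lerB_normD _ _); rewrite normrM normrX mulrBr [X in X - _]mulrC.
rewrite lerD2l lerN2.
apply: (le_trans (ler_norm_sum _ _ _)).
have sx : sg * `|x| <= 4^-1 by apply: le_trans sd; rewrite ler_wpM2l// ltW.
have sx0 : 0 <= sg * `|x| by rewrite mulr_ge0// ltW.
apply: (@le_trans _ _ (\sum_(n.+1 <= k < N.+1) G * (sg * `|x|) ^+ k)).
  apply: ler_sum => k _; rewrite normrM normrX exprMn mulrA.
  by rewrite ler_wpM2r ?exprn_ge0.
rewrite -mulr_sumr; apply: (@le_trans _ _ (G * (2 * (sg * `|x|) ^+ n.+1))).
  rewrite ler_wpM2l// geometric_tail//; apply: (le_trans sx); lra.
rewrite exprMn [`|x| ^+ n.+1]exprSr /K; lra.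
Qed.

Section Taylor.
Variables (I : finType) (c : nat -> I -> I -> R) (v : I -> R).

(** [taylor N] lists the coefficients of order at most [N] of the formal solution
    of x' = (sum_k c_k t^k) x, x(0) = v; carrying the whole list makes
    the recursion structural. *)
Fixpoint taylor (N : nat) : nat -> I -> R :=
  if N is N'.+1 then fun k i =>
    if (k <= N')%N then taylor N' k i else
    N'.+1%:R^-1 * \sum_(q < N'.+1) \sum_l c q i l * taylor N' (N' - q)%N l
  else fun _ => v.

Definition taylor_coef k := taylor k k.

Lemma taylorE N k : (k <= N)%N -> taylor N k = taylor_coef k.
Proof.
elim: N => [|N ih]; first by rewrite leqn0 => /eqP ->.
rewrite leq_eqVlt => /predU1P[-> //|]; rewrite ltnS => kN.
by apply/funext => i /=; rewrite kN ih.
Qed.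

Lemma taylor_coefS N i : N.+1%:R * taylor_coef N.+1 i =
  \sum_l \sum_(q < N.+1) c q i l * taylor_coef (N - q)%N l.
Proof.
rewrite /taylor_coef /= ltnn mulVKf ?pnatr_eq0// exchange_big/=.
apply: eq_bigr => l _; apply: eq_bigr => q _.
by rewrite taylorE// leq_subr.
Qed.

(** Each step of the recursion divides a sum of [N + 1] terms of size
    [C V sg^N] by [N + 1]; the factor [#|I| C] that is left is at most [sg]. *)
Lemma taylor_coef_bound (C V sg : R) : 0 < sg -> 0 <= C -> 0 <= V ->
  #|I|%:R * C <= sg ->
  (forall k i l, `|c k i l| <= C * sg ^+ k) -> (forall i, `|v i| <= V) ->
  forall k i, `|taylor_coef k i| <= V * sg ^+ k.
Proof.
move=> s0 C0 V0 nC cC vV.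
suff h N k i : (k <= N)%N -> `|taylor_coef k i| <= V * sg ^+ k.
  by move=> k i; exact: h.
elim: N k i => [|N ih] k i; first by rewrite leqn0 => /eqP ->; rewrite expr0 mulr1 vV.
rewrite leq_eqVlt => /predU1P[->|]; last by rewrite ltnS; exact: ih.
rewrite -(@ler_pM2l _ N.+1%:R)// -{1}(ger0_norm (ler0n R N.+1)) -normrM taylor_coefS.
apply: (le_trans (ler_norm_sum _ _ _)).
apply: (@le_trans _ _ (\sum_(l : I) N.+1%:R * (C * (V * sg ^+ N)))).
  apply: ler_sum => l _; apply: (le_trans (ler_norm_sum _ _ _)).
  apply: (@le_trans _ _ (\sum_(q < N.+1) C * (V * sg ^+ N))); last first.
    by rewrite sumr_const card_ord -[X in X <= _]mulr_natl.
  apply: ler_sum => q _; rewrite normrM.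
  have -> : C * (V * sg ^+ N) = (C * sg ^+ q) * (V * sg ^+ (N - q)).
    have -> : sg ^+ N = sg ^+ q * sg ^+ (N - q) by rewrite -exprD subnKC// -ltnS.
    by ring.
  by apply: ler_pM => //; apply: ih; rewrite leq_subr.
rewrite -mulr_sumr sumr_const ler_pM2l// -[X in X <= _]mulr_natl exprS.
have -> : #|I|%:R * (C * (V * sg ^+ N)) = (#|I|%:R * C) * (V * sg ^+ N) by ring.
have -> : V * (sg * sg ^+ N) = sg * (V * sg ^+ N) by ring.
by rewrite ler_wpM2r// mulr_ge0// exprn_ge0// ltW.
Qed.

End Taylor.

End Analytic.

Section AnalyticODE.
Variable R : realType.

Lemma finite_upper_bound (J : finType) (K : Type) (h : J -> K -> R) :
  (forall j, exists2 C : R, 0 <= C & forall k, h j k <= C) ->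
  exists2 C : R, 0 <= C & forall j k, h j k <= C.
Proof.
move=> hb; exists (\sum_j s2val (cid2 (hb j))).
  by apply: sumr_ge0 => j _; exact: (s2valP (cid2 (hb j))).
move=> j k; apply: le_trans (s2valP' (cid2 (hb j)) k) _.
rewrite [leRHS](bigD1 j)//= lerDl sumr_ge0// => i _.
exact: (s2valP (cid2 (hb i))).
Qed.

Variables (I : finType) (B : I -> I -> R -> R) (phi : I -> R -> R) (s r : R).
Variable c : nat -> I -> I -> R.
Hypothesis r0 : 0 < r.
Hypothesis cB : forall i l (t : R), `|t - s| < r ->
  \sum_(k < n) (t - s) ^+ k * c k i l @[n --> \oo] --> B i l t.
Hypothesis phiE : forall i (t : R), `|t - s| < r ->
  is_derive t 1 (phi i) (\sum_l B i l t * phi l t).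

(** Cauchy's estimate, from the convergence at distance [r / 2] alone: the terms of a
    convergent series are bounded. *)
Lemma coef_bound : exists2 C : R, 0 <= C &
  forall k i l, `|c k i l| * (r / 2) ^+ k <= C.
Proof.
have r2 : `|s + r / 2 - s| < r.
  have -> : s + r / 2 - s = r / 2 by ring.
  by have r1 := r0; rewrite ger0_norm; lra.
suff [C C0 hC] : exists2 C : R, 0 <= C &
    forall (il : I * I) k, `|c k il.1 il.2| * (r / 2) ^+ k <= C.
  by exists C => // k i l; exact: (hC (i, l)).
apply: finite_upper_bound => -[i l] /=.
have cv := @cB i l _ r2.
have : cvgn (series (fun k => (s + r / 2 - s) ^+ k * c k i l)).
  apply/cvg_ex; exists (B i l (s + r / 2)).
  rewrite (_ : series _ = fun n => \sum_(k < n) (s + r / 2 - s) ^+ k * c k i l)//.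
  by apply/funext => n; rewrite /series/= big_mkord.
move=> /cvg_series_cvg_0/cvgP/cvg_seq_bounded [C [_ hC]].
exists (`|C| + 1); first by rewrite addr_ge0.
move=> k; have := hC (`|C| + 1) _ k Logic.I.
have -> : s + r / 2 - s = r / 2 by ring.
rewrite /= normrM normrX [`|r / 2|]ger0_norm ?divr_ge0 ?(ltW r0)// mulrC; apply.
by rewrite ltr_pwDr// ler_norm.
Qed.

Variables (C sg d V : R).
Hypothesis C0 : 0 <= C.
Hypothesis V0 : 0 <= V.
Hypothesis sg0 : 0 < sg.
Hypothesis d0 : 0 < d.
Hypothesis nC : #|I|%:R * C <= sg.
Hypothesis cC : forall k i l, `|c k i l| <= C * sg ^+ k.
Hypothesis vV : forall i, `|phi i s| <= V.
Hypothesis sgd : sg * d <= 4^-1.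
Hypothesis dr : d < r.

Let x := taylor_coef c (phi ^~ s).

Let p (N : nat) i l : {poly R} := \poly_(k < N) c k i l.
Let q (N : nat) l : {poly R} := \poly_(k < N.+1) x k l.
Let D (N : nat) i : {poly R} := (q N i)^`() - \sum_l p N i l * q N l.

Let xV k i : `|x k i| <= V * sg ^+ k.
Proof. exact: (taylor_coef_bound sg0 C0 V0 nC cC vV). Qed.

Let sgt (t : R) : `|t| <= d -> 0 <= sg * `|t| <= 4^-1.
Proof.
move=> td; rewrite mulr_ge0 ?(ltW sg0)//=; apply: le_trans sgd.
by rewrite ler_wpM2l// ltW.
Qed.

(** This is the recursion that defines the Taylor coefficients. *)
Lemma residual_coef N i k : (k < N)%N -> (D N i)`_k = 0.
Proof.
move=> kN; rewrite /D coefB coef_deriv coef_sum /q coef_poly ltnS kN.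
rewrite -[X in X - _]mulr_natl taylor_coefS; apply/eqP; rewrite subr_eq0; apply/eqP.
apply: eq_bigr => l _; rewrite coefM; apply: eq_bigr => j _.
rewrite !coef_poly (leq_ltn_trans _ kN) ?leq_ord//.
by rewrite ltnS (leq_trans (leq_subr _ _) (ltnW kN)).
Qed.

Lemma residual_coef_bound N i k : (N <= k)%N ->
  `|(D N i)`_k| <= #|I|%:R * (k.+1%:R * (C * V * sg ^+ k)).
Proof.
move=> Nk; rewrite /D coefB coef_deriv coef_sum {1}/q coef_poly ltnS ltnNge Nk/=.
rewrite mul0rn sub0r normrN.
apply: (le_trans (ler_norm_sum _ _ _)).
rewrite mulr_natl -sumr_const; apply: ler_sum => l _.
rewrite coefM; apply: (le_trans (ler_norm_sum _ _ _)).
rewrite mulr_natl -[X in _ *+ X]card_ord -sumr_const; apply: ler_sum => j _.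
have -> : C * V * sg ^+ k = (C * sg ^+ j) * (V * sg ^+ (k - j)).
  have -> : sg ^+ k = sg ^+ j * sg ^+ (k - j) by rewrite -exprD subnKC// -ltnS.
  by ring.
have s0 k' : 0 <= sg ^+ k' by rewrite exprn_ge0// ltW.
rewrite normrM; apply: ler_pM => //; rewrite !coef_poly; case: ifP => // _.
  by rewrite normr0 mulr_ge0.
by rewrite normr0 mulr_ge0.
Qed.

Lemma residual_bound N i (t : R) : `|t| <= d ->
  `|(D N i).[t]| <= 2 * (#|I|%:R * (C * V)) * 2^-1 ^+ N.
Proof.
move=> td; have /andP[st0 st] := sgt td.
rewrite horner_coef -(big_mkord xpredT (fun k => (D N i)`_k * t ^+ k)).
set n := size _.
have K0 : 0 <= #|I|%:R * (C * V) by rewrite !mulr_ge0.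
have [nN|Nn] := leqP n N.
  rewrite big1_seq ?normr0; first by rewrite !mulr_ge0// exprn_ge0// invr_ge0.
  move=> k; rewrite mem_index_iota => /andP[_ /andP[_ kn]].
  by rewrite residual_coef ?mul0r// (leq_trans kn).
rewrite (@big_cat_nat _ _ _ N)//=; last exact: ltnW.
rewrite [X in `|X + _|]big1_seq ?add0r; last first.
  move=> k; rewrite mem_index_iota => /andP[_ /andP[_ kn]].
  by rewrite residual_coef ?mul0r.
apply: (le_trans (ler_norm_sum _ _ _)).
apply: (@le_trans _ _ (\sum_(N <= k < n) #|I|%:R * (C * V) * 2^-1 ^+ k)).
  rewrite big_seq [leRHS]big_seq; apply: ler_sum => k.
  rewrite mem_index_iota => /andP[Nk _]; rewrite normrM normrX.
  apply: le_trans (ler_wpM2r _ (residual_coef_bound i Nk)) _; first by rewrite exprn_ge0.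
  have -> : #|I|%:R * (k.+1%:R * (C * V * sg ^+ k)) * `|t| ^+ k =
     (#|I|%:R * (C * V)) * (k.+1%:R * (sg * `|t|) ^+ k) by rewrite exprMn; ring.
  rewrite ler_wpM2l//.
  have -> : (2^-1 : R) ^+ k = 2 ^+ k * 4^-1 ^+ k by rewrite -exprMn; congr (_ ^+ _); field.
  apply: ler_pM; rewrite ?ler0n ?exprn_ge0//; last by rewrite lerXn2r ?nnegrE ?invr_ge0.
  by rewrite -natrX ler_nat ltn_expl.
rewrite -mulr_sumr [2 * _]mulrC -[leRHS]mulrA ler_wpM2l//.
by apply: geometric_tail => //; rewrite invr_ge0.
Qed.

Let geometric_segment_bound (a : nat -> R) (K : R) N M (t : R) : 0 <= K -> (forall k, `|a k| <= K * sg ^+ k) ->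
  `|t| <= d -> `|\sum_(N <= k < M) a k * t ^+ k| <= 2 * K * 2^-1 ^+ N.
Proof.
move=> K0 aK td; have /andP[st0 st] := sgt td.
apply: (le_trans (ler_norm_sum _ _ _)).
apply: (@le_trans _ _ (\sum_(N <= k < M) K * 2^-1 ^+ k)).
  apply: ler_sum => k _; rewrite normrM normrX.
  apply: (@le_trans _ _ (K * (sg * `|t|) ^+ k)).
    by rewrite exprMn mulrA ler_wpM2r// exprn_ge0.
  rewrite ler_wpM2l// lerXn2r ?nnegrE ?invr_ge0//; lra.
rewrite -mulr_sumr [2 * K]mulrC -mulrA ler_wpM2l//.
by apply: geometric_tail => //; rewrite invr_ge0.
Qed.

Lemma series_coef_bound i l (t : R) : `|t - s| <= d -> `|B i l t| <= 2 * C.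
Proof.
move=> td.
have cv : `|\sum_(k < n) (t - s) ^+ k * c k i l| @[n --> \oo] --> `|B i l t|.
  by apply: cvg_norm; apply: cB; exact: le_lt_trans dr.
apply: (cvgr_to_le cv); apply: nearW => n.
rewrite -(big_mkord xpredT (fun k => (t - s) ^+ k * c k i l)).
under eq_bigr do rewrite mulrC.
have := @geometric_segment_bound (fun k => c k i l) C 0 n (t - s) C0 (fun k => cC k i l) td.
by rewrite expr0 mulr1.
Qed.

Lemma series_tail_bound N i l (t : R) : `|t - s| <= d ->
  `|B i l t - (p N i l).[t - s]| <= 2 * C * 2^-1 ^+ N.
Proof.
move=> td.
have cv : `|\sum_(k < n) (t - s) ^+ k * c k i l - (p N i l).[t - s]| @[n --> \oo] -->
    `|B i l t - (p N i l).[t - s]|.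
  apply: cvg_norm; apply: cvgB; last exact: cvg_cst.
  by apply: cB; exact: le_lt_trans dr.
apply: (cvgr_to_le cv); exists N => // n /= Nn.
rewrite horner_poly -(big_mkord xpredT (fun k => (t - s) ^+ k * c k i l)).
rewrite -(big_mkord xpredT (fun k => c k i l * (t - s) ^+ k)) (@big_cat_nat _ _ _ N)//=.
under eq_bigr do rewrite mulrC.
rewrite addrAC subrr add0r; under eq_bigr do rewrite mulrC.
exact: (@geometric_segment_bound (fun k => c k i l)).
Qed.

Lemma taylor_poly_bound N l (t : R) : `|t| <= d -> `|(q N l).[t]| <= 2 * V.
Proof.
move=> td; rewrite horner_poly -(big_mkord xpredT (fun k => x k l * t ^+ k)).
have := @geometric_segment_bound (fun k => x k l) V 0 N.+1 t V0 (fun k => xV k l) td.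
by rewrite expr0 mulr1.
Qed.

(** The error [e = phi - q] satisfies [e' = B e + O(2^-N)] and vanishes at [s]; on an
    interval so short that [B] contracts, the mean value theorem bounds the
    maximum of the error by a multiple of the residual. *)
Lemma taylor_error : exists2 K : R, 0 <= K & forall N i (t : R), `|t - s| <= d ->
  `|phi i t - (q N i).[t - s]| <= K * 2^-1 ^+ N.
Proof.
set n : R := #|I|%:R; pose eps N := 6 * (n * (C * V)) * 2^-1 ^+ N.
have nCV0 : 0 <= n * (C * V) by rewrite !mulr_ge0.
have e0 N : 0 <= eps N by rewrite /eps !mulr_ge0// exprn_ge0// invr_ge0.
exists (2 * n * d * (6 * (n * (C * V)))); first by rewrite !mulr_ge0// ltW.
move=> N.
pose e i t := phi i t - (q N i).[t - s].
pose de i t := \sum_l B i l t * phi l t - ((q N i)^`()).[t - s].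
have dq i (t : R) : is_derive t 1 (fun t : R => (q N i).[t - s]) (((q N i)^`()).[t - s]).
  have -> : (fun t : R => (q N i).[t - s]) = horner (q N i \Po ('X - s%:P)).
    by apply/funext => u; rewrite horner_comp !hornerE.
  apply: is_derive_eq.
  by rewrite deriv_comp derivB derivX derivC subr0 mulr1 horner_comp !hornerE.
have deE i (t : R) : `|t - s| <= d -> is_derive t 1 (e i) (de i t).
  move=> td; apply: is_deriveB; first exact: phiE (le_lt_trans td dr).
have ces i (t : R) : `|t - s| <= d -> {for t, continuous (e i)}.
  by move=> td; apply/differentiable_continuous/derivable1_diffP; case: (deE i t td).
have es i : e i s = 0.
  rewrite /e subrr horner_coef0 coef_poly /= /x /taylor_coef /=; exact: subrr.
pose g (t : R) := \sum_i `|e i t|.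
have sdd : s - d <= s + d by rewrite lerD2l ge0_cp// ltW.
have inb (t : R) : (t \in `[s - d, s + d]) = (`|t - s| <= d).
  by rewrite in_itv/= ler_distl.
have [|ts tsd gmax] := @EVT_max R g (s - d) (s + d) sdd.
  apply: continuous_in_subspaceT => t /set_mem /=; rewrite inb => td.
  by apply: cvg_sumr => i; apply: cvg_norm; exact: ces.
have key i (t : R) : `|t - s| <= d -> `|e i t| <= d * (2 * C * g ts + eps N).
  apply: (mean_value_bound (ltW d0) (deE i)) => // u ud.
  have -> : de i u = \sum_l B i l u * e l u +
      \sum_l (B i l u - (p N i l).[u - s]) * (q N l).[u - s] - (D N i).[u - s].
    rewrite /de /D hornerD hornerN horner_sum -big_split/=.
    under [X in _ = X - _]eq_bigr => l _.
      rewrite (_ : _ + _ = B i l u * phi l u - (p N i l * q N l).[u - s]); last first.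
        by rewrite hornerM /e; ring.
      over.
    by rewrite sumrB; ring.
  apply: (le_trans (ler_normB _ _)).
  apply: (@le_trans _ _ (2 * C * g ts + n * (2 * C * 2^-1 ^+ N * (2 * V)) +
     2 * (n * (C * V)) * 2^-1 ^+ N)); last by rewrite /eps; lra.
  apply: lerD; last exact: residual_bound.
  apply: (le_trans (ler_normD _ _)); apply: lerD.
    apply: (le_trans (ler_norm_sum _ _ _)).
    apply: (@le_trans _ _ (\sum_l 2 * C * `|e l u|)).
      by apply: ler_sum => l _; rewrite normrM ler_wpM2r// series_coef_bound.
    rewrite -mulr_sumr ler_wpM2l// ?mulr_ge0//.
    by apply: gmax; rewrite inb.
  apply: (le_trans (ler_norm_sum _ _ _)).
  rewrite /n mulr_natl -sumr_const; apply: ler_sum => l _.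
  by rewrite normrM; apply: ler_pM => //; [exact: series_tail_bound|exact: taylor_poly_bound].
have gts : g ts <= n * (d * (2 * C * g ts + eps N)).
  rewrite {1}/g /n [leRHS]mulr_natl -sumr_const; apply: ler_sum => i _.
  by apply: key; rewrite -inb.
have ndC : n * C * d <= 4^-1.
  by apply: le_trans sgd; rewrite ler_wpM2r// ltW.
have g0 : 0 <= g ts by apply: sumr_ge0.
have gts2 : g ts <= 2 * n * d * eps N.
  have h : n * (d * (2 * C * g ts)) <= 2^-1 * g ts.
    have -> : n * (d * (2 * C * g ts)) = 2 * (n * C * d) * g ts by ring.
    by rewrite ler_wpM2r//; lra.
  have : g ts <= 2^-1 * g ts + n * (d * eps N).
    by apply: (le_trans gts); rewrite mulrDr mulrDr lerD2r.
  lra.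
move=> i t td; apply: (@le_trans _ _ (g t)).
  by rewrite /g (bigD1 i)//= lerDl sumr_ge0.
apply: (@le_trans _ _ (g ts)); first by apply: gmax; rewrite inb.
by rewrite -mulrA.
Qed.

End AnalyticODE.

Section IsolatedZeros.
Variable R : realType.
Notation mu := (@lebesgue_measure R).

Definition vanish_near (f : R -> R) (s : R) := exists2 e : R, 0 < e &
  forall t, `|t - s| < e -> f t = 0.

Definition nonzero_around (f : R -> R) (s : R) := exists2 e : R, 0 < e &
  forall t, t != s -> `|t - s| < e -> f t != 0.

(** A linear combination of the coordinates is the sum of its Taylor series near [s], by
    [taylor_error], so that [power_series_zeros] applies to it. *)
Lemma linear_ode_local_zeros (I : finType) (B : I -> I -> R -> R)
    (phi : I -> R -> R) (s r : R) (c : nat -> I -> I -> R) (w : I -> R) : 0 < r ->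
  (forall i l (t : R), `|t - s| < r ->
    \sum_(k < n) (t - s) ^+ k * c k i l @[n --> \oo] --> B i l t) ->
  (forall i (t : R), `|t - s| < r ->
    is_derive t 1 (phi i) (\sum_l B i l t * phi l t)) ->
  vanish_near (fun t => \sum_i w i * phi i t) s \/
  nonzero_around (fun t => \sum_i w i * phi i t) s.
Proof.
move=> r0 cB phiE; have [C C0 hC] := coef_bound r0 cB.
(* [sg] bounds both the growth rate of the coefficients and [#|I| C]. *)
pose sg : R := 2 / r + #|I|%:R * C.
have r2 : 0 < 2 / r by rewrite divr_gt0.
have nC0 : 0 <= #|I|%:R * C by rewrite mulr_ge0.
have s0 : 0 < sg by rewrite /sg ltr_pwDl.
have nC : #|I|%:R * C <= sg by rewrite /sg lerDr ltW.
have sr : 2 / r <= sg by rewrite /sg lerDl.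
have cC k i l : `|c k i l| <= C * sg ^+ k.
  apply: (@le_trans _ _ (C * (2 / r) ^+ k)); last first.
    by rewrite ler_wpM2l// lerXn2r// nnegrE ltW.
  by rewrite -[2 / r]invf_div exprVn ler_pdivlMr ?exprn_gt0 ?divr_gt0// hC.
pose d : R := 4^-1 / sg.
have d0 : 0 < d by rewrite divr_gt0// invr_gt0.
have sgd : sg * d <= 4^-1 by rewrite /d mulrCA divff ?gt_eqF// mulr1.
have dr : d < r.
  rewrite /d ltr_pdivrMr//.
  have : 2 <= sg * r by rewrite -ler_pdivrMr.
  lra.
pose V : R := \sum_i `|phi i s|.
have V0 : 0 <= V by apply: sumr_ge0.
have vV i : `|phi i s| <= V by rewrite /V (bigD1 i)//= lerDl sumr_ge0.
have [K K0 hK] := taylor_error cB phiE C0 V0 s0 d0 nC cC vV sgd dr.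
pose x := taylor_coef c (phi ^~ s).
have xV k i : `|x k i| <= V * sg ^+ k := taylor_coef_bound s0 C0 V0 nC cC vV k i.
pose F t := \sum_i w i * phi i (s + t).
pose g k := \sum_i w i * x k i.
have gb k : `|g k| <= (\sum_i `|w i|) * V * sg ^+ k.
  apply: (le_trans (ler_norm_sum _ _ _)).
  rewrite -mulrA mulr_suml; apply: ler_sum => i _.
  by rewrite normrM ler_wpM2l.
have gF t : `|t| <= d -> \sum_(k < N.+1) g k * t ^+ k @[N --> \oo] --> F t.
  move=> td.
  rewrite (_ : (fun N => _) = fun N => \sum_i w i * \sum_(k < N.+1) x k i * t ^+ k); last first.
    apply/funext => N; under eq_bigr do rewrite mulr_suml.
    rewrite exchange_big/=; apply: eq_bigr => i _; rewrite mulr_sumr.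
    by apply: eq_bigr => k _; rewrite mulrA.
  apply: cvg_sumr => i; apply: cvgM; first exact: cvg_cst.
  apply/cvgrPdist_le => e e0.
  have : K * 2^-1 ^+ N @[N --> \oo] --> (0 : R).
    apply: (@cvg_geometric R K 2^-1).
    by rewrite ger0_norm ?invr_ge0// invf_lt1// ltr1n.
  move=> /cvgrPdist_le /(_ _ e0); apply: filterS => N.
  rewrite sub0r normrN => h; have := hK N i (s + t).
  rewrite horner_poly addrAC subrr add0r => /(_ td)/le_trans; apply.
  exact: le_trans (ler_norm _) h.
have [F0|[e e0 Fe]] := power_series_zeros d0 s0 sgd (mulr_ge0 (sumr_ge0 _ (fun i _ => normr_ge0 (w i))) V0) gb gF.
  left; exists d => // t td; have := F0 (t - s) (ltW td).
  by rewrite /F subrKC.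
right; exists e => // t ts te; have := Fe (t - s).
by rewrite normr_gt0 subr_eq0 => /(_ ts te); rewrite /F subrKC.
Qed.

(** Both the set where [f] vanishes locally and the set where its zeros are isolated are
    open, they are disjoint, and together they cover the half-line, which is
    connected.  Isolated zeros are finitely many in each compact interval. *)
Lemma zeros_dichotomy (f : R -> R) :
  (forall s : R, 0 < s -> vanish_near f s \/ nonzero_around f s) ->
  (forall t : R, 0 < t -> f t = 0) \/ {ae mu, forall t : R, 0 < t -> f t != 0}.
Proof.
move=> loc.
pose W := [set s : R | vanish_near f s].
pose U := [set s : R | nonzero_around f s].
have WU s : W s -> U s -> False.
  move=> [e e0 We] [e' e0' Ue].
  pose h := Num.min e e' / 2.
  have m0 : 0 < Num.min e e' by rewrite lt_min e0.
  have h0 : 0 < h by rewrite /h divr_gt0.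
  have hm : h < Num.min e e' by rewrite /h; lra.
  have := hm; rewrite lt_min => /andP[he he'].
  have sh : `|s + h - s| = h by rewrite addrAC subrr add0r gtr0_norm.
  have /Ue : s + h != s by rewrite -subr_eq0 -normr_eq0 sh gt_eqF.
  by rewrite sh We ?sh// eqxx => /(_ he').
have oW : open W.
  rewrite openE => s [e e0 We]; exists (e / 2); first by rewrite /= divr_gt0.
  move=> t /= st; exists (e / 2); first by rewrite divr_gt0.
  move=> u ut; apply: We; rewrite (splitr e) -(subrKA t).
  by apply: (le_lt_trans (ler_normD _ _)); rewrite ltrD// distrC.
have oU : open U.
  rewrite openE => s [e e0 Ue]; exists e => // t /= st.
  have [<-|ts] := eqVneq s t; first by exists e.
  exists (Num.min (e - `|s - t|) `|s - t|).
    by rewrite lt_min subr_gt0 st normr_gt0 subr_eq0.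
  move=> u ut; rewrite lt_min => /andP[u1 u2]; apply: Ue.
    by apply: contraTneq u2 => ->; rewrite ltxx.
  rewrite -(subrKA t); apply: (le_lt_trans (ler_normD _ _)).
  by rewrite [X in _ + X]distrC; lra.
have [[s0 [s00 Ws0]]|noW] := pselect (exists s, 0 < s /\ W s).
  left => t t0.
  have cI : connected (`]0, +oo[%classic : set R).
    by apply/connected_intervalP; exact: interval_is_interval.
  have := cI (`]0, +oo[%classic `&` W).
  have -> : `]0, +oo[ `&` W = `]0, +oo[ `&` ~` U.
    apply/seteqP; split=> [x [x0 Wx]|x [x0 Ux]]; split => //.
      by move=> /(WU _ Wx).
    have := x0; rewrite /= in_itv/= andbT => /loc[//|]; by move=> /Ux.
  move=> /(_ _ _ _) h.
  have e : `]0, +oo[ `&` ~` U = `]0, +oo[%classic.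
    apply: h.
    - exists s0; split; first by rewrite /= in_itv/= s00.
      by move=> /(WU _ Ws0).
    - exists W => //; apply/seteqP; split=> [x [x0 Ux]|x [x0 Wx]]; split => //.
        by have := x0; rewrite /= in_itv/= andbT => /loc[//|]; move=> /Ux.
      by move=> /(WU _ Wx).
    - by exists (~` U) => //; exact: open_closedC.
  have : (`]0, +oo[ `&` ~` U) t by rewrite e /= in_itv/= t0.
  move=> [_ Ut]; have [[e' e0' We]|/Ut//] := loc t t0.
  by apply: We; rewrite subrr normr0.
right.
have allU s : 0 < s -> U s.
  by move=> s0; have [Ws|//] := loc s s0; exfalso; apply: noW; exists s.
(* The zeros in the compact interval [1/(n+1), n+1]. *)
pose Z n := [set t : R | n.+1%:R^-1 <= t <= n.+1%:R /\ f t = 0].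
have finZ n : finite_set (Z n).
  apply: contrapT => infZ.
  have bZ : bounded_set (Z n).
    exists n.+1%:R; split; first exact: num_real.
    move=> M nM t [/andP[t1 t2] _] /=; rewrite ger0_norm; first exact: le_trans t2 (ltW nM).
    by rewrite (le_trans _ t1)// invr_ge0.
  have [a aZ] := infinite_bounded_limit_point_nonempty infZ bZ.
  have a0 : 0 < a.
    rewrite ltNge; apply/negP => a0.
    have : nbhs a [set t : R | t < n.+1%:R^-1].
      by apply: lt_nbhsl; rewrite (le_lt_trans a0)// invr_gt0.
    by move=> /aZ [t [_ [/andP[t1 _] _] /= t2]]; move: (le_lt_trans t1 t2); rewrite ltxx.
  have [e e0 Ue] := allU a a0.
  have : nbhs a (ball a e) by exact: nbhsx_ballx.
  move=> /aZ [t [ta [_ ft] /=]]; rewrite /ball/= distrC => /(Ue t ta).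
  by rewrite ft eqxx.
have cZ : countable (\bigcup_n Z n).
  by apply: bigcup_countable => // n _; exact: finite_set_countable.
exists (\bigcup_n Z n); split.
- by apply: countable_measurable => // t; exact: measurable_set1.
- exact: countable_lebesgue_measure0.
- move=> t /= /not_implyP[t0 /negP]; rewrite negbK => /eqP ft.
  pose n := Num.truncn (Num.max t t^-1).
  have nt : Num.max t t^-1 < n.+1%:R.
    by rewrite /n truncnS_gt.
  exists n => //; split => //.
  move: nt; rewrite gt_max => /andP[tn /ltW tVn]; rewrite (ltW tn) andbT.
  by rewrite -[leRHS]invrK lef_pV2 ?posrE ?invr_gt0 ?ltr0n.
Qed.

End IsolatedZeros.

(** * Flow of the dual equation and moments of controls *)

Section FundamentalMatrix.
Variable R : realType.
Notation mu := (@lebesgue_measure R).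
Notation "f \Rint D" := (mu.-integrable D (EFin \o f)) (at level 50).
Variables (I : finType) (a : I -> I -> R -> R).
Hypothesis ca : forall i l, continuous (a i l).

Lemma fundamental_matrix (B : I -> I -> R -> R) : (forall i l, continuous (B i l)) ->
  exists X : I -> I -> R -> R, (forall i j, continuous (X i j)) /\
  (forall i j t, X i j t = (i == j)%:R + \int[mu]_(s in `[0, t]) \sum_l B i l s * X l j s).
Proof.
move=> cB.
have /choice [X hX] : forall j, exists x : I -> R -> R, (forall i, continuous (x i)) /\
    (forall i t, x i t = (i == j)%:R + \int[mu]_(s in `[0, t]) \sum_l B i l s * x l s).
  by move=> j; exact: linear_ode_exists.
exists (fun i j => X j i); split => [i j|i j t]; first exact: (hX j).1.
exact: (hX j).2.
Qed.

Lemma Rintegrable_linear (B : I -> I -> R -> R) (x : I -> R -> R) i T :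
  (forall i l, continuous (B i l)) -> (forall i, continuous (x i)) ->
  (fun s => \sum_l B i l s * x l s) \Rint `[0, T].
Proof. by move=> cB cx; apply: Rintegrable_continuous; exact: continuous_lin. Qed.

(** The derivative of [\sum_i x_i y_i] is [\sum_i g_i x_i], as the terms in [a] cancel.
    Integration by parts stands in for the product rule, since [y] need only be
    absolutely continuous. *)
Lemma pairing (x y : I -> R -> R) (x0 y0 : I -> R) (g : I -> R -> R) (T : R) : 0 <= T ->
  (forall i, (fun s => \sum_l a l i s * x l s) \Rint `[0, T]) ->
  (forall i (t : R), 0 <= t <= T -> x i t = x0 i + \int[mu]_(s in `[0, t]) \sum_l a l i s * x l s) ->
  (forall i, (fun s => g i s - \sum_l a i l s * y l s) \Rint `[0, T]) ->
  (forall i (t : R), 0 <= t <= T -> y i t = y0 i +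
     \int[mu]_(s in `[0, t]) (g i s - \sum_l a i l s * y l s)) ->
  \sum_i x i T * y i T = \sum_i x0 i * y0 i +
    \int[mu]_(s in `[0, T]) \sum_i g i s * x i s.
Proof.
move=> T0 xi xE gi yE.
have h i := Rintegration_by_parts_cst (x0 i) (y0 i) T0 (xi i) (gi i).
have TT : 0 <= T <= T by rewrite T0 lexx.
transitivity (\sum_i (x0 i * y0 i + \int[mu]_(s in `[0, T])
   ((\sum_l a l i s * x l s) * y i s + (g i s - \sum_l a i l s * y l s) * x i s))).
  apply: eq_bigr => i _; rewrite xE// yE//; have [_ _ ->] := h i.
  congr (_ + _); apply: eq_Rintegral => s; rewrite mem_setE /= in_itv/= => sT.
  by rewrite -xE// -yE.
rewrite big_split/=; congr (_ + _).
rewrite -Rintegral_sum//; last first.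
  move=> i; have [h1 h2 _] := h i.
  have sub : mu.-integrable `[0, T] (EFin \o (fun s =>
     (\sum_l a l i s * x l s) * (y0 i + \int[mu]_(r in `[0, s]) (g i r - \sum_l a i l r * y l r))
     + (g i s - \sum_l a i l s * y l s) * (x0 i + \int[mu]_(r in `[0, s]) \sum_l a l i r * x l r))).
    by apply: RintegrableD.
  apply: eq_integrable sub => // s; rewrite mem_setE /= in_itv/= => sT.
  by rewrite -xE// -yE.
apply: eq_Rintegral => s _.
transitivity (\sum_i (g i s * x i s) + (\sum_i \sum_l a l i s * x l s * y i s
   - \sum_i \sum_l a i l s * y l s * x i s)).
  rewrite -sumrB -big_split/=; apply: eq_bigr => i _.
  by rewrite -mulr_suml -mulr_suml; ring.
rewrite [X in _ + (_ - X)]exchange_big/=.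
rewrite [X in _ + (X - _)](eq_bigr (fun i => \sum_l a l i s * y i s * x l s)) ?subrr ?addr0//.
by move=> i _; apply: eq_bigr => l _; ring.
Qed.

End FundamentalMatrix.

Section ContinuousColumn.
Variable R : realType.

Lemma continuous_cV n (y : R -> 'cV[R]_n) :
  (forall j, continuous (fun t => y t j ord0)) -> continuous y.
Proof.
move=> cy t; apply/cvgrPdist_le => /= r r0.
have h j : \forall s \near t, `|y t j ord0 - y s j ord0| <= r.
  by have /cvgrPdist_le/(_ r r0) := cy j t.
move/filter_forall: h; apply: filterS => s hs.
rewrite [leLHS]/Num.Def.normr/= mx_normrE.
by apply: (bigmax_le _ (ltW r0)) => -[j q] _ /=; rewrite !mxE ord1.
Qed.

End ContinuousColumn.

Section ControlSystem.
Variable R : realType.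
Notation mu := (@lebesgue_measure R).
Notation "f \Rint D" := (mu.-integrable D (EFin \o f)) (at level 50).
Variables (m d : nat) (A : R -> 'M[R]_m.+1) (b : 'I_d.+1 -> 'cV[R]_m.+1).
Variable y0 : 'cV[R]_m.+1.
Hypothesis A_cont : {within `[0, +oo[, continuous A}.
Notation I := ('I_m.+1).

(** Freezing the coefficients to the left of [0] makes them continuous on all of R. *)
Definition frozen (i l : I) (t : R) : R := A (Num.max t 0) i l.
Notation a := frozen.

Lemma frozenE i l (t : R) : 0 <= t -> a i l t = A t i l.
Proof. by move=> t0; rewrite /a max_l. Qed.

Lemma frozen_continuous i l : continuous (a i l).
Proof.
move=> t; apply/cvgrPdist_lt => e e0.
pose u : R := Num.max t 0.
have u0 : `[0, +oo[%classic u by rewrite /= in_itv/= andbT le_max lexx orbT.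
have /subspace_continuousP /(_ u u0) := A_cont.
move=> /cvgrPdist_lt /(_ e e0).
move=> /nbhs_ballP[r /= r0 h].
exists r => // s /= ts.
have us : `|u - Num.max s 0| < r.
  apply: le_lt_trans ts; rewrite /u /Num.max; case: ltP => t0; case: ltP => s0 //.
  - by rewrite subrr normr0.
  - by rewrite sub0r normrN [leLHS]ger0_norm// [leRHS]ler0_norm ?subr_le0 ?(le_trans (ltW t0))//; lra.
  - by rewrite subr0 [leLHS]ger0_norm// [leRHS]ger0_norm ?subr_ge0 ?(le_trans (ltW s0))//; lra.
have /(_ us) := h (Num.max s 0).
rewrite /= in_itv/= andbT le_max lexx orbT => /(_ isT) /(le_lt_trans _); apply.
rewrite [leRHS]/Num.Def.normr/= mx_normrE.
by apply: le_trans (le_bigmax _ _ (i, l)); rewrite /= !mxE.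
Qed.

Variables Phi Y : I -> I -> R -> R.
Hypothesis cPhi : forall i j, continuous (Phi i j).
Hypothesis PhiE : forall i j t, Phi i j t =
  (i == j)%:R + \int[mu]_(s in `[0, t]) \sum_l a l i s * Phi l j s.
Hypothesis cY : forall i j, continuous (Y i j).
Hypothesis YE : forall i j t, Y i j t =
  (i == j)%:R + \int[mu]_(s in `[0, t]) \sum_l (- a i l s) * Y l j s.

Definition flow (t : R) : 'M[R]_m.+1 := \matrix_(i, j) Phi i j t.
Definition coflow (t : R) : 'M[R]_m.+1 := \matrix_(i, j) Y i j t.

Lemma flow0 : flow 0 = 1%:M.
Proof. by apply/matrixP => i j; rewrite !mxE PhiE Rintegral_itv1 addr0. Qed.

Let ca i l : continuous (a i l) := @frozen_continuous i l.

Let cna i l : continuous (fun s => - a i l s).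
Proof. by move=> s; apply: cvgN; exact: ca. Qed.

Lemma coflow_sub k i s :
  \sum_l (- a k l s) * Y l i s = 0 - \sum_l a k l s * Y l i s.
Proof. by rewrite sub0r -sumrN; apply: eq_bigr => l _; rewrite mulNr. Qed.

(** [Y^T *m Phi] is constant: its entries pair solutions of the dual equation with
    solutions of the homogeneous state equation. *)
Lemma coflow_flow (t : R) : 0 <= t -> (coflow t)^T *m flow t = 1%:M.
Proof.
move=> t0; apply/matrixP => i j; rewrite !mxE.
have := @pairing R _ a (fun k => Phi k j) (fun k => Y k i) (fun k => (k == j)%:R)
  (fun k => (k == i)%:R) (fun _ _ => 0) t t0.
move=> /(_ _ _ _ _) h.
transitivity (\sum_k Phi k j t * Y k i t).
  by apply: eq_bigr => k _; rewrite !mxE mulrC.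
rewrite h//.
- rewrite (@eq_Rintegral _ _ _ mu _ (fun=> 0)); last first.
    by move=> s _; rewrite big1// => k _; rewrite mul0r.
  rewrite Rintegral_cst// mul0r addr0 (bigD1 i)//= eqxx mulr1 big1 ?addr0//.
  by move=> k /negPf ->; rewrite mulr0.
- by move=> k; apply: (@Rintegrable_linear _ _ (fun i l => a l i)) => // l; exact: cPhi.
- move=> k; apply: eq_Rintegrable (Rintegrable_linear k t cna (fun l => @cY l i)) => s; exact: coflow_sub.
- move=> k s _; rewrite YE; congr (_ + _); apply: eq_Rintegral => r _; exact: coflow_sub.
Qed.

Lemma flow_coflow (t : R) : 0 <= t -> flow t *m (coflow t)^T = 1%:M.
Proof. by move=> t0; apply: mulmx1C; exact: coflow_flow. Qed.

Lemma flow_unit (t : R) : 0 <= t -> flow t \in unitmx.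
Proof. by move=> t0; have [] := mulmx1_unit (flow_coflow t0). Qed.

Lemma flow_coord (z : 'cV[R]_m.+1) i t : (flow t *m z) i ord0 = \sum_j z j ord0 * Phi i j t.
Proof. by rewrite mxE; apply: eq_bigr => j _; rewrite mxE mulrC. Qed.

Lemma flow_coord_continuous (z : 'cV[R]_m.+1) i : continuous (fun t => (flow t *m z) i ord0).
Proof.
under eq_fun do rewrite flow_coord.
by apply: continuous_sum => j s; apply: cvgM; [exact: cvg_cst|exact: cPhi].
Qed.

Lemma flow_integral (z : 'cV[R]_m.+1) i t : (flow t *m z) i ord0 =
  z i ord0 + \int[mu]_(s in `[0, t]) \sum_l a l i s * (flow s *m z) l ord0.
Proof.
have cl j : (fun s => \sum_l a l i s * Phi l j s) \Rint `[0, t].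
  by apply: (@Rintegrable_linear _ _ (fun i l => a l i)) => // l; exact: cPhi.
transitivity (\sum_j (z j ord0 * (i == j)%:R +
   \int[mu]_(s in `[0, t]) (z j ord0 * \sum_l a l i s * Phi l j s))).
  rewrite flow_coord; apply: eq_bigr => j _; rewrite PhiE mulrDr; congr (_ + _).
  by rewrite RintegralZl.
rewrite big_split/= (bigD1 i)//= eqxx mulr1 big1 ?addr0; last first.
  by move=> j /negPf; rewrite eq_sym => ->; rewrite mulr0.
congr (_ + _); rewrite -Rintegral_sum//; last by move=> j; apply: RintegrableZ.
apply: eq_Rintegral => s _.
under [LHS]eq_bigr do rewrite mulr_sumr; rewrite exchange_big/=.
apply: eq_bigr => l _; rewrite flow_coord mulr_sumr; apply: eq_bigr => j _; ring.
Qed.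

Lemma flow_lin_continuous (z : 'cV[R]_m.+1) i :
  continuous (fun s => \sum_l a l i s * (flow s *m z) l ord0).
Proof.
by apply: (@continuous_lin _ _ (fun i l => a l i)) => // l; exact: flow_coord_continuous.
Qed.

Lemma flow_is_derive (z : 'cV[R]_m.+1) i (t : R) : 0 < t ->
  is_derive t 1 (fun t => (flow t *m z) i ord0) (\sum_l a l i t * (flow t *m z) l ord0).
Proof.
move=> t0.
rewrite (_ : (fun t => (flow t *m z) i ord0) = cst (z i ord0) +
   (fun t => \int[mu]_(s in `[0, t]) \sum_l a l i s * (flow s *m z) l ord0)); last first.
  by apply/funext => s /=; exact: flow_integral.
have h := primitive_is_derive (@flow_lin_continuous z i) t0.
by apply: is_derive_eq; rewrite add0r.
Qed.

Lemma dual_rhsE (z : 'cV[R]_m.+1) i (t : R) : 0 <= t ->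
  ((A t)^T *m z) i ord0 = \sum_l a l i t * z l ord0.
Proof. by move=> t0; rewrite mxE; apply: eq_bigr => l _; rewrite mxE frozenE. Qed.

Lemma flow_dual_solution (z : 'cV[R]_m.+1) : dual_solution A (fun t => flow t *m z).
Proof.
split=> [t t0|].
  have dM : derivable (fun t => flow t *m z) t 1.
    by apply/derivable_mxP => i j; rewrite ord1; case: (flow_is_derive z i t0).
  apply: DeriveDef => //; rewrite derive_mx//.
  apply/matrixP => i j; rewrite mxE ord1 dual_rhsE ?(ltW t0)//.
  by case: (flow_is_derive z i t0).
apply/cvgrPdist_le => e e0.
have cz i : \forall h \near 0^'+, `|\sum_l a l i 0 * (flow 0 *m z) l ord0 -
    h^-1 * ((flow h *m z) i ord0 - (flow 0 *m z) i ord0)| <= e.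
  have /cvgrPdist_le /(_ e e0) := @flow_lin_continuous z i 0.
  move=> /nbhs_ballP[r /= r0 hr]; exists r => //= h /= h0r h0.
  have [|x|c c0h ->] := @MVT R (fun t => (flow t *m z) i ord0)
    (fun t => \sum_l a l i t * (flow t *m z) l ord0) 0 h h0.
  - by move=> x; rewrite in_itv/= => /andP[x0 _]; exact: flow_is_derive.
  - by apply: continuous_subspaceT; exact: flow_coord_continuous.
  - rewrite subr0 mulrCA mulVf ?gt_eqF// mulr1; apply: hr.
    move: c0h h0r; rewrite in_itv/= /ball/= => /andP[c0 ch].
    by rewrite !sub0r !normrN !gtr0_norm//; exact: lt_trans.
have : \forall h \near 0^'+, forall i, `|\sum_l a l i 0 * (flow 0 *m z) l ord0 -
    h^-1 * ((flow h *m z) i ord0 - (flow 0 *m z) i ord0)| <= e.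
  exact: filter_forall.
apply: filterS => h hh; rewrite [leLHS]/Num.Def.normr/= mx_normrE.
apply: (bigmax_le _ (ltW e0)) => -[i j] _ /=; rewrite ord1.
apply: le_trans (hh i).
rewrite -dual_rhsE//.
move: (flow h *m z) (flow 0 *m z) => p q.
by move: ((A 0)^T *m q) => v; rewrite !mxE.
Qed.

(** The difference quotients at [0] converge, so that [phi] is continuous on the right
    there and the fundamental theorem of calculus applies on the closed interval. *)
Lemma dual_solution_integral phi : dual_solution A phi ->
  forall i (t : R), 0 <= t -> phi t i ord0 =
    phi 0 i ord0 + \int[mu]_(s in `[0, t]) \sum_l a l i s * phi s l ord0 /\
    (fun s => \sum_l a l i s * phi s l ord0) \Rint `[0, t].
Proof.
move=> [dphi phi0] i t t0.
have dphii j (s : R) : 0 < s ->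
    is_derive s 1 (fun s => phi s j ord0) (\sum_l a l j s * phi s l ord0).
  move=> s0; have [dp ep] := dphi s s0.
  apply: DeriveDef; first exact: (derivable_mxP _ _ _).1.
  by rewrite -dual_rhsE ?(ltW s0)// -ep derive_mx// mxE.
have cphi j (s : R) : 0 < s -> {for s, continuous (fun s => phi s j ord0)}.
  move=> s0; apply/differentiable_continuous/derivable1_diffP.
  by case: (dphii j s s0).
have rphi j : phi s j ord0 @[s --> 0^'+] --> phi 0 j ord0.
  have c1 : (h^-1 *: (phi h - phi 0)) j ord0 @[h --> 0^'+] --> ((A 0)^T *m phi 0) j ord0.
    exact: (@cvg_comp _ _ _ _ (fun M : 'cV[R]_m.+1 => M j ord0) _ _ _ phi0 (@coord_continuous R m.+1 1 j ord0 _)).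
  have c0 : h @[h --> (0 : R)^'+] --> (0 : R) by apply: cvg_at_right_filter; exact: cvg_id.
  have : h * (h^-1 *: (phi h - phi 0)) j ord0 + phi 0 j ord0 @[h --> 0^'+] -->
      0 * ((A 0)^T *m phi 0) j ord0 + phi 0 j ord0.
    by apply: cvgD; [exact: cvgM|exact: cvg_cst].
  rewrite mul0r add0r; apply: cvg_trans; apply: near_eq_cvg; near=> h.
  have h0 : 0 < h by near: h; exact: nbhs_right_gt.
  by rewrite /= !mxE mulrA divff ?gt_eqF// mul1r subrK.
have LR j (T : R) : 0 < T -> derivable_oo_LRcontinuous (fun s => phi s j ord0) 0 T.
  move=> T0; split => //; last by apply: cvg_at_left_filter; exact: cphi.
  by move=> x; rewrite in_itv/= => /andP[x0 _]; case: (dphii j x x0).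
have cW j (T : R) : 0 < T -> {within `[0, T], continuous (fun s => \sum_l a l j s * phi s l ord0)}.
  move=> T0 x; apply: cvg_sumr => l; apply: cvgM.
    by apply: continuous_within; exact: ca.
  exact: (derivable_oo_LRcontinuous_within (LR l T T0)).
have iW j (T : R) : 0 < T -> (fun s => \sum_l a l j s * phi s l ord0) \Rint `[0, T].
  by move=> T0; apply: continuous_compact_integrable; [exact: segment_compact|exact: cW].
move: t0; rewrite le_eqVlt => /predU1P[<-|t0].
  rewrite Rintegral_itv1 addr0; split => //; apply: RintegrableS (iW i 1 ltr01) => //.
  by apply: subset_itvl; rewrite bnd_simp.
split; last exact: iW.
rewrite /Rintegral (continuous_FTC2 t0 (cW i t t0) (LR i t t0)) /=; first by rewrite subrKC.
by move=> s; rewrite in_itv/= => /andP[s0 _]; rewrite derive1E; case: (dphii i s s0).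
Unshelve. all: by end_near. Qed.

(** By [pairing] with the columns of [coflow], [coflow^T *m phi] is constant. *)
Lemma dual_solution_flow phi : dual_solution A phi ->
  forall t : R, 0 <= t -> phi t = flow t *m phi 0.
Proof.
move=> dphi t t0.
suff e : (coflow t)^T *m phi t = phi 0.
  by rewrite -e mulmxA flow_coflow// mul1mx.
apply/matrixP => i j; rewrite ord1.
have := @pairing R _ a (fun k s => phi s k ord0) (fun k => Y k i) (fun k => phi 0 k ord0)
  (fun k => (k == i)%:R) (fun _ _ => 0) t t0.
move=> /(_ _ _ _ _) h.
transitivity (\sum_k phi t k ord0 * Y k i t).
  by rewrite mxE; apply: eq_bigr => k _; rewrite !mxE mulrC.
rewrite h//.
- rewrite (@eq_Rintegral _ _ _ mu _ (fun=> 0)); last first.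
    by move=> s _; rewrite big1// => k _; rewrite mul0r.
  rewrite Rintegral_cst// mul0r addr0 (bigD1 i)//= eqxx mulr1 big1 ?addr0//.
  by move=> k /negPf ->; rewrite mulr0.
- by move=> k; exact: (dual_solution_integral dphi k t0).2.
- by move=> k s /andP[s0 _]; exact: (dual_solution_integral dphi k s0).1.
- by move=> k; apply: eq_Rintegrable (Rintegrable_linear k t cna (fun l => @cY l i)) => s; exact: coflow_sub.
- move=> k s _; rewrite YE; congr (_ + _); apply: eq_Rintegral => r _; exact: coflow_sub.
Qed.

Definition pairing_fun (i : 'I_d.+1) (z : 'cV[R]_m.+1) (t : R) : R :=
  inner (b i) (flow t *m z).
Notation p := pairing_fun.

Lemma pairing_fun_continuous i z : continuous (p i z).
Proof.
by apply: continuous_sum => j s; apply: cvgM; [exact: cvg_cst|exact: flow_coord_continuous].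
Qed.

(** Pair the state with the dual solution that starts from [z]; the state vanishes at
    time [T]. *)
Lemma moment_of_steers (D : set R) (T : R) u : 0 <= T -> `[0, T] `<=` D ->
  steers_to_zero A b y0 D T u ->
  forall z, inner z y0 + \int[mu]_(s in `[0, T]) \sum_i u i s * p i z s = 0.
Proof.
move=> T0 TD [y [cy hy] yT] z.
have TT : 0 <= T <= T by rewrite T0 lexx.
have Dt t : 0 <= t <= T -> D t by move=> tT; apply: TD; rewrite /= in_itv.
have rE j s : 0 <= s -> (\sum_i u i s *: b i - A s *m y s) j ord0 =
    \sum_i u i s * b i j ord0 - \sum_l a j l s * y s l ord0.
  move=> s0; rewrite !mxE summxE; congr (_ - _).
    by apply: eq_bigr => i _; rewrite mxE.
  by apply: eq_bigr => l _; rewrite frozenE.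
have := @pairing R _ a (fun j s => (flow s *m z) j ord0) (fun j s => y s j ord0)
  (fun j => z j ord0) (fun j => y0 j ord0) (fun j s => \sum_i u i s * b i j ord0) T T0.
move=> /(_ _ _ _ _) h.
have : \sum_j (flow T *m z) j ord0 * y T j ord0 = 0.
  by rewrite big1// => j _; rewrite yT [X in _ * X]mxE mulr0.
rewrite h.
- move=> e; rewrite -[RHS]e; congr (_ + _); apply: eq_Rintegral => s _.
  under [RHS]eq_bigr do rewrite mulr_suml; rewrite exchange_big/=.
  apply: eq_bigr => i _; rewrite /p /inner mulr_sumr.
  by apply: eq_bigr => j _; rewrite mulrA.
- by move=> j; apply: Rintegrable_continuous; exact: flow_lin_continuous.
- by move=> j t _; exact: flow_integral.
- move=> j; apply: eq_integrable (hy T (Dt _ TT) j).1 => // s.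
  by rewrite mem_setE/= in_itv/= => /andP[s0 _]; rewrite rE.
- move=> j t tT; rewrite (hy t (Dt _ tT) j).2; congr (_ + _).
  apply: eq_Rintegral => s; rewrite mem_setE/= in_itv/= => /andP[s0 _].
  by rewrite rE.
Qed.

Lemma Rintegrable_control (u : 'I_d.+1 -> R -> R) (C T : R) i :
  (forall i, measurable_fun (`]0, +oo[ : set R) (u i)) ->
  (forall i, {ae mu, forall t : R, 0 < t -> `|u i t| <= C}) ->
  u i \Rint `[0, T].
Proof.
move=> mu_ uC; apply: (@Rintegrable_bounded _ _ _ _ C).
  apply/measurable_fun_itv_obnd_cbndP; apply: measurable_funS (mu_ i) => //.
  by apply: subset_itvl.
apply: ae_imply2 (uC i) (ae_neq 0) => t ut tn0 /andP[t0 _]; apply: ut.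
by rewrite lt_neqAle eq_sym tn0.
Qed.

(** Variation of constants: with [w k t] the moment up to time [t] in the direction of the
    [k]-th basis vector, the state is [coflow t *m w t], and it vanishes once all
    moments do. *)
Lemma steers_of_moment (T : R) (u : 'I_d.+1 -> R -> R) (C : R) : 0 <= T ->
  (forall i, measurable_fun (`]0, +oo[ : set R) (u i)) ->
  (forall i, {ae mu, forall t : R, 0 < t -> `|u i t| <= C}) ->
  (forall z, inner z y0 + \int[mu]_(s in `[0, T]) \sum_i u i s * p i z s = 0) ->
  steers_to_zero A b y0 `[0, +oo[ T u.
Proof.
move=> T0 mu_ uC mom.
pose e k : 'cV[R]_m.+1 := delta_mx k ord0.
pose G k s := \sum_i u i s * p i (e k) s.
pose w k t := y0 k ord0 + \int[mu]_(s in `[0, t]) G k s.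
have iG k t : G k \Rint `[0, t].
  apply: Rintegrable_sum => // i.
  apply: eq_Rintegrable (Rintegrable_mul_continuous (Rintegrable_control t i mu_ uC) (@pairing_fun_continuous i (e k))) => s.
  by rewrite mulrC.
have cw k : continuous (w k).
  move=> t; apply: cvgD; first exact: cvg_cst.
  apply: primitive_continuous => B; first exact: iG.
  have [|C2 C20 hC2] := @continuous_bounded R (fun s : R => \sum_i `|p i (e k) s|) 0 B.
    by apply: continuous_sum => i s; apply: cvg_norm; exact: pairing_fun_continuous.
  exists (`|C| * C2); first by rewrite mulr_ge0.
  apply: ae_imply2 (ae_forall uC) (ae_neq 0) => s us sn0 s0B.
  have s0 : 0 < s by case/andP: s0B => s0 _; rewrite lt_neqAle eq_sym sn0.
  apply: (le_trans (ler_norm_sum _ _ _)).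
  apply: (@le_trans _ _ (\sum_i `|C| * `|p i (e k) s|)).
    apply: ler_sum => i _; rewrite normrM ler_wpM2r// (le_trans (us i s0))// ler_norm.
    by [].
  by rewrite -mulr_sumr ler_wpM2l// (le_trans _ (hC2 s s0B))// ler_norm.
pose y t : 'cV[R]_m.+1 := \col_j \sum_k Y j k t * w k t.
have pe i k s : p i (e k) s = \sum_q b i q ord0 * Phi q k s.
  rewrite /p /inner; apply: eq_bigr => q _; congr (_ * _).
  rewrite flow_coord (bigD1 k)//= big1 ?addr0; first by rewrite mxE !eqxx mul1r.
  by move=> l /negPf lk; rewrite mxE lk mul0r.
have dY j k t : (fun s => \sum_l (- a j l s) * Y l k s) \Rint `[0, t].
  exact: (Rintegrable_linear j t cna (fun l => @cY l k)).
exists y; last first.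
  apply/matrixP => j q; rewrite !mxE big1// => k _.
  suff -> : w k T = 0 by rewrite mulr0.
  rewrite /w -[RHS](mom (e k)); congr (_ + _).
  rewrite /inner (bigD1 k)//= big1 ?addr0; first by rewrite mxE !eqxx mul1r.
  by move=> l /negPf lk; rewrite mxE lk mul0r.
split.
  apply: continuous_subspaceT; apply: continuous_cV => j.
  under eq_fun do rewrite mxE.
  by apply: continuous_sum => k s; apply: cvgM; [exact: cY|exact: cw].
move=> t; rewrite /= in_itv/= andbT => t0 j.
have h k := Rintegration_by_parts_cst (j == k)%:R (y0 k ord0) t0 (dY j k t) (iG k t).
have rE s : 0 <= s -> (\sum_i u i s *: b i - A s *m y s) j ord0 =
   \sum_k ((\sum_l (- a j l s) * Y l k s) * w k s + G k s * Y j k s).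
  move=> s0.
  rewrite big_split/= addrC [LHS]mxE; congr (_ + _).
    rewrite summxE; under [RHS]eq_bigr do rewrite mulr_suml.
    rewrite exchange_big/=; apply: eq_bigr => i _; rewrite mxE.
    under [RHS]eq_bigr do rewrite -mulrA pe.
    rewrite -mulr_sumr; congr (_ * _).
    under [RHS]eq_bigr do rewrite mulr_suml.
    rewrite exchange_big/=.
    transitivity (\sum_q b i q ord0 * (flow s *m (coflow s)^T) q j).
      rewrite flow_coflow// (bigD1 j)//= big1 ?addr0; first by rewrite mxE eqxx mulr1.
      by move=> q /negPf qj; rewrite mxE qj mulr0.
    apply: eq_bigr => q _; rewrite mxE mulr_sumr; apply: eq_bigr => k _.
    by rewrite !mxE mulrA.
  rewrite mxE [in LHS]mxE -sumrN.
  under [RHS]eq_bigr do rewrite mulr_suml.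
  rewrite exchange_big/=; apply: eq_bigr => l _; rewrite mxE -frozenE// -mulNr mulr_sumr.
  by apply: eq_bigr => k _; rewrite mulrA.
have iS : (fun s => \sum_k ((\sum_l (- a j l s) * Y l k s) * w k s + G k s * Y j k s)) \Rint `[0, t].
  apply: Rintegrable_sum => // k; have [h1 h2 _] := h k; apply: RintegrableD => //.
  by apply: eq_Rintegrable h2 => s; rewrite -YE.
split.
  apply: eq_integrable iS => // s.
  by rewrite mem_setE/= in_itv/= => /andP[s0 _]; rewrite rE.
rewrite mxE.
transitivity (\sum_k ((j == k)%:R * y0 k ord0 + \int[mu]_(s in `[0, t])
   ((\sum_l (- a j l s) * Y l k s) * w k s + G k s * Y j k s))).
  apply: eq_bigr => k _; have [_ _] := h k; rewrite -YE => ->; congr (_ + _).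
  by apply: eq_Rintegral => s _; rewrite -YE.
rewrite big_split/=; congr (_ + _).
  rewrite (bigD1 j)//= eqxx mul1r big1 ?addr0// => k /negPf.
  by rewrite eq_sym => ->; rewrite mul0r.
rewrite -Rintegral_sum//; last first.
  move=> k; have [h1 h2 _] := h k; apply: RintegrableD => //.
  by apply: eq_Rintegrable h2 => s; rewrite -YE.
by apply: eq_Rintegral => s; rewrite mem_setE/= in_itv/= => /andP[s0 _]; rewrite rE.
Qed.

End ControlSystem.

Section Flow.
Variable R : realType.
Notation mu := (@lebesgue_measure R).
Variables (m d : nat) (A : R -> 'M[R]_m.+1) (b : 'I_d.+1 -> 'cV[R]_m.+1).
Variable y0 : 'cV[R]_m.+1.

(** What the optimisation argument uses of the dual equation: its flow, and the
    description of the controls that steer [y0] to [0] by moment conditions. *)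
Record dual_flow_spec (F : R -> 'M[R]_m.+1) : Prop := DualFlowSpec {
  dflow0 : F 0 = 1%:M;
  dflow_unit : forall t : R, 0 <= t -> F t \in unitmx;
  dflow_solution : forall z, dual_solution A (fun t => F t *m z);
  dflow_unique : forall phi, dual_solution A phi ->
    forall t : R, 0 <= t -> phi t = F t *m phi 0;
  dflow_continuous : forall i z, continuous (fun t => inner (b i) (F t *m z));
  dflow_neq0 : forall i z, z != 0 ->
    {ae mu, forall t : R, 0 < t -> inner (b i) (F t *m z) != 0};
  dflow_moment : forall (D : set R) (T : R) u, 0 <= T -> `[0, T] `<=` D ->
    steers_to_zero A b y0 D T u -> forall z, inner z y0 +
      \int[mu]_(s in `[0, T]) \sum_i u i s * inner (b i) (F s *m z) = 0;
  dflow_steers : forall (T : R) (u : 'I_d.+1 -> R -> R) (C : R), 0 <= T ->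
    (forall i, measurable_fun (`]0, +oo[ : set R) (u i)) ->
    (forall i, {ae mu, forall t : R, 0 < t -> `|u i t| <= C}) ->
    (forall z, inner z y0 +
      \int[mu]_(s in `[0, T]) \sum_i u i s * inner (b i) (F s *m z) = 0) ->
    steers_to_zero A b y0 `[0, +oo[ T u }.

Lemma coord_series (c : nat -> 'M[R]_m.+1) (x : R) (M : 'M[R]_m.+1) i l :
  \sum_(k < n) x ^+ k *: c k @[n --> \oo] --> M ->
  \sum_(k < n) x ^+ k * c k i l @[n --> \oo] --> M i l.
Proof.
move=> cM.
have := @cvg_comp _ _ _ _ (fun N : 'M[R]_m.+1 => N i l) _ _ _ cM
  (@coord_continuous R m.+1 m.+1 i l M).
apply: cvg_trans; apply: near_eq_cvg; apply: nearW => n /=.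
by rewrite summxE; apply: eq_bigr => k _; rewrite mxE.
Qed.

(** Where the flow is analytic, [<b_i, phi>] vanishes identically or has isolated
    zeros; Conti's condition excludes the former. *)
Lemma flow_pairing_neq0 (F : R -> 'M[R]_m.+1) : F 0 = 1%:M ->
  (forall z, dual_solution A (fun t => F t *m z)) ->
  real_analytic_on `]0, +oo[ A -> conti A b ->
  forall i z, z != 0 -> {ae mu, forall t : R, 0 < t -> inner (b i) (F t *m z) != 0}.
Proof.
move=> F0 solF anA contiA i z z0.
have [s s0|f0|//] := @zeros_dichotomy R (fun t => inner (b i) (F t *m z)).
  have [|r r0 [c hc]] := anA s; first by rewrite /= in_itv/= s0.
  pose r' := Num.min r s.
  have r'0 : 0 < r' by rewrite lt_min r0.
  have pos (t : R) : `|t - s| < r' -> 0 < t.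
    by rewrite lt_min => /andP[_]; rewrite ltr_distl => /andP[+ _]; rewrite subrr.
  apply: (@linear_ode_local_zeros R _ (fun j l t => A t l j)
    (fun j t => (F t *m z) j ord0) s r' (fun k j l => c k l j) (fun j => b i j ord0)) => //.
  - move=> j l t ts; apply: coord_series; apply: hc.
    by apply: lt_le_trans ts _; rewrite ge_min lexx.
  - move=> j t /pos t0; have [dp ep] := (solF z).1 t t0.
    apply: DeriveDef; first exact: (derivable_mxP _ _ _).1.
    have -> : \sum_l A t l j * (F t *m z) l ord0 = ((A t)^T *m (F t *m z)) j ord0.
      by rewrite [RHS]mxE; apply: eq_bigr => l _; rewrite [X in _ = X * _]mxE.
    by rewrite -ep derive_mx// mxE.
exfalso; have := contiA i _ (solF z).
have zz : exists2 t : R, 0 <= t & F t *m z != 0.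
  by exists 0 => //; rewrite F0 mul1mx.
move=> /(_ zz); rewrite (eq_integral (cst 0%E)).
  by rewrite integral0.
by move=> t; rewrite mem_setE/= in_itv/= andbT => /f0 ->; rewrite normr0.
Qed.

Theorem dual_flow_exists : {within `[0, +oo[, continuous A} ->
  real_analytic_on `]0, +oo[ A -> conti A b -> exists F, dual_flow_spec F.
Proof.
move=> cA anA contiA.
have ca := frozen_continuous cA.
have [Phi [cPhi PhiE]] := @fundamental_matrix R _ (fun i l => frozen A l i) (fun i l => ca l i).
have cna i l : continuous (fun s => - frozen A i l s).
  by move=> s; apply: cvgN; exact: ca.
have [Y [cY YE]] := @fundamental_matrix R _ (fun i l s => - frozen A i l s) cna.
have F0 := flow0 PhiE.
have solF := flow_dual_solution cA cPhi PhiE.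
exists (flow Phi); split => //.
- exact: (@flow_unit _ _ A cA Phi Y cPhi PhiE cY YE).
- exact: (@dual_solution_flow _ _ A cA Phi Y cPhi PhiE cY YE).
- exact: (@pairing_fun_continuous _ _ _ b Phi cPhi).
- exact: flow_pairing_neq0.
- by move=> D T u T0 TD st z; exact: (@moment_of_steers _ _ _ A b y0 cA Phi cPhi PhiE D T u T0 TD st z).
- exact: (@steers_of_moment _ _ _ A b y0 cA Phi Y cPhi PhiE cY YE).
Qed.

End Flow.

(** * Minima on the unit sphere *)

Section Sphere.
Variable R : realType.

Lemma lipschitz_continuous (V W : normedModType R) (f : V -> W) (C : R) :
  (forall z z', `|f z - f z'| <= C * `|z - z'|) -> continuous f.
Proof.
move=> lf z; apply/cvgrPdist_lt => e e0.
have C0 : 0 < `|C| + 1 by rewrite ltr_wpDl.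
have eC : 0 < e / (`|C| + 1) by rewrite divr_gt0.
have : \forall z' \near z, `|z - z'| < e / (`|C| + 1).
  by apply/nbhs_ballP; exists (e / (`|C| + 1)) => // y; rewrite -ball_normE.
apply: filterS => z'; rewrite ltr_pdivlMr// => h; apply: le_lt_trans h.
apply: (le_trans (lf z z')); rewrite mulrC ler_wpM2l//.
by apply: (le_trans (ler_norm C)); rewrite lerDl.
Qed.

Lemma ratio_continuous (V : normedModType R) (f g : V -> R) (z : V) :
  continuous f -> continuous g -> g z != 0 -> {for z, continuous (fun x => f x / g x)}.
Proof.
move=> cf cg gz; apply: (@cvgM _ _ (nbhs z)); first exact: cf.
by apply: cvgV => //; exact: cg.
Qed.

Lemma combination_continuous (V : normedModType R) (c : R) (f g : V -> R) (z : V) :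
  continuous f -> continuous g -> {for z, continuous (fun x => c * f x + g x)}.
Proof.
move=> cf cg; apply: (@cvgD _ _ _ (nbhs z)); last exact: cg.
by apply: cvgM; [exact: cvg_cst|exact: cf].
Qed.

Lemma norm_trmx_le (p q : nat) (M : 'M[R]_(p, q)) : `|M^T| <= `|M|.
Proof.
rewrite [leLHS]/Num.Def.normr/= mx_normrE; apply: bigmax_le => // -[i j] _.
rewrite mxE/= [leRHS]/Num.Def.normr/= mx_normrE.
exact: (le_bigmax _ (fun ij : 'I_p * 'I_q => `|M ij.1 ij.2|) (j, i)).
Qed.

Lemma norm_trmx (p q : nat) (M : 'M[R]_(p, q)) : `|M^T| = `|M|.
Proof.
apply/eqP; rewrite eq_le norm_trmx_le/=.
by rewrite -{1}[M]trmxK norm_trmx_le.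
Qed.

(** The unit sphere is compact; columns are transposed into rows, to which the
    compactness of bounded closed sets applies. *)
Lemma sphere_min n (f : 'cV[R]_n.+1 -> R) :
  (forall z : 'cV[R]_n.+1, `|z| = 1 -> {for z, continuous f}) ->
  exists2 z : 'cV[R]_n.+1, `|z| = 1 & forall z' : 'cV[R]_n.+1, `|z'| = 1 -> f z <= f z'.
Proof.
move=> cf; pose S := [set v : 'rV[R]_n.+1 | `|v| = 1].
have tr_cont : continuous (@trmx R 1 n.+1).
  apply: (@lipschitz_continuous _ _ _ 1) => v w.
  by rewrite -linearB norm_trmx mul1r.
have S0 : S !=set0.
  exists (const_mx 1); rewrite /S/= [LHS]/Num.Def.normr/= mx_normrE.
  apply/eqP; rewrite eq_le; apply/andP; split.
    by apply: bigmax_le => // -[i j] _; rewrite mxE normr1.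
  by apply: le_trans (le_bigmax _ _ (ord0, ord0)); rewrite mxE normr1.
have cS : compact S.
  apply: bounded_closed_compact.
    by exists 1; split; [exact: num_real|move=> M M1 v /= ->; exact: ltW].
  apply: (@closed_comp _ _ (fun v : 'rV[R]_n.+1 => `|v|) [set 1]).
    by move=> v _; exact: norm_continuous.
  exact: closed_eq.
have [|c /set_mem cSS cmin] := @EVT_min_rV R n.+1 (f \o trmx) S S0 cS.
  apply: continuous_in_subspaceT => v /set_mem Sv.
  apply: continuous_comp; first exact: tr_cont.
  by apply: cf; rewrite norm_trmx.
exists c^T; first by rewrite norm_trmx.
move=> z' z1; rewrite -[z']trmxK; apply: cmin.
by rewrite inE /S/= norm_trmx.
Qed.

End Sphere.

Section Inner.
Variables (R : realType) (m : nat).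
Implicit Types x y z : 'cV[R]_m.+1.

Lemma innerDl x y z : inner (x + y) z = inner x z + inner y z.
Proof. by rewrite /inner -big_split/=; apply: eq_bigr => i _; rewrite mxE mulrDl. Qed.

Lemma innerZl c x z : inner (c *: x) z = c * inner x z.
Proof. by rewrite /inner mulr_sumr; apply: eq_bigr => i _; rewrite mxE mulrA. Qed.

Lemma innerNl x z : inner (- x) z = - inner x z.
Proof. by rewrite -scaleN1r innerZl mulN1r. Qed.

Lemma innerC x y : inner x y = inner y x.
Proof. by apply: eq_bigr => i _; rewrite mulrC. Qed.

Lemma inner0l z : inner 0 z = 0.
Proof. by rewrite -(scale0r 0) innerZl mul0r. Qed.

Lemma inner_gt0 x : x != 0 -> 0 < inner x x.
Proof.
move=> x0; have ge0 : 0 <= inner x x by apply: sumr_ge0 => i _; rewrite -expr2 sqr_ge0.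
rewrite lt_neqAle ge0 andbT eq_sym; apply: contra x0.
rewrite psumr_eq0 => [/allP h|i _]; last by rewrite -expr2 sqr_ge0.
apply/eqP/matrixP => i j; rewrite ord1 mxE.
by have := h i (mem_index_enum i); rewrite mulf_eq0 orbb => /eqP.
Qed.

Lemma coord_le_norm x i : `|x i ord0| <= `|x|.
Proof.
by rewrite [leRHS]/Num.Def.normr/= mx_normrE; exact: (le_bigmax _ _ (i, ord0)).
Qed.

Lemma inner_le x y : `|inner x y| <= (\sum_i `|y i ord0|) * `|x|.
Proof.
apply: (le_trans (ler_norm_sum _ _ _)); rewrite mulr_suml; apply: ler_sum => i _.
by rewrite normrM mulrC ler_wpM2l// coord_le_norm.
Qed.

Lemma inner_continuous y : continuous (fun x : 'cV[R]_m.+1 => inner x y).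
Proof.
apply: (@lipschitz_continuous _ _ _ _ (\sum_i `|y i ord0|)) => x x'.
have -> : inner x y - inner x' y = inner (x - x') y.
  by rewrite innerDl innerNl.
exact: inner_le.
Qed.

End Inner.

(** * The moment problem with bounded controls *)

(* In the application [p i z] is the pairing of [b_i] with the dual solution that
   starts from [z]; the duality argument uses its linearity in [z], its continuity in
   time and its zeros only. *)
Section MomentProblem.
Variables (R : realType) (m d : nat).
Notation mu := (@lebesgue_measure R).
Notation "f \Rint D" := (mu.-integrable D (EFin \o f)) (at level 50).
Notation V := 'cV[R]_m.+1.
Variables (k : 'I_d.+1 -> R) (p : 'I_d.+1 -> V -> R -> R) (y0 : V).
Hypothesis k_gt0 : forall i, 0 < k i.
Hypothesis pD : forall i (z z' : V) (s : R), p i (z + z') s = p i z s + p i z' s.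
Hypothesis pZ : forall i (c : R) (z : V) (s : R), p i (c *: z) s = c * p i z s.
Hypothesis p_cont : forall i z, continuous (p i z).
Hypothesis p_neq0 : forall i (z : V), z != 0 -> {ae mu, forall t : R, 0 < t -> p i z t != 0}.

Definition density (z : V) (s : R) : R := \sum_i k i * `|p i z s|.

Definition dual_norm (T : R) (z : V) : R := \int[mu]_(s in `[0, T]) density z s.

Notation w := density.
Notation N := dual_norm.

Lemma density_continuous z : continuous (w z).
Proof.
apply: continuous_sum => i s; apply: cvgM; first exact: cvg_cst.
by apply: cvg_norm; exact: p_cont.
Qed.

Lemma density_ge0 z s : 0 <= w z s.
Proof. by apply: sumr_ge0 => i _; rewrite mulr_ge0// ltW. Qed.

Lemma Rintegrable_density z a c : w z \Rint `[a, c].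
Proof. by apply: Rintegrable_continuous; exact: density_continuous. Qed.

Lemma densityZ c z s : w (c *: z) s = `|c| * w z s.
Proof.
by rewrite /w mulr_sumr; apply: eq_bigr => i _; rewrite pZ normrM mulrCA.
Qed.

Lemma densityD z z' s : w (z + z') s <= w z s + w z' s.
Proof.
rewrite /w -big_split/=; apply: ler_sum => i _.
by rewrite -mulrDr ler_pM2l// pD ler_normD.
Qed.

Lemma dual_norm_ge0 T z : 0 <= N T z.
Proof. by apply: Rintegral_ge0 => s _; exact: density_ge0. Qed.

Lemma dual_normZ T c z : N T (c *: z) = `|c| * N T z.
Proof.
rewrite /N -RintegralZl//; last exact: Rintegrable_density.
by apply: eq_Rintegral => s _; exact: densityZ.
Qed.

Lemma dual_norm0 T : N T 0 = 0.
Proof. by rewrite -(scale0r 0) dual_normZ normr0 mul0r. Qed.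

Lemma dual_normD T z z' : N T (z + z') <= N T z + N T z'.
Proof.
rewrite /N -RintegralD//; [|exact: Rintegrable_density|exact: Rintegrable_density].
apply: le_Rintegral_ae => //; first exact: Rintegrable_density.
- by apply: RintegrableD => //; exact: Rintegrable_density.
- by apply: nearW => s _; exact: densityD.
Qed.

Lemma dual_norm_split (T T' : R) z : 0 <= T -> T <= T' ->
  N T' z = N T z + \int[mu]_(s in `[T, T']) w z s.
Proof. by move=> T0 TT; rewrite /N (Rintegral_split T0 TT)//; exact: Rintegrable_density. Qed.

Lemma dual_norm_mono (T T' : R) z : 0 <= T -> T <= T' -> N T z <= N T' z.
Proof.
move=> T0 TT; rewrite (dual_norm_split _ T0 TT) lerDl.
by apply: Rintegral_ge0 => s _; exact: density_ge0.
Qed.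

Lemma density_le (z : V) (s : R) : w z s <= `|z| * \sum_j w (delta_mx j ord0) s.
Proof.
have zE : z = \sum_j z j ord0 *: delta_mx j ord0.
  by rewrite {1}[z]matrix_sum_delta; apply: eq_bigr => j _; rewrite big_ord1.
have w0 : w 0 s = 0 by rewrite -(scale0r 0) densityZ normr0 mul0r.
apply: (@le_trans _ _ (\sum_j w (z j ord0 *: delta_mx j ord0) s)).
  rewrite {1}zE; elim/big_ind2 : _ => [|x a y c xa yc|j _]; rewrite ?w0//.
  by apply: (le_trans (densityD _ _ _)); exact: lerD.
rewrite mulr_sumr; apply: ler_sum => j _; rewrite densityZ.
by rewrite ler_wpM2r ?density_ge0// coord_le_norm.
Qed.

Lemma dual_norm_lipschitz (B : R) : exists2 C : R, 0 <= C &
  forall (T T' : R) (z : V), 0 <= T -> T <= T' -> T' <= B ->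
    N T' z <= N T z + C * (T' - T) * `|z|.
Proof.
have [|C C0 hC] := @continuous_bounded R (fun s => \sum_j w (delta_mx j ord0) s) 0 B.
  by apply: continuous_sum => j; exact: density_continuous.
exists C => // T T' z T0 TT TB; rewrite (dual_norm_split _ T0 TT) lerD2l.
apply: (le_trans (ler_norm _)); rewrite mulrAC; apply: Rintegral_bound => //.
  exact: Rintegrable_density.
apply: nearW => s /andP[Ts sT]; rewrite ger0_norm ?density_ge0//.
apply: (le_trans (density_le _ _)); rewrite mulrC ler_wpM2r//.
apply: (le_trans (ler_norm _)); apply: hC.
by rewrite (le_trans T0 Ts) (le_trans sT TB).
Qed.

Lemma dual_norm_le (T : R) : 0 <= T ->
  exists2 C : R, 0 <= C & forall z : V, N T z <= C * `|z|.
Proof.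
move=> T0; have [C C0 hC] := dual_norm_lipschitz T.
exists (C * T) => [|z]; first by rewrite mulr_ge0.
by have := hC 0 T z (lexx 0) T0 (lexx T); rewrite {2}/N Rintegral_itv1 add0r subr0.
Qed.

Lemma dual_norm_continuous (T : R) : 0 <= T -> continuous (N T).
Proof.
move=> T0; have [C C0 hC] := dual_norm_le T0.
apply: (@lipschitz_continuous _ _ _ _ C) => z z'.
rewrite ler_norml; apply/andP; split.
  rewrite lerBrDr addrC lerBlDr addrC.
  have := dual_normD T (z' - z) z; rewrite subrK => h; apply: (le_trans h).
  by rewrite lerD2r distrC.
rewrite lerBlDr; have := dual_normD T (z - z') z'; rewrite subrK => h.
by apply: (le_trans h); rewrite lerD2r.
Qed.

Lemma dual_norm_gt0 (T : R) (z : V) : 0 < T -> z != 0 -> 0 < N T z.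
Proof.
move=> T0 z0; rewrite lt_neqAle dual_norm_ge0 andbT eq_sym; apply/eqP => N0.
have w0 : {ae mu, forall t : R, `[0, T]%classic t -> w z t = 0}.
  apply: Rintegral_eq0_ae; rewrite //; first exact: Rintegrable_density.
    by apply: nearW => s _; exact: density_ge0.
  by rewrite -/(N T z) N0.
have [t [/andP[t0 tT] [wt pt]]] : exists t : R, 0 < t < T /\ (w z t = 0 /\ p ord0 z t != 0).
  apply: (@ae_itv_exists R T (fun t => w z t = 0 /\ p ord0 z t != 0)) => //.
  apply: ae_imply2 w0 (p_neq0 ord0 z0) => t h1 h2 /andP[t0 tT].
  by split; [apply: h1; rewrite /= in_itv/= (ltW t0) ltW|exact: h2].
move: pt; rewrite -normr_eq0 -(mulrI_eq0 _ (mulfI (lt0r_neq0 (k_gt0 ord0)))).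
move/eqP: wt; rewrite psumr_eq0 => [/allP|i _]; last by rewrite mulr_ge0// ltW.
by move=> /(_ ord0 (mem_index_enum _)) /= ->.
Qed.

Definition moment (T : R) (u : 'I_d.+1 -> R -> R) (z : V) : R :=
  inner z y0 + \int[mu]_(s in `[0, T]) \sum_i u i s * p i z s.

Definition control_bound (T L : R) (u : 'I_d.+1 -> R -> R) : Prop :=
  forall i, measurable_fun (`]0, T[ : set R) (u i) /\
    {ae mu, forall t : R, 0 < t < T -> `|u i t| <= k i * L}.

Lemma Rintegrable_bounded_control (T L : R) u i : control_bound T L u -> u i \Rint `[0, T].
Proof.
by move=> uL; have [mu_ ub] := uL i; exact: Rintegrable_bounded_oo mu_ ub.
Qed.

Lemma Rintegrable_action_term (T L : R) u i z : control_bound T L u ->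
  (fun s => u i s * p i z s) \Rint `[0, T].
Proof.
move=> uL; apply: eq_Rintegrable (Rintegrable_mul_continuous (Rintegrable_bounded_control i uL) (@p_cont i z)) => s.
by rewrite mulrC.
Qed.

Lemma Rintegrable_action (T L : R) u z : control_bound T L u ->
  (fun s => \sum_i u i s * p i z s) \Rint `[0, T].
Proof. by move=> uL; apply: Rintegrable_sum => // i; exact: Rintegrable_action_term uL. Qed.

Lemma action_le (T L : R) u z : control_bound T L u ->
  {ae mu, forall t : R, 0 <= t <= T -> `|\sum_i u i t * p i z t| <= L * w z t}.
Proof.
move=> uL; have := ae_forall (fun i => ae_itv_oo_cc (uL i).2).
apply: ae_imply => t ut tT; apply: (le_trans (ler_norm_sum _ _ _)).
rewrite mulr_sumr; apply: ler_sum => i _; rewrite normrM mulrA [L * _]mulrC.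
by rewrite ler_wpM2r// ut.
Qed.

Lemma moment_bound (T L : R) u z : control_bound T L u -> moment T u z = 0 ->
  `|inner z y0| <= L * N T z.
Proof.
move=> uL /eqP; rewrite addr_eq0 => /eqP ->; rewrite normrN.
apply: (le_trans (le_normr_Rintegral _ (Rintegrable_action _ uL))) => //.
rewrite /N -RintegralZl//; last exact: Rintegrable_density.
apply: le_Rintegral_ae => //.
- exact: integrable_norm (Rintegrable_action _ uL).
- by apply: RintegrableZ => //; exact: Rintegrable_density.
- exact: action_le uL.
Qed.

Definition sign_control (L : R) (z : V) (i : 'I_d.+1) (s : R) : R :=
  L * (k i * Num.sg (p i z s)).

Lemma sign_control_measurable (L : R) z i : measurable_fun setT (sign_control L z i).
Proof.
apply: measurable_funM => //; apply: measurable_funM => //.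
apply: measurableT_comp; last by apply: continuous_measurable_fun; exact: p_cont.
exact: sg_measurable.
Qed.

Lemma sign_control_le (L : R) z i s : 0 <= L -> `|sign_control L z i s| <= k i * L.
Proof.
move=> L0; rewrite /sign_control normrM ger0_norm// mulrC ler_wpM2r//.
rewrite normrM gtr0_norm// -[leRHS]mulr1 ler_pM2l// normr_sg.
by case: eqP.
Qed.

Lemma sign_control_bound (T L : R) z : 0 <= L -> control_bound T L (sign_control L z).
Proof.
move=> L0 i; split; last by apply: nearW => s _; exact: sign_control_le.
exact: measurable_funS (sign_control_measurable L z i).
Qed.

(** Once [|y| / (n + 1) < |x|], adding [y / (n + 1)] does not change the sign of [x], and
    the difference quotient of the absolute value is equal to its limit. *)
Lemma norm_slope (x y : R) : x != 0 ->
  (`|x + n.+1%:R^-1 * y| - `|x|) * n.+1%:R @[n --> \oo] --> Num.sg x * y.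
Proof.
move=> x0; apply: cvg_near_cst.
have : \forall n \near \oo, (n.+1%:R^-1 : R) * `|y| < `|x|.
  have h : (n.+1%:R^-1 : R) * `|y| @[n --> \oo] --> 0 * `|y|.
    by apply: cvgM; [exact: cvg_harmonic|exact: cvg_cst].
  by apply: (cvgr_lt _ h); rewrite mul0r normr_gt0.
apply: filterS => n h; have n0 : (n.+1%:R : R) != 0 by rewrite pnatr_eq0.
set e := n.+1%:R^-1 in h *; have e0 : 0 < e by rewrite invr_gt0 ltr0n.
have : `|e * y| < `|x| by rewrite normrM gtr0_norm.
have en : e * n.+1%:R = 1 by rewrite mulVf.
case: (ltrgt0P x) x0 => // x0 _; rewrite ltr_norml => /andP[h1 h2].
  rewrite gtr0_sg// gtr0_norm; last by lra.
  by rewrite addrAC subrr add0r mul1r mulrAC en mul1r.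
rewrite ltr0_sg// ltr0_norm; last by lra.
by rewrite opprD addrAC subrr add0r mulN1r mulNr mulrAC en mul1r.
Qed.

(** At a minimum of [h |-> L * N T h + <h, y0>] the derivative in every direction
    vanishes, which says that the sign control solves the moment problem. *)
Lemma sign_control_moment (T L : R) (z : V) : 0 < T -> 0 <= L -> z != 0 ->
  (forall h, 0 <= L * N T h + inner h y0) -> L * N T z + inner z y0 = 0 ->
  forall h, moment T (sign_control L z) h = 0.
Proof.
move=> T0 L0 z0 Lge0 Lz.
(* The moment is linear in [h], so that one inequality suffices. *)
suff half h : 0 <= moment T (sign_control L z) h.
  move=> h; apply/eqP; rewrite eq_le half andbT -oppr_ge0.
  have := half (-1 *: h); rewrite /moment innerZl mulN1r.
  congr (_ <= _); rewrite opprD; congr (_ + _).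
  rewrite -[RHS]mulN1r -RintegralZl//; last exact: Rintegrable_action (sign_control_bound T z L0).
  apply: eq_Rintegral => s _; rewrite mulr_sumr; apply: eq_bigr => i _.
  by rewrite pZ mulN1r mulrN mulN1r.
(* Difference quotients of the density in the direction [h], and their limit. *)
pose Q n s := (w (z + n.+1%:R^-1 *: h) s - w z s) * n.+1%:R.
pose D s := \sum_i k i * (Num.sg (p i z s) * p i h s).
have cQ n : continuous (Q n).
  move=> s; apply: cvgM; last exact: cvg_cst.
  by apply: cvgB; exact: density_continuous.
have sumE s : \sum_i sign_control L z i s * p i h s = L * D s.
  by rewrite mulr_sumr; apply: eq_bigr => i _; rewrite -!mulrA.
have mD : measurable_fun setT D.
  apply: measurable_sum => i; apply: measurable_funM => //; apply: measurable_funM.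
    apply: measurableT_comp; last by apply: continuous_measurable_fun; exact: p_cont.
    exact: sg_measurable.
  by apply: continuous_measurable_fun; exact: p_cont.
have Qle n s : `|Q n s| <= w h s.
  have n0 : 0 < (n.+1%:R : R) by rewrite ltr0n.
  rewrite /Q normrM [X in _ * X]gtr0_norm// -ler_pdivlMr// mulrC.
  have <- : w (n.+1%:R^-1 *: h) s = n.+1%:R^-1 * w h s.
    by rewrite densityZ gtr0_norm// invr_gt0.
  rewrite ler_norml; apply/andP; split; last by rewrite lerBlDr addrC densityD.
  rewrite lerBrDr addrC lerBlDr.
  have := densityD (z + n.+1%:R^-1 *: h) (- (n.+1%:R^-1 *: h)) s.
  by rewrite addrK -scaleN1r densityZ normrN1 mul1r.
have [C C0 hC] := @continuous_bounded R (w h) 0 T (@density_continuous h).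
have pn0 : {ae mu, forall t : R, forall i, 0 < t -> p i z t != 0}.
  by apply: ae_forall => i; exact: p_neq0.
have [||||iD cD] := @Rdominated_cvg _ _ _ mu `[0, T] Q D C (measurable_itv _) (measure_itvcc 0 T).
- by move=> n; apply: measurable_funTS; exact: continuous_measurable_fun.
- exact: measurable_funTS.
- apply: ae_imply2 pn0 (ae_neq 0) => t ptn0 tn0; rewrite /= in_itv/= => /andP[t0 _].
  have {}t0 : 0 < t by rewrite lt_neqAle eq_sym tn0.
  have -> : Q^~ t = fun n => \sum_i k i *
      ((`|p i z t + n.+1%:R^-1 * p i h t| - `|p i z t|) * n.+1%:R).
    apply/funext => n; rewrite /Q /w -sumrB mulr_suml; apply: eq_bigr => i _.
    by rewrite pD pZ -mulrBr mulrA.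
  apply: cvg_sumr => i; apply: cvgM; first exact: cvg_cst.
  by apply: norm_slope; exact: ptn0.
- apply: nearW => t; rewrite /= in_itv/= => tT n; apply: (le_trans (Qle n t)).
  exact: (le_trans (ler_norm _) (hC t tT)).
have -> : moment T (sign_control L z) h =
    inner h y0 + L * \int[mu]_(s in `[0, T]) D s.
  rewrite /moment -RintegralZl//; congr (_ + _).
  by apply: eq_Rintegral => s _; rewrite sumE.
have cv : inner h y0 + L * \int[mu]_(s in `[0, T]) Q n s @[n --> \oo] -->
    inner h y0 + L * \int[mu]_(s in `[0, T]) D s.
  by apply: cvgD; [exact: cvg_cst|apply: cvgM; [exact: cvg_cst|]].
rewrite -(cvg_lim _ cv)//; apply: limr_ge; first by apply/cvg_ex; eexists; exact: cv.
apply: nearW => n; set e := n.+1%:R^-1 : R.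
have n0 : 0 < (n.+1%:R : R) by rewrite ltr0n.
have -> : \int[mu]_(s in `[0, T]) Q n s = (N T (z + e *: h) - N T z) * n.+1%:R.
  rewrite /Q RintegralZr ?RintegralB//; try exact: Rintegrable_density.
  by apply: RintegrableB => //; exact: Rintegrable_density.
have := Lge0 (z + e *: h); rewrite innerDl innerZl => he.
have -> : inner h y0 = e * inner h y0 * n.+1%:R by rewrite mulrAC mulVf ?mul1r// gt_eqF.
rewrite mulrA -mulrDl mulr_ge0 ?(ltW n0)//; lra.
Qed.

(** This is the converse of [moment_bound].  A direction [z] that maximises
    [- <z, y0> / N T z] provides a sign control, whose size is that maximum. *)
Lemma moment_feasible (T M : R) : 0 < T -> y0 != 0 ->
  (forall h, 0 <= M * N T h + inner h y0) ->
  exists z L, [/\ z != 0, 0 < L, L <= M & forall h, moment T (sign_control L z) h = 0].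
Proof.
move=> T0 y00 Mge0; have T0' := ltW T0.
have norm1 (z : V) : `|z| = 1 -> z != 0 by move=> z1; rewrite -normr_eq0 z1 oner_neq0.
pose f (z : V) := inner z y0 / N T z.
have [z /norm1|z z1 zmin] := @sphere_min R m f.
  move=> z0; apply: ratio_continuous; last by rewrite gt_eqF// dual_norm_gt0.
    exact: inner_continuous.
  exact: dual_norm_continuous.
have z0 := norm1 _ z1; have Nz := dual_norm_gt0 T0 z0.
have L0 h : f z * N T h <= inner h y0.
  have [->|h0] := eqVneq h 0.
    by rewrite inner0l dual_norm0 mulr0.
  have nh : 0 < `|h| by rewrite normr_gt0.
  have h1 : `| `|h|^-1 *: h| = 1.
    by rewrite normrZ normfV normr_id mulVf// gt_eqF.
  have := zmin _ h1; rewrite /f innerZl dual_normZ normfV normr_id.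
  rewrite invfM invrK mulrACA mulVf ?gt_eqF// mul1r.
  by rewrite -/(f z) ler_pdivlMr// dual_norm_gt0.
have fz : f z < 0.
  rewrite ltNge; apply/negP => fz0; have := L0 (-1 *: y0); rewrite innerZl mulN1r.
  apply/negP; rewrite -ltNge (lt_le_trans _ (mulr_ge0 fz0 (dual_norm_ge0 T _)))//.
  by rewrite oppr_lt0 inner_gt0.
exists z, (- f z); split=> //; first by rewrite oppr_gt0.
  have Mz := Mge0 z; rewrite -(ler_pM2r Nz) mulNr /f divfK ?gt_eqF//; lra.
apply: sign_control_moment => //.
- by rewrite ltW// oppr_gt0.
- by move=> h; rewrite mulNr addrC subr_ge0.
- by rewrite mulNr /f divfK ?gt_eqF// addNr.
Qed.

Lemma scaled_parabola (a c q : R) : 0 <= a ->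
  (forall s : R, q <= 2^-1 * (`|s| * a) ^+ 2 + s * c) -> c ^+ 2 <= - 2 * q * a ^+ 2.
Proof.
move=> a0 h; have [aE|an0] := eqVneq a 0.
  have [->|c0] := eqVneq c 0; first by rewrite aE !expr0n/= mulr0.
  by have := h ((q - 1) / c); rewrite aE mulr0 expr0n/= mulr0 add0r divfK//; lra.
have a2 : 0 < a ^+ 2 by rewrite exprn_gt0// lt_neqAle eq_sym an0.
(* The vertex of the parabola. *)
have := h (- c / a ^+ 2); rewrite exprMn -normrX ger0_norm ?sqr_ge0// => hq.
have : c ^+ 2 / a ^+ 2 <= - 2 * q.
  have e : 2^-1 * ((- c / a ^+ 2) ^+ 2 * a ^+ 2) + - c / a ^+ 2 * c =
      - (2^-1 * (c ^+ 2 / a ^+ 2)) by field.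
  by move: hq; rewrite e; lra.
by rewrite ler_pdivrMr.
Qed.

(** Minimality along each ray [s |-> s h] bounds a parabola from below; its discriminant
    gives the inequality in the direction [h], and equality along the minimizer. *)
Lemma minimizer_first_order (T : R) (z : V) : 0 < T -> y0 != 0 ->
  (forall h, 2^-1 * N T z ^+ 2 + inner z y0 <= 2^-1 * N T h ^+ 2 + inner h y0) ->
  [/\ z != 0, N T z * N T z + inner z y0 = 0 &
      forall h, 0 <= N T z * N T h + inner h y0].
Proof.
move=> T0 y00 zmin; set q := _ + _ in zmin.
have par h : inner h y0 ^+ 2 <= - 2 * q * N T h ^+ 2.
  apply: scaled_parabola => [|s]; first exact: dual_norm_ge0.
  by rewrite -dual_normZ -innerZl.
have zE : N T z * N T z + inner z y0 = 0.
  apply/eqP; rewrite -sqrf_eq0 eq_le sqr_ge0 andbT.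
  have := par z; rewrite /q; nra.
have {}par h : inner h y0 ^+ 2 <= (N T z * N T h) ^+ 2.
  apply: (le_trans (par h)); rewrite /q exprMn; nra.
have h0 h : 0 <= N T z * N T h + inner h y0.
  have := par h; rewrite -ler_sqrt ?sqr_ge0// !sqrtr_sqr => ih.
  rewrite [leRHS]ger0_norm in ih; last by rewrite mulr_ge0// dual_norm_ge0.
  by have := lerNnormlW ih; lra.
split=> //; apply/eqP => z0; have := h0 (- y0).
rewrite z0 dual_norm0 mul0r add0r innerNl oppr_ge0.
by rewrite leNgt inner_gt0.
Qed.

(** If no shorter horizon is feasible, then at horizon [T] the bound of
    [moment_feasible] is attained in some direction: otherwise it would hold with a
    margin on the unit sphere, hence also for a slightly shorter horizon. *)
Lemma exhausting_direction (T M : R) : 0 < T -> 0 < M ->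
  (forall T' : R, 0 < T' -> T' < T -> ~ (forall h, 0 <= M * N T' h + inner h y0)) ->
  exists2 z, z != 0 & M * N T z + inner z y0 <= 0.
Proof.
move=> T0 M0 minT; pose f (z : V) := M * N T z + inner z y0.
have [z _|z z1 zmin] := @sphere_min R m f.
  apply: combination_continuous; last exact: inner_continuous.
  by apply: dual_norm_continuous; exact: ltW.
have [fz|fz] := leP (f z) 0.
  by exists z => //; rewrite -normr_eq0 z1 oner_neq0.
exfalso; have [C C0 hC] := dual_norm_lipschitz T.
(* Shortening the horizon by [e] costs at most [M C e < f z] on the sphere. *)
pose e := Num.min (T / 2) (f z / (M * C + 1)).
have MC0 : 0 < M * C + 1 by rewrite ltr_wpDl// mulr_ge0// ltW.
have e0 : 0 < e by rewrite lt_min !divr_gt0.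
have eT : e <= T / 2 by rewrite ge_min lexx.
have ef : e * (M * C + 1) <= f z by rewrite -ler_pdivlMr// ge_min lexx orbT.
apply: (minT (T - e)); [lra|lra|] => h.
have [->|h0] := eqVneq h 0.
  by rewrite inner0l addr0 mulr_ge0 ?dual_norm_ge0// ltW.
have nh : 0 < `|h| by rewrite normr_gt0.
have h1 : `| `|h|^-1 *: h| = 1.
  by rewrite normrZ normfV normr_id mulVf// gt_eqF.
have := zmin _ h1; rewrite {2}/f innerZl dual_normZ normfV normr_id mulrCA -mulrDr.
rewrite mulrC ler_pdivlMr// => fh.
have Te : T - (T - e) = e by rewrite opprB addrC subrK.
have := hC (T - e) T h; rewrite Te => /(_ _ _ (lexx T)) hC'.
have {}hC' : N T h <= N (T - e) h + C * e * `|h| by apply: hC'; lra.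
have : M * N T h <= M * N (T - e) h + M * C * e * `|h|.
  by rewrite -!mulrA -mulrDr !mulrA ler_pM2l// -mulrA.
have : e * (M * C + 1) * `|h| <= f z * `|h| by rewrite ler_pM2r.
have : 0 <= e * `|h| by rewrite mulr_ge0// ltW.
nra.
Qed.

(** The nonnegative function [\sum_i (k_i M |p_i z| - u_i p_i z)] has a nonpositive
    integral, hence vanishes almost everywhere. *)
Lemma bang_bang (T M : R) u z : 0 <= T -> control_bound T M u -> moment T u z = 0 ->
  M * N T z + inner z y0 <= 0 ->
  {ae mu, forall t : R, 0 <= t <= T -> forall i, u i t * p i z t = k i * M * `|p i z t|}.
Proof.
move=> T0 uM mom le0.
have ub : {ae mu, forall t : R, 0 <= t <= T -> forall i,
    u i t * p i z t <= k i * M * `|p i z t|}.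
  have := ae_forall (fun i => ae_itv_oo_cc (uM i).2); apply: ae_imply => t ut tT i.
  by apply: (le_trans (ler_norm _)); rewrite normrM ler_wpM2r// ut.
have sE s : M * w z s - \sum_i u i s * p i z s =
    \sum_i (k i * M * `|p i z s| - u i s * p i z s).
  by rewrite mulr_sumr -sumrB; apply: eq_bigr => i _; rewrite mulrA [M * _]mulrC.
have iw : (fun s => M * w z s) \Rint `[0, T] by apply: RintegrableZ => //; exact: Rintegrable_density.
have h0 : {ae mu, forall t : R, `[0, T]%classic t ->
    M * w z t - \sum_i u i t * p i z t = 0}.
  apply: Rintegral_eq0_ae => //.
  - by apply: RintegrableB => //; exact: Rintegrable_action uM.
  - apply: ae_imply ub => t ut; rewrite /= in_itv/= sE => tT.
    by apply: sumr_ge0 => i _; rewrite subr_ge0 ut.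
  - rewrite RintegralB//; last exact: Rintegrable_action uM.
    rewrite RintegralZl//; last exact: Rintegrable_density.
    move: mom; rewrite /moment -/(N T z); lra.
apply: ae_imply2 ub h0 => t ut h tT i.
have {}h : M * w z t - \sum_i u i t * p i z t = 0 by apply: h; rewrite /= in_itv.
rewrite sE in h.
move/eqP: h; rewrite psumr_eq0 => [/allP|j _]; last by rewrite subr_ge0 ut.
by move=> /(_ i (mem_index_enum _)); rewrite subr_eq0 eq_sym => /eqP.
Qed.

Lemma action_horizon_gap (T T' L : R) u z : 0 <= T -> T <= T' -> control_bound T' L u ->
  `|\int[mu]_(s in `[0, T']) (\sum_i u i s * p i z s) -
    \int[mu]_(s in `[0, T]) (\sum_i u i s * p i z s)| <= L * (N T' z - N T z).
Proof.
move=> T0 TT uL.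
have sub : `[T, T'] `<=` (`[0, T'] : set R).
  by move=> s; rewrite /= !in_itv/= => /andP[Ts ->]; rewrite (le_trans T0 Ts).
have ia := Rintegrable_action z uL.
have ia' : (fun s => \sum_i u i s * p i z s) \Rint `[T, T'].
  by apply: RintegrableS ia.
rewrite (Rintegral_split T0 TT)// (dual_norm_split _ T0 TT).
rewrite addrAC subrr add0r addrAC subrr add0r.
apply: (le_trans (le_normr_Rintegral _ ia')) => //.
rewrite -RintegralZl//; last exact: Rintegrable_density.
apply: le_Rintegral_ae => //.
- exact: integrable_norm.
- by apply: RintegrableZ => //; exact: Rintegrable_density.
- apply: ae_imply (action_le z uL) => t h; rewrite /= in_itv/= => /andP[Tt tT].
  by apply: h; rewrite tT (le_trans T0 Tt).
Qed.

Lemma Rintegrable_control_gap (T L M : R) u v i z : control_bound T L u -> control_bound T M v ->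
  (fun s => `|u i s - v i s| * `|p i z s|) \Rint `[0, T].
Proof.
move=> uL vM.
apply: (@eq_Rintegrable _ _ _ mu (fun s => `|u i s * p i z s - v i s * p i z s|)) => [s|].
  by rewrite -mulrBl normrM.
by apply: integrable_norm; apply: RintegrableB => //; exact: Rintegrable_action_term.
Qed.

(** How far a control that is nearly feasible is from a bang-bang one: both controls
    have the same moment in the direction [z], up to the difference of the horizons,
    and the second one makes its moment as large as its bound allows. *)
Lemma control_gap (T T' L M : R) u v z : 0 <= T -> 0 <= T' -> 0 <= L ->
  control_bound T L u -> control_bound T' L u -> control_bound T M v ->
  moment T' u z = 0 -> M * N T z + inner z y0 <= 0 ->
  {ae mu, forall t : R, 0 <= t <= T -> forall i, v i t * p i z t = k i * M * `|p i z t|} ->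
  \int[mu]_(s in `[0, T]) (\sum_i `|u i s - v i s| * `|p i z s|) <=
    L * `|N T' z - N T z| + 2 * Num.max (L - M) 0 * N T z.
Proof.
move=> T0 T'0 L0 uT uT' vM mom le0 bang.
pose x := Num.max (L - M) 0.
have iw c : (fun s => c * w z s) \Rint `[0, T] by apply: RintegrableZ => //; exact: Rintegrable_density.
have iu := Rintegrable_action z uT.
have iuv : (fun s => \sum_i `|u i s - v i s| * `|p i z s|) \Rint `[0, T].
  by apply: Rintegrable_sum => // i; exact: Rintegrable_control_gap uT vM.
have pointwise : {ae mu, forall t : R, `[0, T]%classic t ->
    \sum_i `|u i t - v i t| * `|p i z t| <=
      (M * w z t - \sum_i u i t * p i z t) + 2 * x * w z t}.
  have ub := ae_forall (fun i => ae_itv_oo_cc (uT i).2).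
  apply: ae_imply2 bang ub => t bt ut; rewrite /= in_itv/= => tT.
  rewrite /w !mulr_sumr -sumrB -big_split/=; apply: ler_sum => i _.
  rewrite -normrM mulrBl bt//.
  have : `|u i t * p i z t| <= k i * L * `|p i z t| by rewrite normrM ler_wpM2r// ut.
  rewrite ler_norml => /andP[_ uL].
  have xL : L - M <= x by rewrite le_max lexx.
  have x0 : 0 <= x by rewrite le_max lexx orbT.
  have kp : 0 <= k i * `|p i z t| by rewrite mulr_ge0// ltW.
  have h1 : 0 <= x * (k i * `|p i z t|) by rewrite mulr_ge0.
  have h2 : (L - M) * (k i * `|p i z t|) <= x * (k i * `|p i z t|) by rewrite ler_wpM2r.
  rewrite ler_norml; apply/andP; split; lra.
apply: (@le_trans _ _ (\int[mu]_(s in `[0, T])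
    ((M * w z s - \sum_i u i s * p i z s) + 2 * x * w z s))).
  apply: le_Rintegral_ae => //.
  by apply: RintegrableD => //; apply: RintegrableB.
rewrite RintegralD//; last exact: RintegrableB.
rewrite RintegralB// !RintegralZl//; try exact: Rintegrable_density.
rewrite -/(N T z) lerD2r.
have : `|\int[mu]_(s in `[0, T']) (\sum_i u i s * p i z s) -
    \int[mu]_(s in `[0, T]) (\sum_i u i s * p i z s)| <= L * `|N T' z - N T z|.
  have [TT|/ltW TT] := leP T T'.
    rewrite [X in _ <= _ * X]ger0_norm ?subr_ge0 ?dual_norm_mono//.
    exact: action_horizon_gap.
  rewrite distrC [X in _ <= _ * X]distrC.
  rewrite [X in _ <= _ * X]ger0_norm ?subr_ge0 ?dual_norm_mono//.
  exact: action_horizon_gap.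
rewrite ler_norml => /andP[_]; move: mom; rewrite /moment; lra.
Qed.

Lemma dual_norm_coercive (T : R) : 0 < T ->
  exists2 c : R, 0 < c & forall z : V, c * `|z| <= N T z.
Proof.
move=> T0; have [z _|z z1 zmin] := @sphere_min R m (N T).
  by apply: dual_norm_continuous; exact: ltW.
exists (N T z); first by rewrite dual_norm_gt0// -normr_eq0 z1 oner_neq0.
move=> h; have [->|h0] := eqVneq h 0; first by rewrite normr0 mulr0 dual_norm_ge0.
have nh : 0 < `|h| by rewrite normr_gt0.
rewrite -ler_pdivlMr// mulrC; have := zmin (`|h|^-1 *: h).
rewrite dual_normZ normfV normr_id; apply.
by rewrite normrZ normfV normr_id mulVf// gt_eqF.
Qed.

Lemma dual_norm_dist (B : R) : exists2 C : R, 0 <= C &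
  forall (T T' : R) (z : V), 0 <= T <= B -> 0 <= T' <= B ->
    `|N T' z - N T z| <= C * `|T' - T| * `|z|.
Proof.
have [C C0 hC] := dual_norm_lipschitz B; exists C => // T T' z.
wlog TT : T T' / T <= T' => [H hT hT'|/andP[T0 _] /andP[_ T'B]].
  by have [|/ltW] := leP T T' => h; [|rewrite distrC [X in _ * X * _]distrC]; exact: H.
rewrite !ger0_norm ?subr_ge0 ?dual_norm_mono//.
by rewrite lerBlDl; exact: hC.
Qed.

(** The moment of [v] in the direction [x] gives [L N t x = - <x, y0> <= M N T x], hence
    [L <= M + a |t - T|], because [N] is Lipschitz in the horizon and dominates the
    norm of [x] uniformly in [t >= T / 2].  The bound on the gap follows by
    [control_gap]. *)
Lemma gap_estimate (T M : R) v z : 0 < T -> 0 < M -> control_bound T M v ->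
  (forall h, moment T v h = 0) -> M * N T z + inner z y0 <= 0 ->
  exists C K : R, forall (t L : R) u (x : V), T / 2 <= t <= 2 * T -> 0 <= L ->
    control_bound T L u -> control_bound t L u -> moment t u z = 0 ->
    x != 0 -> L * N t x + inner x y0 = 0 ->
    L <= K /\
    \int[mu]_(s in `[0, T]) (\sum_i `|u i s - v i s| * `|p i z s|) <= C * `|t - T|.
Proof.
move=> T0 M0 vM mom le0.
have bang := bang_bang (ltW T0) vM (mom z) le0.
have T20 : 0 < T / 2 by rewrite divr_gt0.
have [c c0 hc] := dual_norm_coercive T20.
have [C C0 hC] := dual_norm_dist (2 * T).
pose a := M * C / c; have a0 : 0 <= a by rewrite divr_ge0 ?mulr_ge0// ltW.
exists ((M + a * T) * C * `|z| + 2 * a * N T z), (M + a * T).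
move=> t L u x /andP[Tt tT] L0 uT ut mu_ x0 Lx.
have T_0 := T0; have t0 : 0 <= t by lra.
have hT : 0 <= T <= 2 * T by apply/andP; split; lra.
have ht : 0 <= t <= 2 * T by rewrite t0.
have dT : `|t - T| <= T by rewrite ler_norml; apply/andP; split; lra.
have nx : 0 < `|x| by rewrite normr_gt0.
have Nt : c * `|x| <= N t x.
  by apply: (le_trans (hc x)); apply: dual_norm_mono => //; exact: ltW.
have Ntx : 0 < N t x by apply: lt_le_trans Nt; rewrite mulr_gt0.
have La : L - M <= a * `|t - T|.
  have := moment_bound vM (mom x); rewrite ler_norml => /andP[h1 _].
  have := hC _ _ x ht hT; rewrite distrC ler_norml => /andP[h2 _].
  have h3 : M * (N T x - N t x) <= M * (C * `|T - t| * `|x|) by rewrite ler_pM2l//; lra.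
  have h4 : M * (C * `|T - t| * `|x|) <= a * `|T - t| * N t x.
    have -> : M * (C * `|T - t| * `|x|) = a * `|T - t| * (c * `|x|).
      by rewrite /a; field; rewrite gt_eqF.
    by rewrite ler_wpM2l// mulr_ge0.
  rewrite -(ler_pM2r Ntx) [`|t - T|]distrC; lra.
have LK : L <= M + a * T.
  have : a * `|t - T| <= a * T by rewrite ler_wpM2l.
  lra.
split=> //.
apply: (le_trans (control_gap (ltW T0) t0 L0 uT ut vM mu_ le0 bang)).
rewrite [leRHS]mulrDl; apply: lerD.
  have h := hC _ _ z hT ht.
  apply: (@le_trans _ _ ((M + a * T) * (C * `|t - T| * `|z|))).
    apply: (@le_trans _ _ ((M + a * T) * `|N t z - N T z|)); first by rewrite ler_wpM2r.
    by rewrite ler_wpM2l// (le_trans L0 LK).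
  by rewrite le_eqVlt; apply/orP; left; apply/eqP; ring.
have : Num.max (L - M) 0 <= a * `|t - T| by rewrite ge_max La mulr_ge0.
have := dual_norm_ge0 T z; nra.
Qed.

End MomentProblem.

(** * Lebesgue norms on an interval *)

Section LpNorms.
Variable R : realType.
Notation mu := (@lebesgue_measure R).
Notation "f \Rint D" := (mu.-integrable D (EFin \o f)) (at level 50).
Implicit Types (f g : R -> R) (T C : R).

Lemma lebesgue_setT_gt0 : (0 < mu [set: R])%E.
Proof. by rewrite -set_itvNyy lebesgue_measure_itv/= ltry. Qed.

Lemma Lp_norm_oo_le T f C : 0 <= C ->
  {ae mu, forall t : R, 0 < t < T -> `|f t| <= C} -> (Lp_norm +oo T f <= C%:E)%E.
Proof.
move=> C0 fC; rewrite /Lp_norm unlock lebesgue_setT_gt0.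
apply/ess_supP; apply: ae_imply fC => t h; rewrite /= lee_fin patchE.
by case: ifPn => [|_]; [rewrite inE/= in_itv/=; exact: h|rewrite normr0].
Qed.

Lemma ae_le_Lp_norm_oo T f :
  {ae mu, forall t : R, 0 < t < T -> (`|f t|%:E <= Lp_norm +oo T f)%E}.
Proof.
rewrite /Lp_norm unlock lebesgue_setT_gt0.
apply: ae_imply (ess_sup_ge mu (abse \o (EFin \o (f \_ `]0, T[)))) => t h tT.
by apply: le_trans h; rewrite /= patchE mem_set//= in_itv.
Qed.

Lemma Lp_norm_oo_cst T f C : 0 < T -> 0 <= C ->
  {ae mu, forall t : R, 0 < t < T -> `|f t| = C} -> Lp_norm +oo T f = C%:E.
Proof.
move=> T0 C0 fC; apply/eqP; rewrite eq_le; apply/andP; split.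
  by apply: Lp_norm_oo_le => //; apply: ae_imply fC => t h tT; rewrite h.
have [t [tT [<- //]]] := @ae_itv_exists R T
  (fun t => `|f t| = C /\ (`|f t|%:E <= Lp_norm +oo T f)%E) T0
  (ae_imply2 (fun t h1 h2 tT => conj (h1 tT) (h2 tT)) fC (ae_le_Lp_norm_oo T f)).
Qed.

Lemma Rintegrable_bounded_sqr T f C : measurable_fun (`]0, T[ : set R) f ->
  {ae mu, forall t : R, 0 < t < T -> `|f t| <= C} -> (fun t => f t ^+ 2) \Rint `[0, T].
Proof.
move=> mf fC; apply: (@Rintegrable_bounded_oo _ _ _ (C ^+ 2)); first exact: measurable_funX.
apply: ae_imply fC => t h /h fC; rewrite normrX.
by rewrite ler_sqr ?nnegrE// (le_trans _ fC).
Qed.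

Lemma Lp_norm_2E T f C : measurable_fun (`]0, T[ : set R) f ->
  {ae mu, forall t : R, 0 < t < T -> `|f t| <= C} ->
  Lp_norm 2%:E T f = (Num.sqrt (\int[mu]_(t in `[0, T]) f t ^+ 2))%:E.
Proof.
move=> mf fC; have f2 := Rintegrable_bounded_sqr mf fC.
rewrite /Lp_norm unlock.
have -> : (\int[mu]_x `|(EFin \o f \_ `]0%R, T[) x| `^ 2 =
    \int[mu]_(x in `]0%R, T[) (f x ^+ 2)%:E)%E.
  rewrite [RHS]integral_mkcond; apply: eq_integral => x _.
  rewrite /= /patch; case: (x \in _) => /=; last by rewrite normr0 powR0.
  by rewrite powR_mulrn// real_normK// num_real.
have f2' : (fun t => f t ^+ 2) \Rint `]0, T[.
  by apply: RintegrableS f2 => //; exact: subset_itv_oo_cc.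
rewrite -(Rintegral_oo_cc f2) -(fineK (integrable_fin_num _ f2'))//.
rewrite poweR12_sqrt/=; last by rewrite lee_fin; apply: Rintegral_ge0 => t _; exact: sqr_ge0.
by [].
Qed.

(** Convergence in [L^1] with a weight upgrades to [L^2]: where [j w >= 1] the square
    of a function bounded by [C] is at most [C j w |g|], and the set where [j w < 1]
    becomes negligible as [j] grows. *)
Lemma weighted_cvg_L2 T (g : nat -> R -> R) (w : R -> R) C : 0 <= C ->
  (forall n, measurable_fun (`]0, T[ : set R) (g n)) ->
  (forall n, {ae mu, forall t : R, 0 < t < T -> `|g n t| <= C}) ->
  continuous w -> (forall t, 0 <= w t) ->
  {ae mu, forall t : R, 0 < t < T -> w t != 0} ->
  \int[mu]_(t in `[0, T]) (`|g n t| * w t) @[n --> \oo] --> (0 : R) ->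
  Lp_norm 2%:E T (g n) @[n --> \oo] --> 0%E.
Proof.
move=> C0 mg gC cw w0 wn0 gw.
suff h : \int[mu]_(t in `[0, T]) g n t ^+ 2 @[n --> \oo] --> (0 : R).
  have -> : (fun n => Lp_norm 2%:E T (g n)) =
      (fun n => (Num.sqrt (\int[mu]_(t in `[0, T]) g n t ^+ 2))%:E).
    by apply/funext => n; exact: Lp_norm_2E (mg n) (gC n).
  apply/fine_cvgP; split; first exact: nearW.
  by rewrite -[X in _ --> X]sqrtr0; apply: continuous_cvg => //; exact: sqrt_continuous.
(* [q j] is at least [1 - j w] and tends to [0] wherever [w] does not vanish. *)
pose q j t := (1 + j%:R * w t)^-1.
have jw0 j t : 0 <= j%:R * w t by rewrite mulr_ge0.
have d0 j t : 0 < 1 + j%:R * w t by rewrite ltr_wpDr.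
have q0 j t : 0 <= q j t by rewrite invr_ge0 ltW.
have q1 j t : q j t <= 1 by rewrite invf_le1// lerDl.
have cq j : continuous (q j).
  move=> t; apply: cvgV; first by rewrite gt_eqF.
  apply: cvgD; first exact: cvg_cst.
  by apply: cvgM; [exact: cvg_cst|exact: cw].
have iq j : q j \Rint `[0, T] by exact: Rintegrable_continuous.
have igw n : (fun t => `|g n t| * w t) \Rint `[0, T].
  apply: eq_Rintegrable (Rintegrable_mul_continuous _ cw) => [t|]; first by rewrite mulrC.
  by apply: integrable_norm; exact: Rintegrable_bounded_oo (mg n) (gC n).
have key n j : \int[mu]_(t in `[0, T]) g n t ^+ 2 <=
    C * j%:R * \int[mu]_(t in `[0, T]) (`|g n t| * w t) +
    C ^+ 2 * \int[mu]_(t in `[0, T]) q j t.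
  rewrite -!RintegralZl// -RintegralD//; [|exact: RintegrableZ|exact: RintegrableZ].
  apply: le_Rintegral_ae => //.
  - exact: Rintegrable_bounded_sqr (mg n) (gC n).
  - by apply: RintegrableD => //; exact: RintegrableZ.
  apply: ae_imply (ae_itv_oo_cc (gC n)) => t h; rewrite /= in_itv/= => /h {}h.
  rewrite -real_normK ?num_real//; set x := `|g n t| in h *.
  have x0 : 0 <= x by exact: normr_ge0.
  have hq : 1 - j%:R * w t <= q j t.
    rewrite -(ler_pM2r (d0 j t)) mulVf ?gt_eqF//.
    have := sqr_ge0 (j%:R * w t); rewrite expr2; lra.
  have jw := jw0 j t.
  have := q0 j t; move: (q j t) hq => y hy y0.
  have : x ^+ 2 * 1 <= x ^+ 2 * (j%:R * w t + y) by rewrite ler_wpM2l ?sqr_ge0//; lra.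
  have : x * x * (j%:R * w t) <= C * x * (j%:R * w t) by rewrite !ler_wpM2r.
  have : x ^+ 2 * y <= C ^+ 2 * y by rewrite ler_wpM2r// ler_sqr ?nnegrE.
  rewrite expr2; lra.
have [||||_] := @Rdominated_cvg _ _ _ mu `[0, T] q (cst 0) 1 (measurable_itv _) (measure_itvcc 0 T).
- by move=> j; apply: measurable_funTS; exact: continuous_measurable_fun.
- exact: measurable_cst.
- apply: ae_imply (ae_itv_oo_cc wn0) => t wt; rewrite /= in_itv/= => /wt {}wt.
  have wt0 : 0 < w t by rewrite lt_neqAle eq_sym wt w0.
  apply/cvgrPdist_lt => e e0; near=> j.
  rewrite /= sub0r normrN ger0_norm// /q invf_plt ?posrE//.
  apply: (@le_lt_trans _ _ (j%:R * w t)); last by rewrite ltrDr.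
  rewrite -ler_pdivrMr//.
  by near: j; exact: nbhs_infty_ger.
- by apply: nearW => t _ j; rewrite ger0_norm.
rewrite Rintegral_cst//= mul0r => cvq.
apply/cvgrPdist_lt => e e0.
have C1 : 0 < C ^+ 2 + 1 by rewrite ltr_wpDl// sqr_ge0.
have [j hj] : exists j, \int[mu]_(t in `[0, T]) q j t < e / 2 / (C ^+ 2 + 1).
  have he : 0 < e / 2 / (C ^+ 2 + 1) by rewrite !divr_gt0.
  have [j _ hj] := cvgr_lt _ cvq _ he.
  by exists j; apply: hj => /=.
have Cj : 0 < C * j%:R + 1 by rewrite ltr_wpDl// mulr_ge0.
have : \forall n \near \oo, \int[mu]_(t in `[0, T]) (`|g n t| * w t) < e / 2 / (C * j%:R + 1).
  by apply: cvgr_lt gw _ _; rewrite !divr_gt0.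
apply: filterS => n hn.
rewrite sub0r normrN ger0_norm; last by apply: Rintegral_ge0 => t _; exact: sqr_ge0.
apply: (le_lt_trans (key n j)).
have I0 : 0 <= \int[mu]_(t in `[0, T]) (`|g n t| * w t).
  by apply: Rintegral_ge0 => t _; rewrite mulr_ge0.
have J0 : 0 <= \int[mu]_(t in `[0, T]) q j t by apply: Rintegral_ge0 => t _.
move: hn hj I0 J0; rewrite !ltr_pdivlMr//.
move: (Rintegral _ _ _) (Rintegral _ _ _) => a c; lra.
Unshelve. all: by end_near. Qed.

End LpNorms.

(** * Bisection *)

Section Bisection.
Variables (R : realType) (Mt : R -> \bar R) (M t0 : R) (K : nat).
Hypotheses (t0_gt0 : 0 < t0) (K_gt0 : (0 < K)%N).
Notation br := (bracket Mt M t0 K).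

Lemma bracket_length n : (br n).2 - (br n).1 = K%:R * t0 / 2 ^+ n.
Proof.
elim: n => [|n IH] /=; first by rewrite subr0 expr0 divr1.
move: IH; case: (br n) => a b /= IH.
by case: ifP => _ /=; rewrite exprS invfM mulrCA -IH; field.
Qed.

Lemma bracket_ge0 n : 0 <= (br n).1.
Proof.
elim: n => [|n IH] //=; move: (bracket_length n) IH.
case: (br n) => a b /= e a0; case: ifP => _ //=.
have : 0 < b - a by rewrite e divr_gt0 ?exprn_gt0// mulr_gt0// ltr0n.
by lra.
Qed.

Lemma bisection_gt0 n : 0 < bisection Mt M t0 K n.
Proof.
case: n => [|n] //=; have := bracket_ge0 n; have := bracket_length n.
have : 0 < K%:R * t0 / 2 ^+ n by rewrite divr_gt0 ?exprn_gt0// mulr_gt0// ltr0n.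
by move: (_ / _) (br n).1 (br n).2 => l a b; lra.
Qed.

(** The bracket always contains [T]: comparing [Mt] with [M] at the midpoint amounts to
    comparing [T] with the midpoint. *)
Lemma bisection_cvg (T : R) : T <= K%:R * t0 -> 0 <= T ->
  (forall t : R, 0 < t -> (Mt t <= M%:E)%E = (T <= t)) ->
  bisection Mt M t0 K n @[n --> \oo] --> T.
Proof.
move=> TK T0 MtE; have inv n : (br n).1 <= T <= (br n).2.
  elim: n => [|n IH] /=; first by rewrite T0.
  have := bisection_gt0 n.+1; rewrite /=; move: IH.
  case: (br n) => a b /= /andP[aT Tb] ab.
  rewrite ltNge MtE//; case: (leP T ((a + b) / 2)) => h /=; last by rewrite Tb andbT ltW.
  by rewrite aT h.
rewrite -cvg_shiftS; apply/cvgrPdist_lt => e e0.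
have : \forall n \near \oo, K%:R * t0 / 2 ^+ n < e.
  have h : K%:R * t0 / 2 ^+ n @[n --> \oo] --> K%:R * t0 * 0.
    apply: cvgM; first exact: cvg_cst.
    have -> : (fun n => (2 ^+ n)^-1) = (fun n => (2^-1 : R) ^+ n).
      by apply/funext => n; rewrite exprVn.
    by apply: cvg_expr; rewrite ger0_norm ?invr_ge0// invf_lt1// ltr1n.
  by apply: (cvgr_lt _ h); rewrite mulr0.
apply: filterS => n; rewrite -bracket_length /= => h.
have := inv n; move: (br n) h => [a b] /= h /andP[aT Tb].
rewrite ltr_norml; apply/andP; split; lra.
Qed.

End Bisection.

(** * Optimal time and minimal norm *)

Section OptimalTime.
Variable R : realType.
Notation mu := (@lebesgue_measure R).
Variables (m d : nat) (A : R -> 'M[R]_m.+1) (b : 'I_d.+1 -> 'cV[R]_m.+1).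
Variables (y0 : 'cV[R]_m.+1) (k : 'I_d.+1 -> R) (F : R -> 'M[R]_m.+1).
Hypothesis spec : dual_flow_spec A b y0 F.
Hypothesis y0_neq0 : y0 != 0.
Hypothesis k_first : k ord0 = 1.
Hypothesis k_gt0 : forall i, 0 < k i.
Notation V := 'cV[R]_m.+1.

Definition flow_pairing (i : 'I_d.+1) (z : V) (t : R) : R := inner (b i) (F t *m z).

Notation p := flow_pairing.
Notation N := (dual_norm k p).
Notation moment := (moment p y0).
Notation sign_control := (sign_control k p).

Lemma flow_pairingD i (z z' : V) (s : R) : p i (z + z') s = p i z s + p i z' s.
Proof. by rewrite /p mulmxDr innerC innerDl ![inner _ (b i)]innerC. Qed.

Lemma flow_pairingZ i (c : R) (z : V) (s : R) : p i (c *: z) s = c * p i z s.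
Proof. by rewrite /p -scalemxAr innerC innerZl innerC. Qed.

Lemma flow_pairing_continuous i z : continuous (p i z).
Proof. exact: (dflow_continuous spec). Qed.

Lemma flow_pairing_ae_neq0 i (z : V) : z != 0 ->
  {ae mu, forall t : R, 0 < t -> p i z t != 0}.
Proof. exact: (dflow_neq0 spec). Qed.

Lemma weighted_integral_flow (T : R) phi : 0 <= T -> dual_solution A phi ->
  weighted_integral b k T phi = N T (phi 0).
Proof.
move=> T0 phiS; rewrite /N -Rintegral_oo_cc; last first.
  exact: (Rintegrable_density _ flow_pairing_continuous).
apply: eq_Rintegral => s; rewrite mem_setE/= in_itv/= => /andP[s0 _].
by apply: eq_bigr => i _; rewrite (dflow_unique spec phiS (ltW s0)).
Qed.

(** As a function of the initial value, [J^T] no longer refers to the terminal condition. *)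
Lemma J_flow (T : R) (h : V) : 0 <= T ->
  J A b y0 k T (F T *m h) = 2^-1 * N T h ^+ 2 + inner h y0.
Proof.
move=> T0; have [phiS phiT] : dual_solution A (dual_flow A T (F T *m h)) /\
    dual_flow A T (F T *m h) T = F T *m h.
  apply: (@xgetPex _ _ [set phi | dual_solution A phi /\ phi T = F T *m h]).
  by exists (fun t => F t *m h); split => //; exact: (dflow_solution spec).
have e : dual_flow A T (F T *m h) 0 = h.
  move: phiT; rewrite (dflow_unique spec phiS T0).
  by move=> /(congr1 (mulmx (invmx (F T)))); rewrite !mulKmx// (dflow_unit spec).
by rewrite /J weighted_integral_flow// e.
Qed.

Lemma J_minimizer (T : R) phi : 0 < T -> dual_solution A phi ->
  (forall z, J A b y0 k T (phi T) <= J A b y0 k T z) ->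
  [/\ phi 0 != 0, N T (phi 0) * N T (phi 0) + inner (phi 0) y0 = 0 &
      forall h, 0 <= N T (phi 0) * N T h + inner h y0].
Proof.
move=> T0 phiS phimin; have T0' := ltW T0.
apply: (minimizer_first_order k_gt0 flow_pairingZ flow_pairing_continuous T0 y0_neq0).
by move=> h; have := phimin (F T *m h); rewrite (dflow_unique spec phiS T0') !J_flow.
Qed.

Lemma admissible_bound (T M : R) u : admissible_U k M u -> control_bound k T M u.
Proof.
move=> uU i; have [mu_ ub] := uU i; split.
  by apply: measurable_funS mu_ => //; apply: subset_itvl.
by apply: ae_imply ub => t h /andP[t0 _]; exact: h.
Qed.

Lemma bound_nonneg (T L : R) u : 0 < T -> (forall h, moment T u h = 0) ->
  control_bound k T L u -> forall h, 0 <= L * N T h + inner h y0.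
Proof.
move=> T0 mom uL h.
have := moment_bound flow_pairing_continuous uL (mom h).
by rewrite ler_norml => /andP[h1 _]; lra.
Qed.

Lemma sign_control_admissible (L M : R) z : 0 <= L -> L <= M ->
  admissible_U k M (sign_control L z).
Proof.
move=> L0 LM i; split.
  apply: measurable_funS (sign_control_measurable k flow_pairing_continuous L z i) => //.
apply: nearW => t _; apply: (le_trans (sign_control_le p k_gt0 z i t L0)).
by rewrite ler_wpM2l// ltW.
Qed.

Lemma admissible_steers (T M : R) u : 0 <= T -> admissible_U k M u ->
  (forall h, moment T u h = 0) -> steers_to_zero A b y0 `[0, +oo[ T u.
Proof.
move=> T0 uU mom.
apply: (dflow_steers spec (C := (\sum_i k i) * `|M|)) => // i; first by case: (uU i).
apply: ae_imply (uU i).2 => t h /h {}h; apply: (le_trans h).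
apply: (le_trans (ler_norm _)); rewrite normrM ler_wpM2r// gtr0_norm//.
by rewrite (bigD1 i)//= lerDl; apply: sumr_ge0 => j _; exact: ltW.
Qed.

(** The direct implication is [moment_bound] for all competitors; the converse holds
    because the sign control of [moment_feasible] has constant modulus in its first
    component, which makes it a competitor of norm [L <= M]. *)
Lemma min_norm_leP (T M : R) : 0 < T ->
  (min_norm A b y0 k T <= M%:E)%E <-> forall h, 0 <= M * N T h + inner h y0.
Proof.
move=> T0; have T0' := ltW T0; split=> [minM h|Mge0].
  have [->|h0] := eqVneq h 0.
    rewrite inner0l (dual_norm0 _ flow_pairingZ flow_pairing_continuous).
    by rewrite mulr0 addr0.
  have Nh := dual_norm_gt0 k_gt0 flow_pairing_continuous flow_pairing_ae_neq0 T0 h0.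
  suff : ((- inner h y0 / N T h)%:E <= M%:E)%E.
    by rewrite lee_fin ler_pdivrMr//; lra.
  apply: le_trans minM; apply/ereal_infP => _ [v [vV vS] <-].
  have v0 := (vV ord0).
  have [L LE] : exists L : R, Lp_norm +oo T (v ord0) = L%:E.
    have [_ fin _] := v0; exists (fine (Lp_norm +oo T (v ord0))); rewrite fineK//.
    by rewrite ge0_fin_numE//; exact: Lnorm_ge0.
  rewrite LE lee_fin ler_pdivrMr//.
  have vL : control_bound k T L v.
    move=> i; have [mv _ vb] := vV i; split => //.
    by apply: ae_imply vb => t h1 /h1; rewrite LE -EFinM lee_fin.
  have mom : moment T v h = 0 by apply: (dflow_moment spec T0' _ vS).
  have := moment_bound flow_pairing_continuous vL mom.
  by rewrite ler_norml => /andP[h1 _]; lra.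
have [z [L [z0 L0 LM mom]]] := moment_feasible k_gt0 flow_pairingD flow_pairingZ
  flow_pairing_continuous flow_pairing_ae_neq0 T0 y0_neq0 Mge0.
have L0' := ltW L0.
have uE : Lp_norm +oo T (sign_control L z ord0) = L%:E.
  apply: Lp_norm_oo_cst => //; apply: ae_imply (flow_pairing_ae_neq0 ord0 z0).
  move=> t h /andP[/h pt _].
  by rewrite normrM k_first mul1r normr_sg pt mulr1 ger0_norm.
apply: (@le_trans _ _ L%:E); last by rewrite lee_fin.
rewrite -uE; apply: ereal_inf_lbound; exists (sign_control L z) => //; split.
  move=> i; split.
  - by have [] := admissible_bound T (sign_control_admissible z L0' (lexx L)) i.
  - apply: (@le_lt_trans _ _ (k i * L)%:E); last exact: ltry.
    apply: Lp_norm_oo_le; first by rewrite mulr_ge0// ltW.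
    by apply: nearW => t _; exact: sign_control_le.
  - rewrite uE -EFinM; apply: nearW => t _; rewrite lee_fin.
    exact: sign_control_le.
have [y [cy hy] yT] := admissible_steers T0' (sign_control_admissible z L0' (lexx L)) mom.
have sub : `[0, T] `<=` (`[0, +oo[ : set R) by apply: subset_itvl.
exists y => //; split; first exact: continuous_subspaceW cy.
by move=> t tT; apply: hy; exact: sub.
Qed.

(** By [moment_feasible] and [moment_bound] the times at which [y0] can be steered to [0]
    within the bound [M] are those with [M * N t h + <h, y0> >= 0] for all [h]; as
    [N t h] increases with [t], they form a half-line starting at the optimal time.
    The latter is positive since no control moves the state instantly. *)
Lemma optimal_controlP (M : R) u : optimal_control A b y0 k M u ->
  exists T : R, [/\ 0 < T, opt_time A b y0 k M = T%:E, control_bound k T M u,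
    forall h, moment T u h = 0 &
    forall t : R, 0 < t -> (forall h, 0 <= M * N t h + inner h y0) <-> T <= t].
Proof.
move=> [uU [T TE uS]]; exists T.
have T0' : 0 <= T.
  rewrite -lee_fin -TE; apply/ereal_infP => _ [t [t0 _] <-].
  by rewrite lee_fin ltW.
have mom h : moment T u h = 0.
  by apply: (dflow_moment spec T0' _ uS); apply: subset_itvl.
have T0 : 0 < T.
  rewrite lt_neqAle T0' andbT; apply/eqP => TO; have := mom y0.
  rewrite /moment -TO Rintegral_itv1 addr0 => /eqP.
  by rewrite gt_eqF// inner_gt0.
have uT := admissible_bound T uU.
split=> // t t0; split=> [tge0|Tt h].
  have [z [L [_ L0 LM momL]]] := moment_feasible k_gt0 flow_pairingD flow_pairingZ
    flow_pairing_continuous flow_pairing_ae_neq0 t0 y0_neq0 tge0.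
  rewrite -lee_fin -TE; apply: ereal_inf_lbound; exists t => //; split => //.
  have sU := sign_control_admissible z (ltW L0) LM; exists (sign_control L z) => //.
  exact: (admissible_steers (ltW t0) sU momL).
have := bound_nonneg T0 mom uT h.
have M0 : 0 <= M.
  have := @ae_itv_exists R T (fun t => `|u ord0 t| <= k ord0 * M) T0 (uT ord0).2.
  by move=> [s [_]]; rewrite k_first mul1r; exact: le_trans.
have := @dual_norm_mono _ _ _ k p k_gt0 flow_pairing_continuous T t h T0' Tt.
move=> h1; have := ler_wpM2l M0 h1; lra.
Qed.

(** At a zero of the pairing the quotient [x / |x|] is [0 / 0 = 0], which agrees with the
    sign of [0]. *)
Lemma feedback_sign_control (T : R) phi u i : 0 <= T -> dual_solution A phi ->
  {ae mu, forall t : R, 0 < t -> u t = weighted_integral b k T phi *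
    (k i * inner (b i) (phi t) / `|inner (b i) (phi t)|)} ->
  {ae mu, forall t : R, 0 < t -> u t = sign_control (N T (phi 0)) (phi 0) i t}.
Proof.
move=> T0 phiS; apply: ae_imply => t ut t0; rewrite ut// weighted_integral_flow//.
rewrite (dflow_unique spec phiS (ltW t0)) /sign_control -/(p i (phi 0) t) -mulrA.
move: (p i (phi 0) t) => x; congr (_ * (_ * _)).
have [->|x0] := eqVneq x 0; first by rewrite mul0r sgr0.
by rewrite [X in X / _]numEsg mulfK// normr_eq0.
Qed.

Lemma ae_sign_control_bound (T L : R) u z : 0 <= L ->
  (forall i, measurable_fun (`]0, +oo[ : set R) (u i)) ->
  (forall i, {ae mu, forall t : R, 0 < t -> u i t = sign_control L z i t}) ->
  control_bound k T L u.
Proof.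
move=> L0 mu_ uE i; split.
  by apply: measurable_funS (mu_ i) => //; apply: subset_itvl.
by apply: ae_imply (uE i) => s us /andP[s0 _]; rewrite us// sign_control_le.
Qed.

Lemma ae_sign_control_moment (T L : R) u z h : control_bound k T L u -> 0 <= L ->
  (forall i, {ae mu, forall t : R, 0 < t -> u i t = sign_control L z i t}) ->
  moment T u h = moment T (sign_control L z) h.
Proof.
move=> uL L0 uE; congr (_ + _); apply: eq_Rintegral_ae => //.
- exact: (Rintegrable_action flow_pairing_continuous h uL).
- apply: (Rintegrable_action flow_pairing_continuous h).
  exact: (sign_control_bound k_gt0 flow_pairing_continuous T z L0).
- have uE' : {ae mu, forall t : R, forall i, 0 < t -> u i t = sign_control L z i t}.
    exact: ae_forall.
  apply: ae_imply2 uE' (ae_neq 0) => t ut tn0; rewrite /= in_itv/= => /andP[t0 _].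
  by apply: eq_bigr => i _; rewrite ut// lt_neqAle eq_sym tn0.
Qed.

End OptimalTime.

(** * Convergence of the bisection controls *)

Unset Implicit Arguments.

Theorem theorem1p2 (R : realType) (m d : nat)
  (A : R -> 'M[R]_m.+1) (b : 'I_d.+1 -> 'cV[R]_m.+1) (y0 : 'cV[R]_m.+1)
  (k : 'I_d.+1 -> R)
  (A_cont : {within `[0, +oo[, continuous A})
  (A_analytic : real_analytic_on `]0, +oo[ A)
  (A_conti : conti A b)
  (y0_neq0 : y0 != 0)
  (k_first : k ord0 = 1)
  (k_noninc : forall i j : 'I_d.+1, (i <= j)%N -> k j <= k i)
  (k_gt0 : forall i : 'I_d.+1, 0 < k i)
  (M : R) (M_gt0 : 0 < M)
  (t0 : R) (t0_gt0 : 0 < t0)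
  (K : nat) (K_first : first_multiple (min_norm A b y0 k) M t0 K)
  (t_ : nat -> R) (t_def : t_ = bisection (min_norm A b y0 k) M t0 K)
  (ustar : 'I_d.+1 -> R -> R) (ustar_opt : optimal_control A b y0 k M ustar)
  (zhat : nat -> 'cV[R]_m.+1)
  (zhat_min : forall n z, J A b y0 k (t_ n) (zhat n) <= J A b y0 k (t_ n) z)
  (phihat : nat -> R -> 'cV[R]_m.+1)
  (phihat_sol : forall n, dual_solution A (phihat n))
  (phihat_end : forall n, phihat n (t_ n) = zhat n)
  (u_ : nat -> 'I_d.+1 -> R -> R)
  (u_meas : forall n i, measurable_fun (`]0, +oo[ : set R) (u_ n i))
  (u_def : forall n i, {ae lebesgue_measure, forall t, 0 < t ->
     u_ n i t = weighted_integral b k (t_ n) (phihat n) *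
       (k i * inner (b i) (phihat n t) / `|inner (b i) (phihat n t)|)}) :
  (t_ n)%:E @[n --> \oo] --> opt_time A b y0 k M /\
  forall i : 'I_d.+1,
    Lp_norm 2%:E (fine (opt_time A b y0 k M)) (u_ n i \- ustar i) @[n --> \oo]
      --> 0%E.
Proof.
have [F spec] := dual_flow_exists y0 A_cont A_analytic A_conti.
have pD := flow_pairingD b F; have pZ := flow_pairingZ b F.
have pc := flow_pairing_continuous spec.
have [T [T0 TE vT vmom feasible]] := optimal_controlP spec y0_neq0 k_first k_gt0 ustar_opt.
have normP := min_norm_leP spec y0_neq0 k_first k_gt0 M.
have [K1 KM _] := K_first.
have Kt0 : 0 < K%:R * t0 by rewrite mulr_gt0// ltr0n.
have t_gt0 n : 0 < t_ n by rewrite t_def bisection_gt0.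
have cvt : t_ n @[n --> \oo] --> T.
  rewrite t_def; apply: bisection_cvg => //.
  - by apply/(feasible _ Kt0)/(normP _ Kt0); exact: ltW.
  - exact: ltW.
  - move=> t t_0; apply/idP/idP; first by move=> /(normP _ t_0) /(feasible _ t_0).
    by move=> Tt; apply/(normP _ t_0)/(feasible _ t_0).
split=> [|i]; rewrite TE.
  by apply/fine_cvgP; split => //; exact: nearW.
rewrite [fine _]/=.
pose L n := dual_norm k (flow_pairing b F) (t_ n) (phihat n 0).
have minimizer n := J_minimizer spec y0_neq0 k_gt0 (t_gt0 n) (phihat_sol n)
  (fun z => etrans (congr1 (fun x => J A b y0 k (t_ n) x <= _) (phihat_end n)) (zhat_min n z)).
have L0 n : 0 <= L n by exact: dual_norm_ge0.
have uE n j := feedback_sign_control spec (ltW (t_gt0 n)) (phihat_sol n) (u_def n j).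
have uB n t := ae_sign_control_bound k_gt0 t (L0 n) (u_meas n) (uE n).
have umom n h : moment (flow_pairing b F) y0 (t_ n) (u_ n) h = 0.
  have [z0 zE zge] := minimizer n.
  rewrite (ae_sign_control_moment spec k_gt0 h (uB n _) (L0 n) (uE n)).
  exact: (sign_control_moment k_gt0 pD pZ pc (flow_pairing_ae_neq0 spec)).
have [z z0 zle] : exists2 z, z != 0 &
    M * dual_norm k (flow_pairing b F) T z + inner z y0 <= 0.
  apply: (exhausting_direction k_gt0 pD pZ pc) => // t t_0 tT.
  by move/(feasible _ t_0); rewrite leNgt tT.
have [C [B gap]] := gap_estimate k_gt0 pD pZ pc
  (flow_pairing_ae_neq0 spec) T0 M_gt0 vT vmom zle.
have [n0 _ near_T] : \forall n \near \oo, T / 2 <= t_ n <= 2 * T.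
  near=> n; apply/andP; split; near: n.
    by apply: (cvgr_ge _ cvt); lra.
  by apply: (cvgr_le _ cvt); lra.
pose p := flow_pairing b F.
have gapn n : (n0 <= n)%N -> L n <= B /\
    \int[lebesgue_measure]_(s in `[0, T])
      (\sum_j `|u_ n j s - ustar j s| * `|p j z s|) <= C * `|t_ n - T|.
  move=> nn0; have [x0 xE _] := minimizer n.
  by apply: (gap (t_ n) (L n) (u_ n) (phihat n 0)) => //; exact: near_T.
(* From the rank [n0] on, [t_ n] lies in the range of [gap_estimate]. *)
rewrite -(cvg_shiftn n0).
apply: (@weighted_cvg_L2 R T (fun n => u_ (n + n0)%N i \- ustar i)
  (fun t => `|p i z t|) (k i * B + k i * M)) => //=.
- have [B0 _] := gapn n0 (leqnn n0).
  by rewrite -mulrDr mulr_ge0 ?addr_ge0 ?(le_trans (L0 n0) B0) ?ltW.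
- by move=> n; apply: measurable_funB; [exact: (uB _ T i).1|exact: (vT i).1].
- move=> n; apply: ae_imply2 (uB (n + n0)%N T i).2 (vT i).2 => t ut vt tT.
  apply: (le_trans (ler_normB _ _)); apply: lerD; last exact: vt.
  apply: (le_trans (ut tT)); rewrite ler_pM2l//.
  by have [] := gapn (n + n0)%N (leq_addl _ _).
- by move=> t; apply: cvg_norm; exact: pc.
- apply: ae_imply (flow_pairing_ae_neq0 spec i z0) => t h /andP[/h pt _].
  by rewrite normr_eq0.
apply: (@squeeze_cvgr _ _ _ _ (cst 0) (fun n => C * `|t_ (n + n0)%N - T|)).
- apply: nearW => n; apply/andP; split.
    by apply: Rintegral_ge0 => s _; rewrite mulr_ge0.
  apply: le_trans (gapn (n + n0)%N (leq_addl _ _)).2.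
  have iuv j := Rintegrable_control_gap pc j z (uB (n + n0)%N T) vT.
  apply: le_Rintegral_ae => //; first by apply: Rintegrable_sum => // j; exact: iuv.
  apply: nearW => s _; rewrite [leRHS](bigD1 i)//= lerDl.
  by apply: sumr_ge0 => j _; rewrite mulr_ge0.
- exact: cvg_cst.
- rewrite -[X in _ --> X](mulr0 C); apply: cvgM; first exact: cvg_cst.
  have h : t_ (n + n0)%N - T @[n --> \oo] --> T - T.
    by apply: cvgB; [rewrite (cvg_shiftn n0)|exact: cvg_cst].
  by rewrite -[X in _ --> X](@normr0 _ R) -(subrr T); exact: cvg_norm.
Unshelve. all: by end_near.
Qed.
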